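(* Let $h$ be a centered (possibly degenerate) Gaussian random variable satisfying $\mathbb{E}e^{2|h|}<\left(\max_{\beta\ge0}\frac{\beta}{\cosh^2\beta}\right)^{-1}$. The following statements hold: 1. Let $0<u<1$ and $\mathbb{E}h^2=0$. For $(\beta,\boldsymbol{\beta})\in\mathcal{R}_u$, there exists some $\mu\in(u,1)$ such that $\left<I(|m-\mu|\le\varepsilon)\right>$ and $\left<I(|m+\mu|\le\varepsilon)\right>$ converge to $1/2$ almost surely as $N\to\infty$ for all $0<\varepsilon<\mu$. 2. Let $1/2<u<1$ and $\mathbb{E}h^2\ne0$. For $(\beta,\boldsymbol{\beta})\in\mathcal{R}_u$, there exists some $\mu\in(u,1)$ such that $\left<I(|m-\mu|\le\varepsilon)\right>$ and $\left<I(|m+\mu|\le\varepsilon)\right>$ each converge weakly (in distribution) to a Bernoulli$(1/2)$ random variable as $N\to\infty$ for all $0<\varepsilon<\mu$.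
   Context: Let $\mathcal{B}=\{(\beta,\boldsymbol{\beta}):\boldsymbol{\beta}=(\beta_p)_{p\ge1}\subset\mathbb{R},\ \beta\ge 0,\ \sum_{p\ge1}2^p\beta_p^2<\infty\}$. Let $(h_i)$ be i.i.d. copies of a Gaussian random variable $h$ and $\boldsymbol{g}=(g_{i_1,\ldots,i_{2p}})$ i.i.d. standard Gaussians independent of $(h_i)$. For $\boldsymbol{\sigma}\in\Sigma_N=\{-1,+1\}^N$ set $m=m(\boldsymbol{\sigma})=N^{-1}\sum_{i\le N}\sigma_i$, $$H_N^{SK}(\boldsymbol{\sigma})=\sum_{p\ge1}\frac{\beta_p}{N^{p-1/2}}\sum_{1\le i_1,\ldots,i_{2p}\le N}g_{i_1,\ldots,i_{2p}}\sigma_{i_1}\cdots\sigma_{i_{2p}},\qquad H_N(\boldsymbol{\sigma})=\frac{\beta N}{2}m(\boldsymbol{\sigma})^2+H_N^{SK}(\boldsymbol{\sigma})+\sum_{i\le N}h_i\sigma_i.$$ $Z_N=\sum_{\boldsymbol{\sigma}}\exp H_N(\boldsymbol{\sigma})$, $G_N(\boldsymbol{\sigma})=\exp H_N(\boldsymbol{\sigma})/Z_N$, $F_N(\beta,\boldsymbol{\beta},h)=N^{-1}\mathbb{E}\ln Z_N$; $\left<\cdot\right>$ is the average with respect to $G_N$ (a random variable depending on $\boldsymbol{g}$ and $(h_i)$); $I(E)$ is the indicator of $E$. $F^{SK}(\boldsymbol{\beta},h)=\lim_{N\to\infty}F_N(0,\boldsymbol{\beta},h)$ (the limit is known to exist for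 every Gaussian $h$); for $x\in\mathbb{R}$, external field $x+h$ means $h_i$ is replaced by $x+h_i$. Let $\xi(x)=\sum_{p\ge1}\beta_p^2x^{2p}$. $\Omega(\beta,\boldsymbol{\beta},h)=\mathrm{Argmax}_{\mu\in[-1,1]}\{F^{SK}(\boldsymbol{\beta},\beta\mu+h)-\beta\mu^2/2\}$. $\mathcal{B}_d$ is the set of $(\beta,\boldsymbol{\beta})\in\mathcal{B}$ with $\beta>0$ such that either $|\Omega(\beta,\boldsymbol{\beta},h)|=1$ or $\Omega(\beta,\boldsymbol{\beta},h)=\{\mu,-\mu\}$ for some $0<\mu<1$. $\mathcal{B}'$ is the set of $(\beta,\boldsymbol{\beta})\in\mathcal{B}$ with $\beta>0$ and $\beta_p\ne0$ for all $p\ge1$. $\mathcal{B}_d'=\mathcal{B}_d\cap\mathcal{B}'$. Let $\alpha$ be defined by $\alpha\,\mathbb{E}\frac{1}{\cosh^2h}=1$ and, for $\mu\in[-1,1]$, $\beta\in(\alpha,\infty)$, let $f(\mu,\beta)=\ln2+\mathbb{E}\ln\cosh(\beta\mu+h)-\frac{\beta\mu^2}{2}$. For each $\beta>\alpha$, $f(\cdot,\beta)$ has a unique maximizer $\mu(\beta)\in(0,1)$ over $[0,1]$, and $\beta\mapsto\mu(\beta)$ is a continuous, strictly increasing bijection from $(\alpha,\infty)$ onto $(0,1)$. For $0<u<1$ let $\beta_u\in(\alpha,\infty)$ be the unique number with $\mu(\beta_u)=u$, and define $\delta_u(\beta)=f(\mu(\beta),\beta)-f(u,\beta)$ for $\beta\ge\beta_u$.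 Finally $$\mathcal{R}_u=\{(\beta,\boldsymbol{\beta})\in\mathcal{B}_d':\ \beta>\beta_u\ \text{and}\ \xi(1)<2\delta_u(\beta)\}.$$ *)

(* Defs.v *)
From HB Require Import structures.
From mathcomp Require Import all_boot all_order all_algebra.
From mathcomp Require Import all_classical all_reals all_analysis.

Set Implicit Arguments.
Unset Strict Implicit.
Unset Printing Implicit Defensive.

Import Order.TTheory GRing.Theory Num.Theory.
Import numFieldNormedType.Exports.

Local Open Scope classical_set_scope.
Local Open Scope ring_scope.

Definition cosh {R : realType} (x : R) : R := (expR x + expR (- x)) / 2.

Definition argmax {R : realType} (A : set R) (F : R -> R) : set R :=
  [set x | A x /\ forall y, A y -> F y <= F x].

Section probability_notions.
Context {d : measure_display} {T : measurableType d} {R : realType}.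
Variable P : probability T R.

(* Real-valued expectation; only meaningful for integrable variables. *)
Definition expect (X : T -> R) : R := fine ('E_P[X])%E.

Definition same_law (X Y : {RV P >-> R}) : Prop :=
  forall A : set R, measurable A -> distribution P X A = distribution P Y A.

(* [normal_prob 0 0] is the uniform law on [0, 1], so the degenerate Gaussian
   has to be split off. *)
Definition centered_gaussian (X : {RV P >-> R}) : Prop :=
  exists2 s : R, 0 <= s & forall A : set R, measurable A ->
    distribution P X A = (if s == 0 then \d_(0 : R) A else normal_prob 0 s A).

Definition standard_gaussian (X : {RV P >-> R}) : Prop :=
  forall A : set R, measurable A -> distribution P X A = normal_prob 0 1 A.

Definition mutually_independent (I : choiceType) (D : set I)
    (X : I -> {RV P >-> R}) : Prop :=
  forall (s : seq I) (A : I -> set R), uniq s -> (forall i, i \in s -> D i) ->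
    (forall i, measurable (A i)) ->
    P (\bigcap_(i in [set` s]) (X i @^-1` A i)) =
    (\prod_(i <- s) distribution P (X i) (A i))%E.

Definition cvg_weakly (X : nat -> T -> R) {d' : measure_display}
    {S : measurableType d'} (Q : probability S R) (Y : S -> R) : Prop :=
  forall phi : R -> R, continuous phi ->
    (exists M : R, forall x, `|phi x| <= M) ->
    ('E_P[phi \o X n])%E @[n --> \oo] --> ('E_Q[phi \o Y])%E.

End probability_notions.

Section model.
Context {d : measure_display} {T : measurableType d} {R : realType}.
Variable P : probability T R.

Definition config (N : nat) := {ffun 'I_N -> bool}.

Definition spin (N : nat) (sigma : config N) (i : 'I_N) : R :=
  (-1) ^+ (sigma i).

Definition magnetization (N : nat) (sigma : config N) : R :=
  N%:R^-1 * \sum_(i < N) spin sigma i.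

(* Sites are numbered from 0.  [g p t] is g_{i_1, ..., i_2p} with
   t = (i_1, ..., i_2p); one family serves all system sizes.  Only p >= 1 is
   used, both here and in the coefficient sequences [bp]. *)
Definition disorder := forall p : nat, p.*2.-tuple nat -> {RV P >-> R}.

Definition joint_index : choiceType := (nat + {p : nat & p.*2.-tuple nat})%type.

Definition joint_domain : set joint_index :=
  [set k | match k with inl _ => True | inr u => (1 <= tag u)%N end].

Definition joint_family (hs : nat -> {RV P >-> R}) (g : disorder)
    (k : joint_index) : {RV P >-> R} :=
  match k with inl i => hs i | inr u => g (tag u) (tagged u) end.

(* (hs i) are i.i.d. copies of h, the couplings are i.i.d. standard Gaussian
   and independent of (hs i). *)
Definition disorder_law (h : {RV P >-> R}) (hs : nat -> {RV P >-> R})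
    (g : disorder) : Prop :=
  [/\ forall i, same_law (hs i) h,
      forall p (t : p.*2.-tuple nat), (1 <= p)%N -> standard_gaussian (g p t) &
      mutually_independent joint_domain (joint_family hs g)].

Definition xi (bp : nat -> R) (x : R) : R :=
  limn (fun n => \sum_(1 <= p < n) bp p ^+ 2 * x ^+ p.*2).

Section hamiltonian.
Variable g : disorder.

(* The series converges for almost every w when (b, bp) is in [calB]. *)
Definition H_SK (bp : nat -> R) (N : nat) (w : T) (sigma : config N) : R :=
  limn (fun n => \sum_(1 <= p < n) bp p / (N%:R `^ (p%:R - 2^-1)) *
    \sum_(t : p.*2.-tuple 'I_N)
      g (map_tuple (@nat_of_ord N) t) w * \prod_(i <- t) spin sigma i).

Definition hamiltonian (b : R) (bp : nat -> R) (field : nat -> T -> R)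
    (N : nat) (w : T) (sigma : config N) : R :=
  b * N%:R / 2 * magnetization sigma ^+ 2 + H_SK bp w sigma +
  \sum_(i < N) field i w * spin sigma i.

Definition partition_function (b : R) (bp : nat -> R) (field : nat -> T -> R)
    (N : nat) (w : T) : R :=
  \sum_(sigma : config N) expR (hamiltonian b bp field w sigma).

Definition gibbs (b : R) (bp : nat -> R) (field : nat -> T -> R)
    (N : nat) (w : T) (sigma : config N) : R :=
  expR (hamiltonian b bp field w sigma) / partition_function b bp field N w.

(* Gibbs average of the indicator of |m - x| <= eps. *)
Definition gibbs_near (b : R) (bp : nat -> R) (field : nat -> T -> R)
    (x eps : R) (N : nat) (w : T) : R :=
  \sum_(sigma : config N)
    gibbs b bp field w sigma * (`|magnetization sigma - x| <= eps)%R%:R.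

Definition free_energy (b : R) (bp : nat -> R) (field : nat -> T -> R)
    (N : nat) : R :=
  N%:R^-1 * expect P (fun w => ln (partition_function b bp field N w)).

Definition F_SK (bp : nat -> R) (field : nat -> T -> R) : R :=
  limn (free_energy 0 bp field).

Definition Omega (b : R) (bp : nat -> R) (field : nat -> T -> R) : set R :=
  argmax `[-1, 1] (fun mu =>
    F_SK bp (fun i w => b * mu + field i w) - b * mu ^+ 2 / 2).

End hamiltonian.

Definition calB : set (R * (nat -> R)) :=
  [set x : R * (nat -> R) | 0 <= x.1 /\
    cvgn (fun n => \sum_(1 <= p < n) 2 ^+ p * x.2 p ^+ 2)].

Definition calB' : set (R * (nat -> R)) :=
  [set x : R * (nat -> R) | [/\ calB x, 0 < x.1 & forall p, (1 <= p)%N -> x.2 p != 0]].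

Definition calB_d (g : disorder) (field : nat -> T -> R) :
    set (R * (nat -> R)) :=
  [set x : R * (nat -> R) | [/\ calB x, 0 < x.1 &
    (exists mu, Omega g x.1 x.2 field = [set mu]) \/
    (exists mu, 0 < mu < 1 /\ Omega g x.1 x.2 field = [set mu; - mu])]].

Definition calB_d' (g : disorder) (field : nat -> T -> R) :
    set (R * (nat -> R)) := calB_d g field `&` calB'.

Section curie_weiss.
Variable h : {RV P >-> R}.

Definition alpha : R := (expect P (fun w => (cosh (h w) ^+ 2)^-1))^-1.

Definition f_CW (mu b : R) : R :=
  ln 2 + expect P (fun w => ln (cosh (b * mu + h w))) - b * mu ^+ 2 / 2.

(* Definite descriptions: both sets are singletons when alpha < b and
   0 < u < 1 respectively, under the moment condition on h. *)
Definition mu_CW (b : R) : R := xget 0 (argmax `[0, 1] (f_CW^~ b)).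

Definition beta_CW (u : R) : R :=
  xget 0 [set b | alpha < b /\ mu_CW b = u].

Definition delta_CW (u b : R) : R := f_CW (mu_CW b) b - f_CW u b.

End curie_weiss.

Definition calR (h : {RV P >-> R}) (g : disorder) (field : nat -> T -> R)
    (u : R) : set (R * (nat -> R)) :=
  [set x : R * (nat -> R) | [/\ calB_d' g field x, beta_CW h u < x.1 &
               xi x.2 1 < 2 * delta_CW h u x.1]].

(* The supremum of b / cosh^2 b over b >= 0 is attained. *)
Definition moment_condition (h : {RV P >-> R}) : Prop :=
  ('E_P[fun w => (expR (2 * `|h w|))%R] <
   ((sup [set b / cosh b ^+ 2 | b in [set b : R | 0%R <= b]%R])^-1)%:E)%E.

End model.

(* Main.v *)
(* Write L_N(x) for ln Z_N at beta = 0 with external field x + h_i.  Gaussian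
   interpolation bounds E L_N(x) between N (ln 2 + E ln cosh(x + h)) and the same
   plus N xi(1)/2 and makes N |-> E L_N(x) superadditive, so that L_N(x)/N tends to
   F^SK(x), almost surely because L_N(x) concentrates.  Since
   m^2 = (m - q)^2 + 2 q m - q^2, configurations with magnetization near q have
   total weight about exp(L_N(beta q) - N beta q^2/2), while Z_N is at least this
   expression at any other q; hence m concentrates on Omega.  The condition
   xi(1) < 2 delta_u(beta) is smaller than the loss incurred by f on [0, u], so the
   points of Omega have modulus greater than u; F^SK is even in x, so Omega is
   {mu, -mu} and only the splitting of the unit mass between W+ and W-, the Gibbs
   weights near mu and -mu, remains.

   If h = 0, the spin flip preserves the Hamiltonian and W+ = W-.  Otherwise,
   integrating by parts in the fields,
   N E h^2 E(<m^2> - <m>^2) = E(<m> sum_i h_i) = O(sqrt N), so E(W+ W-) -> 0; as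
   W+ + W- -> 1 and (W+, W-) has an exchangeable law (flip spins and fields), W+ and
   W- converge in law to Bernoulli(1/2).

   On the Curie-Weiss side everything follows from t |-> E tanh(t + h) having a
   strictly decreasing derivative on [0, oo), which holds because the centred
   Gaussian law is symmetric and unimodal. *)

Require Import Defs.
From HB Require Import structures.
From mathcomp Require Import all_boot all_order all_algebra.
From mathcomp Require Import all_classical all_reals all_analysis.
From mathcomp Require Import measurable_realfun.
From mathcomp Require Import ring lra zify.

Import Order.TTheory GRing.Theory Num.Theory.
Import numFieldNormedType.Exports.

Local Open Scope classical_set_scope.
Local Open Scope ring_scope.

Set Implicit Arguments.
Unset Strict Implicit.
Unset Printing Implicit Defensive.

(** * Expectations of real-valued random variables *)

(** The Hamiltonian is a series over all orders of interaction, while interpolation, integration by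
    parts and concentration concern finitely many Gaussian variables. Each is therefore proved for
    the model cut at order [n], with bounds in which [n] enters only through [xin bp n <= xi bp 1].
    Then [n] goes to infinity at fixed [N]; the summability of [2^p beta_p^2] provides the
    integrable majorant. In the deviation bound the exponential is first replaced by a bounded
    function, so that dominated convergence applies there as well.

    Concentration integrates out one coordinate at a time and uses only exponential moments. It
    costs the sum of the squared sensitivities of [ln Z_N] to the single variables; by the
    normalisation [N^(p-1/2)] this is at most [N (1 + xi(1))], small against the square of a
    deviation [eps N].

    The Gaussian law is used through the four properties collected in [gauss_law]. They hold for the
    point mass at 0 as well, so the degenerate field is singled out only when the mass is split
    between the two peaks. *)

Section expectation_lemmas.
Context {d : measure_display} {T : measurableType d} {R : realType}.
Variable P : probability T R.
Implicit Types X Y G : T -> R.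

Definition rint X := P.-integrable setT (EFin \o X).
Definition Ex X : R := \int[P]_w X w.

Lemma rint_meas X : rint X -> measurable_fun setT X.
Proof. by move=> /integrableP[/measurable_EFinP]. Qed.

Lemma rint_le_ae X Y : measurable_fun setT X -> rint Y ->
  {ae P, forall w, `|X w| <= Y w} -> rint X.
Proof.
move=> mX iY XY; apply/integrableP; split; first exact/measurable_EFinP.
have /integrableP[mY Yoo] := iY.
apply: le_lt_trans Yoo; apply: ae_ge0_le_integral => //.
- exact/measurable_EFinP/measurableT_comp.
- exact: measurableT_comp.
- apply: filterS XY => w XYw _ /=.
  by rewrite lee_fin (le_trans XYw)// ler_norm.
Qed.

Lemma rint_le X Y : measurable_fun setT X -> rint Y ->
  (forall w, `|X w| <= Y w) -> rint X.
Proof. by move=> mX iY XY; apply: (rint_le_ae mX iY); apply: aeW. Qed.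

Lemma rint_cst c : rint (cst c).
Proof. exact: finite_measure_integrable_cst. Qed.

Lemma rint_bnd X c : measurable_fun setT X -> (forall w, `|X w| <= c) -> rint X.
Proof. by move=> mX Xc; apply: (rint_le mX (rint_cst c)). Qed.

Lemma rintD X Y : rint X -> rint Y -> rint (fun w => X w + Y w).
Proof.
by move=> iX iY; have := integrableD measurableT iX iY; apply: eq_integrable.
Qed.

Lemma rintB X Y : rint X -> rint Y -> rint (fun w => X w - Y w).
Proof.
by move=> iX iY; have := integrableB measurableT iX iY; apply: eq_integrable.
Qed.

Lemma rintZ c X : rint X -> rint (fun w => c * X w).
Proof.
by move=> iX; have := integrableZl measurableT c iX; apply: eq_integrable.
Qed.

Lemma rintN X : rint X -> rint (fun w => - X w).
Proof.
by move=> iX; have := rintZ (-1) iX; apply: eq_integrable => // w _ /=; rewrite mulN1r.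
Qed.

Lemma rint_norm X : rint X -> rint (fun w => `|X w|).
Proof.
move=> iX; apply: (@rint_le_ae _ (fun w => `|X w|)).
- exact: measurableT_comp (rint_meas iX).
- by move: (integrable_abse iX); apply: eq_integrable.
- by apply: aeW => w; rewrite normr_id.
Qed.

Lemma rint_sum (I : Type) (s : seq I) (Q : pred I) (X : I -> T -> R) :
  (forall i, Q i -> rint (X i)) -> rint (fun w => \sum_(i <- s | Q i) X i w).
Proof.
move=> iX; elim: s => [|i s IH].
  have -> : (fun w => \sum_(i <- [::] | Q i) X i w) = cst 0.
    by apply/funext => w; rewrite big_nil.
  exact: rint_cst.
have -> : (fun w => \sum_(i <- i :: s | Q i) X i w) =
    (fun w => if Q i then X i w + \sum_(i <- s | Q i) X i w
              else \sum_(i <- s | Q i) X i w).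
  by apply/funext => w; rewrite big_cons.
case Qi : (Q i) => //; apply: rintD => //; exact: iX.
Qed.

Lemma eq_Ex X Y : X =1 Y -> Ex X = Ex Y.
Proof. by move=> /funext->. Qed.

Lemma Ex_cst c : Ex (cst c) = c.
Proof. rewrite /Ex Rintegral_cst// (_ : fine _ = 1) ?mulr1//.
exact: (congr1 fine (probability_setT P)). Qed.

Lemma ExD X Y : rint X -> rint Y -> Ex (fun w => X w + Y w) = Ex X + Ex Y.
Proof. by move=> iX iY; rewrite /Ex RintegralD. Qed.

Lemma ExB X Y : rint X -> rint Y -> Ex (fun w => X w - Y w) = Ex X - Ex Y.
Proof. by move=> iX iY; rewrite /Ex RintegralB. Qed.

Lemma ExZ c X : rint X -> Ex (fun w => c * X w) = c * Ex X.
Proof. by move=> iX; rewrite /Ex RintegralZl. Qed.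

Lemma ExN X : rint X -> Ex (fun w => - X w) = - Ex X.
Proof.
by move=> iX; rewrite -mulN1r -ExZ//; apply: eq_Ex => w; rewrite mulN1r.
Qed.

Lemma Ex_sum (I : Type) (s : seq I) (Q : pred I) (X : I -> T -> R) :
  (forall i, Q i -> rint (X i)) ->
  Ex (fun w => \sum_(i <- s | Q i) X i w) = \sum_(i <- s | Q i) Ex (X i).
Proof.
move=> iX; elim: s => [|i s IH].
  rewrite big_nil -[RHS]Ex_cst; apply: eq_Ex => w; exact: big_nil.
rewrite big_cons.
have -> : Ex (fun w => \sum_(i <- i :: s | Q i) X i w) =
  Ex (fun w => if Q i then X i w + \sum_(i <- s | Q i) X i w
               else \sum_(i <- s | Q i) X i w).
  by apply: eq_Ex => w; rewrite big_cons.
case Qi : (Q i) => //; rewrite ExD ?IH//; first exact: iX.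
exact: rint_sum.
Qed.

Lemma Ex_le X Y : rint X -> rint Y -> (forall w, X w <= Y w) -> Ex X <= Ex Y.
Proof. by move=> iX iY XY; apply: le_Rintegral => // w _. Qed.

Lemma Ex_ge0 X : (forall w, 0 <= X w) -> 0 <= Ex X.
Proof. by move=> X0; apply: Rintegral_ge0 => w _. Qed.

Lemma normr_Ex X : rint X -> `|Ex X| <= Ex (fun w => `|X w|).
Proof. by move=> iX; apply: le_normr_Rintegral. Qed.

Lemma integral_Ex X : rint X -> (\int[P]_w (X w)%:E)%E = (Ex X)%:E.
Proof. by move=> iX; rewrite /Ex /Rintegral fineK//; exact: integrable_fin_num. Qed.

Lemma Ex_dominated (X : nat -> T -> R) Y G :
  (forall n, measurable_fun setT (X n)) -> measurable_fun setT Y -> rint G ->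
  {ae P, forall w, X ^~ w @ \oo --> Y w} ->
  {ae P, forall w, forall n, `|X n w| <= G w} ->
  Ex (X n) @[n --> \oo] --> Ex Y.
Proof.
move=> mX mY iG XY XG.
have mX' n : measurable_fun setT (EFin \o X n) by exact/measurable_EFinP.
have mY' : measurable_fun setT (EFin \o Y) by exact/measurable_EFinP.
have XY' : {ae P, forall w, setT w -> (EFin \o X n) w @[n --> \oo] --> (EFin \o Y) w}.
  by apply: filterS XY => w h _; apply: cvg_EFin => //; exact: nearW.
have XG' : {ae P, forall w n, setT w -> (`|(EFin \o X n) w| <= (EFin \o G) w)%E}.
  by apply: filterS XG => w h n _; rewrite /= lee_fin.
have [iY _ cvgXY] := dominated_convergence measurableT mX' mY' XY' iG XG'.
apply: fine_cvg; move: cvgXY; rewrite [X in _ --> X -> _](_ : _ = (\int[P]_w (Y w)%:E)%E)//.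
by rewrite (_ : (fine _)%:E = (\int[P]_w (Y w)%:E)%E)// fineK//; exact: integrable_fin_num.
Qed.

Lemma expectE X : expect P X = Ex X.
Proof. by rewrite /expect unlock. Qed.

Lemma expectation_Ex X : rint X -> ('E_P[X])%E = (Ex X)%:E.
Proof. by move=> iX; rewrite unlock integral_Ex. Qed.

(** By monotone convergence the sum of the series has finite expectation, hence is finite almost
    surely. Used to sum the interaction terms of the Hamiltonian, and in place of Borel-Cantelli for
    the deviations of the free energy. *)
Lemma series_Ex (X : nat -> T -> R) (a : nat -> R) :
  (forall n, rint (X n)) -> (forall n w, 0 <= X n w) ->
  (forall n, Ex (X n) <= a n) -> cvgn (series a) ->
  exists D : T -> R, [/\ rint D, (forall w, 0 <= D w) &
    {ae P, forall w, series (X ^~ w) @ \oo --> D w /\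
      forall n, series (X ^~ w) n <= D w}].
Proof.
move=> iX X0 Xa ca.
pose S w : \bar R := (\sum_(n <oo) (X n w)%:E)%E.
have mX n : measurable_fun setT (EFin \o X n) by have /integrableP[] := iX n.
have S0 w : (0 <= S w)%E by apply: nneseries_ge0 => n _ _; rewrite lee_fin.
have mS : measurable_fun setT S.
  apply: (@ge0_emeasurable_sum _ _ _ setT (fun n w => (X n w)%:E) xpredT) => //.
    by move=> n w _ _; rewrite lee_fin.
  by move=> k _; exact: mX.
have iSE : (\int[P]_w S w = \sum_(n <oo) (Ex (X n))%:E)%E.
  rewrite /S integral_nneseries//.
    by apply: eq_eseriesr => n _; rewrite -integral_Ex.
  by move=> n w _; rewrite lee_fin.
have E0 n : 0 <= Ex (X n) by exact: Ex_ge0.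
have iSoo : (\int[P]_w S w < +oo)%E.
  rewrite iSE; apply: (@le_lt_trans _ _ (\sum_(n <oo) (a n)%:E)%E).
    by apply: lee_nneseries => [n _ _|n _]; rewrite lee_fin.
  rewrite (_ : (\sum_(n <oo) (a n)%:E)%E = (limn (series a))%:E) ?ltry//.
  by rewrite -EFin_lim//; congr (limn _); apply/funext => n; rewrite /= /series/= sumEFin.
have iS : P.-integrable setT S.
  apply/integrableP; split=> //.
  by under eq_integral => w _ do rewrite gee0_abs//.
have Sfin : {ae P, forall w, S w \is a fin_num}.
  by apply: filterS (integrable_ae measurableT iS) => w; exact.
(* On the null set where [S] is infinite, [fine] gives 0, so the majorant is real and nonnegative
   everywhere. *)
exists (fine \o S); split.
- apply/integrableP; split.
    apply/measurable_EFinP/(measurableT_comp _ mS).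
    exact: fine_measurable.
  have /integrableP[_] := iS; apply: le_lt_trans; apply: ae_ge0_le_integral => //.
  + apply/measurableT_comp => //; apply/measurable_EFinP/(measurableT_comp _ mS).
    exact: fine_measurable.
  + exact/measurableT_comp.
  + by apply: filterS Sfin => w h _ /=; rewrite -abse_EFin fineK.
- by move=> w; exact: fine_ge0.
- apply: filterS Sfin => w h.
  have cS : series (X ^~ w) @ \oo --> fine (S w).
    suff /fine_cvg : (series (X ^~ w) n)%:E @[n --> \oo] --> (fine (S w))%:E by [].
    rewrite fineK//.
    have -> : (fun n => (series (X ^~ w) n)%:E) =
        (fun n => \sum_(0 <= k < n) (X k w)%:E)%E.
      by apply/funext => n; rewrite /= /series/= sumEFin.
    by apply: is_cvg_nneseries => n _ _; rewrite lee_fin.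
  split=> // n; rewrite /= -(cvg_lim (@Rhausdorff R) cS).
  apply: nondecreasing_cvgn_le; last by apply/cvg_ex; exists (fine (S w)).
  by apply: nondecreasing_series => k _ _.
Qed.

End expectation_lemmas.

(** * Finite independent families *)

Section tuple_measures.
Context {R : realType} {n : nat}.

Definition cyl (A : 'I_n -> set R) : set (n.-tuple R) :=
  [set t | forall i, A i (tnth t i)].

Lemma measurable_cyl A : (forall i, measurable (A i)) -> measurable (cyl A).
Proof.
move=> mA.
have -> : cyl A = \bigcap_(i in [set: 'I_n]) ((@tnth _ R ^~ i) @^-1` A i).
  by apply/seteqP; split=> t /= h i => [_|]; apply: h.
apply: fin_bigcap_measurable => [|i _]; first exact: finite_finset.
by rewrite -[X in measurable X]setTI; apply: measurable_tnth.
Qed.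

(** Boxes are stable under intersection, contain the whole space, and generate the product
    sigma-algebra because a condition on one coordinate is a box. *)
Lemma tuple_measure_unique (m1 m2 : {measure set (n.-tuple R) -> \bar R}) :
  (m1 setT < +oo)%E ->
  (forall A, (forall i, measurable (A i)) -> m1 (cyl A) = m2 (cyl A)) ->
  forall S, measurable S -> m1 S = m2 S.
Proof.
move=> m1oo m12.
have cT : setT = cyl (fun=> setT) by apply/seteqP; split.
apply: (measure_unique [set cyl A | A in [set A | forall i, measurable (A i)]]
  (fun=> setT)) => //.
- apply/seteqP; split=> S.
  + apply: smallest_sub; first exact: smallest_sigma_algebra.
    rewrite -bigcup_seq => B [i _ [A mA <-]]; apply: sub_sigma_algebra.
    exists (fun j => if j == i then A else setT).
      by move=> j /=; case: ifP.
    rewrite setTI; apply/seteqP; split=> t /=.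
      by move=> /(_ i); rewrite eqxx.
    by move=> At j; case: eqP => [->|].
  + apply: smallest_sub; first exact: sigma_algebra_measurable.
    by move=> _ [A mA <-]; exact: measurable_cyl.
- move=> _ _ [A mA <-] [B mB <-]; exists (fun i => A i `&` B i) => [i|].
    exact: measurableI.
  apply/seteqP; split=> t /=.
    by move=> h; split=> i; have [] := h i.
  by move=> [h1 h2] i; split.
- by move=> _; exists (fun=> setT).
- by rewrite bigcup_const.
- by move=> _ [A mA <-]; exact: m12.
Qed.

End tuple_measures.

Section independence.
Context {d : measure_display} {T : measurableType d} {R : realType}.
Variable P : probability T R.

Definition tupleRV n (X : 'I_n -> T -> R) (w : T) : n.-tuple R :=
  [tuple X i w | i < n].

Lemma measurable_tupleRV n (X : 'I_n -> T -> R) :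
  (forall i, measurable_fun setT (X i)) -> measurable_fun setT (tupleRV X).
Proof.
move=> mX; apply/measurable_fun_tnthP => i.
by apply: eq_measurable_fun (mX i) => w _ /=; rewrite tnth_mktuple.
Qed.

(** Testing the full family is enough: subfamilies are reached by taking [A k = setT] at the other
    indices. *)
Definition findep (K : finType) (X : K -> T -> R) : Prop :=
  forall A : K -> set R, (forall k, measurable (A k)) ->
  P [set w | forall k, A k (X k w)] = (\prod_k P (X k @^-1` A k))%E.

Section pair.
Variables (n : nat) (X : {RV P >-> R}) (Y : {mfun T >-> n.-tuple R}).
Hypothesis XY : forall A B, measurable A -> (forall i, measurable (B i)) ->
  P (X @^-1` A `&` Y @^-1` (cyl B)) = (P (X @^-1` A) * P (Y @^-1` (cyl B)))%E.

Let mX : measurable_fun setT X. Proof. exact: measurable_funPT. Qed.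
Let mY : measurable_fun setT Y. Proof. exact: measurable_funPT. Qed.

Lemma indep_cyl A B : measurable A -> measurable B ->
  P (X @^-1` A `&` Y @^-1` B) = (P (X @^-1` A) * P (Y @^-1` B))%E.
Proof.
move=> mA mB.
have mXA : measurable (X @^-1` A) by rewrite -[X in measurable X]setTI; exact: mX.
have r0 : 0 <= fine (P (X @^-1` A)) by exact: fine_ge0.
pose r : {nonneg R} := NngNum r0.
have rE : P (X @^-1` A) = r%:num%:E by rewrite /= fineK// fin_num_measure.
pose m1 : {measure set (n.-tuple R) -> \bar R} := pushforward (mrestr P mXA) Y.
pose m2 : {measure set (n.-tuple R) -> \bar R} := mscale r (distribution P Y).
rewrite setIC -[LHS]/(m1 mY B) rE -[RHS]/(m2 B).
apply: tuple_measure_unique => //.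
  rewrite -[m1 _ _]/(P (Y @^-1` setT `&` X @^-1` A)) preimage_setT setTI.
  by rewrite (le_lt_trans (probability_le1 _ _)) ?ltry.
move=> C mC; rewrite -[m1 _ _]/(P (Y @^-1` cyl C `&` X @^-1` A)) setIC XY//.
by rewrite rE.
Qed.

Definition pairRV : {mfun T >-> (R * n.-tuple R)%type} :=
  mfun_Sub (mem_set (measurable_fun_pair mX mY)).

Lemma distribution_pair (S : set (R * n.-tuple R)) : measurable S ->
  distribution P pairRV S = (distribution P X \x distribution P Y)%E S.
Proof.
move=> mS; apply/esym; apply: product_measure_unique => //.
by move=> A B mA mB; rewrite /distribution/pushforward/= -indep_cyl.
Qed.

Lemma ge0_integral_pair (f : R * n.-tuple R -> \bar R) :
  measurable_fun setT f -> (forall z, 0 <= f z)%E ->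
  (\int[P]_w f (X w, Y w) =
   \int[P]_w \int[distribution P X]_x f (x, Y w))%E.
Proof.
move=> mf f0.
rewrite -[LHS](ge0_integral_distribution pairRV mf f0).
rewrite (eq_measure_integral (distribution P X \x distribution P Y)%E); last first.
  by move=> A mA _; exact: distribution_pair.
rewrite fubini_tonelli2// ge0_integral_distribution//.
- exact: measurable_fun_fubini_tonelli_G.
- by move=> y; apply: integral_ge0.
Qed.

Lemma integrable_pair (f : R * n.-tuple R -> R) :
  measurable_fun setT f -> rint P (fun w => f (X w, Y w)) ->
  (distribution P X \x distribution P Y)%E.-integrable setT (EFin \o f).
Proof.
move=> mf /integrableP[_ foo]; apply/integrableP; split.
  exact/measurable_EFinP.
rewrite (eq_measure_integral (distribution P pairRV)); last first.
  by move=> A mA _; apply/esym; exact: distribution_pair.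
rewrite ge0_integral_distribution//.
by apply/measurableT_comp => //; exact/measurable_EFinP.
Qed.

(** Averaging over [X] with [Y] frozen: both the concentration bound and the integration by parts
    for Gibbs averages reduce to one coordinate in this way. *)
Lemma Ex_pair (f : R * n.-tuple R -> R) :
  measurable_fun setT f -> rint P (fun w => f (X w, Y w)) ->
  (forall y, rint (distribution P X) (fun x => f (x, y))) ->
  let F y := Ex (distribution P X) (fun x => f (x, y)) in
  [/\ measurable_fun setT F, rint P (F \o Y) & 
  Ex P (fun w => f (X w, Y w)) = Ex P (F \o Y)].
Proof.
move=> mf intf intx F.
have FE : EFin \o F = fubini_G (distribution P X) (EFin \o f).
  by apply/funext => y; rewrite /F /fubini_G/= integral_Ex.
have intp := integrable_pair mf intf.
have mF : measurable_fun setT F.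
  by apply/measurable_EFinP; rewrite FE; exact: (measurable_fubini_G intp).
have iF : (distribution P Y).-integrable setT (EFin \o F).
  have mf' : measurable_fun setT (EFin \o f) by exact/measurable_EFinP.
  have := (iffLR (integrable21ltyP _ _ mf')) intp.
  move=> foo; apply/integrableP; split; first exact/measurable_EFinP.
  apply: le_lt_trans foo; apply: ge0_le_integral => //.
  - by apply/measurableT_comp => //; exact/measurable_EFinP.
  - apply: (@measurable_fun_fubini_tonelli_G _ _ _ _ _ _ (abse \o (EFin \o f))).
      exact/measurableT_comp.
    by move=> x; exact: abse_ge0.
  - move=> y _; rewrite [in leLHS]FE.
    apply: le_abse_integral => //.
    by have /integrableP[] := intx y.
have iFY : rint P (F \o Y).
  move: iF => /integrableP[_ Foo]; apply/integrableP; split.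
    exact/measurable_EFinP/measurableT_comp.
  move: Foo; rewrite ge0_integral_distribution//.
  by apply/measurableT_comp => //; exact/measurable_EFinP.
split=> //; apply: EFin_inj; rewrite -!integral_Ex//.
rewrite -[RHS](@integral_distribution _ _ _ _ _ _ Y (EFin \o F))//; last first.
  exact/measurable_EFinP.
rewrite FE (integral21_prod_meas1 intp).
rewrite (eq_measure_integral (distribution P pairRV)); last first.
  by move=> A mA _; apply/esym; exact: distribution_pair.
by rewrite integral_distribution//; exact/measurable_EFinP.
Qed.

End pair.

(** The joint law of an independent tuple is determined by its marginals. This is what permits
    relabelling the disorder and changing the signs of the fields. *)
Lemma tuple_law_Ex n (X X' : 'I_n -> T -> R) (f : n.-tuple R -> R) :
  (forall i, measurable_fun setT (X i)) ->
  (forall i, measurable_fun setT (X' i)) ->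
  findep X -> findep X' ->
  (forall i A, measurable A -> P (X i @^-1` A) = P (X' i @^-1` A)) ->
  measurable_fun setT f ->
  rint P (f \o tupleRV X) -> rint P (f \o tupleRV X') ->
  Ex P (f \o tupleRV X) = Ex P (f \o tupleRV X').
Proof.
move=> mX mX' iX iX' XX' mf If If'.
pose Z : {mfun T >-> n.-tuple R} := mfun_Sub (mem_set (measurable_tupleRV mX)).
pose Z' : {mfun T >-> n.-tuple R} := mfun_Sub (mem_set (measurable_tupleRV mX')).
apply: EFin_inj; rewrite -!integral_Ex//.
have mf' : measurable_fun setT (EFin \o f) by exact/measurable_EFinP.
rewrite -[LHS](@integral_distribution _ _ _ _ _ _ Z _ mf')//.
rewrite -[RHS](@integral_distribution _ _ _ _ _ _ Z' _ mf')//.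
apply: eq_measure_integral => S mS _.
apply: tuple_measure_unique => //.
  by rewrite (le_lt_trans (probability_le1 _ _)) ?ltry.
move=> A mA.
rewrite -[LHS]/(P (tupleRV X @^-1` cyl A)) -[RHS]/(P (tupleRV X' @^-1` cyl A)).
have cE (V : 'I_n -> T -> R) : tupleRV V @^-1` cyl A = [set w | forall k, A k (V k w)].
  by apply/seteqP; split=> w /= h i; have := h i; rewrite tnth_mktuple.
by rewrite !cE iX// iX'//; apply: eq_bigr => i _; exact: XX'.
Qed.

End independence.

(** * Gaussian laws *)

Section lebesgue_translation.
Context {R : realType}.
Local Notation mu := (@lebesgue_measure R).

Lemma lebesgue_measure_translation (c : R) (A : set R) : measurable A ->
  pushforward mu ((fun x => x + c) : _ -> measurableTypeR R) A = mu A.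
Proof.
move=> mA; apply/esym; apply: lebesgue_measure_unique => //=.
  exact: measurable_funD.
move=> mc _ [[a b]] _ <-; rewrite /pushforward/=.
have -> : (fun x => x + c) @^-1` `]a, b] = `]a - c, b - c]%classic.
  by apply/seteqP; split => x /=; rewrite !in_itv/= ltrBlDr lerBrDr.
rewrite !lebesgue_measure_itv/= !lte_fin ltrD2r; case: ifP => // _.
by rewrite -!EFinD; congr EFin; ring.
Qed.

Lemma ge0_integral_translation (c : R) (f : R -> \bar R) :
  measurable_fun setT f -> (forall x, 0 <= f x)%E ->
  (\int[mu]_x f (x + c)%R = \int[mu]_x f x)%E.
Proof.
move=> mf f0.
have mc : measurable_fun setT ((fun x => x + c) : R -> measurableTypeR R).
  exact: measurable_funD.
transitivity (\int[pushforward mu ((fun x => x + c)%R : R -> measurableTypeR R)]_x f x)%E.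
  by rewrite ge0_integral_pushforward.
by apply: eq_measure_integral => A mA _; exact: lebesgue_measure_translation.
Qed.

End lebesgue_translation.

Section normal.
Context {R : realType} (s : R).
Hypothesis s0 : s != 0.
Local Notation mu := (@lebesgue_measure R).
Local Notation nu := (normal_prob 0 s).
Local Notation pdf := (normal_pdf 0 s).

Lemma ge0_integral_normal (f : R -> \bar R) :
  measurable_fun setT f -> (forall x, 0 <= f x)%E ->
  (\int[nu]_x f x = \int[mu]_x (f x * (pdf x)%:E))%E.
Proof.
move=> mf f0.
have dom : nu `<< mu by exact: normal_prob_dominates.
rewrite -(Radon_Nikodym_SigmaFinite.change_of_variables dom)//.
apply: ae_eq_integral => //.
- apply: emeasurable_funM => //.
  exact: measurable_int (Radon_Nikodym_SigmaFinite.f_integrable dom).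
- apply: emeasurable_funM => //; apply/measurable_EFinP.
  exact: measurable_normal_pdf.
- apply: ae_eqe_mul2l; apply: integral_ae_eq => //=.
  + exact: Radon_Nikodym_SigmaFinite.f_integrable.
  + by apply/measurable_EFinP; exact: measurable_normal_pdf.
  + by move=> E E01 mE; rewrite -Radon_Nikodym_SigmaFinite.f_integral.
Qed.

Lemma pdfE x : pdf x = normal_peak s * expR (- x ^+ 2 / (s ^+ 2 *+ 2)).
Proof. by rewrite normal_pdfE// /normal_fun subr0. Qed.

Lemma mexp (l : R) : measurable_fun setT (fun x : R => expR (l * x)).
Proof. by apply: measurableT_comp => //; exact: measurable_funM. Qed.

(** Completing the square turns the tilted density into a constant times the normal density of mean
    [l * s ^+ 2], which has mass 1. *)
Lemma integral_normal_exp (l : R) :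
  (\int[nu]_x (expR (l * x))%:E = (expR (l ^+ 2 * s ^+ 2 / 2))%:E)%E.
Proof.
rewrite ge0_integral_normal; last by move=> x; rewrite lee_fin expR_ge0.
  rewrite -[RHS]mule1 -(integral_normal_pdf (l * s ^+ 2) s).
  have mp : measurable_fun setT (fun x => (normal_pdf (l * s ^+ 2) s x)%:E).
    by apply/measurable_EFinP; exact: measurable_normal_pdf.
  have p0 x : setT x -> (0 <= (normal_pdf (l * s ^+ 2) s x)%:E)%E.
    by rewrite lee_fin normal_pdf_ge0.
  rewrite -(ge0_integralZl_EFin mu measurableT p0 mp (expR_ge0 _)).
  apply: eq_integral => x _; rewrite -!EFinM; congr EFin.
  rewrite pdfE normal_pdfE// /normal_fun mulrCA [in RHS]mulrCA -!expRD.
  congr (_ * expR _); field.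
  by rewrite s0.
by apply/measurable_EFinP; exact: mexp.
Qed.

Lemma rint_normal_exp (l : R) : rint nu (fun x => expR (l * x)).
Proof.
apply/integrableP; split; first by apply/measurable_EFinP; exact: mexp.
under eq_integral => x _ do rewrite /= ger0_norm ?expR_ge0//.
by rewrite integral_normal_exp ltry.
Qed.

Lemma normal_probN (A : set R) : measurable A -> nu (-%R @^-1` A) = nu A.
Proof.
move=> mA; rewrite /normal_prob.
transitivity (\int[pushforward mu (-%R : R -> measurableTypeR R)]_(x in A) (pdf x)%:E)%E; last first.
  by apply: eq_measure_integral => B mB _; exact: lebesgue_measureN.
rewrite ge0_integral_pushforward.
- by apply: eq_integral => x _; rewrite /= !pdfE sqrrN.
- exact: oppr_measurable.
- exact: mA.
- by apply: measurable_funTS; apply/measurable_EFinP; exact: measurable_normal_pdf.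
- by move=> x _; rewrite lee_fin normal_pdf_ge0.
Qed.

Lemma integral_normal (f : R -> R) : rint nu f ->
  (\int[nu]_x (f x)%:E = \int[mu]_x (f x * pdf x)%:E)%E.
Proof.
move=> intf.
have dom : nu `<< mu by exact: normal_prob_dominates.
have mf : measurable_fun setT (EFin \o f) by have /integrableP[] := intf.
rewrite -[LHS](Radon_Nikodym_change_of_variables dom measurableT intf).
apply: ae_eq_integral => //.
- exact: emeasurable_funM.
- apply/measurable_EFinP/measurable_funM; first exact/measurable_EFinP.
  exact: measurable_normal_pdf.
- under [in X in ae_eq _ _ _ X]eq_fun do rewrite EFinM.
  apply: ae_eqe_mul2l => /=.
  rewrite Radon_NikodymE//=.
  case: cid => /= g [g1 g2 g3].
  apply: integral_ae_eq => //=.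
  + by apply/measurable_EFinP; exact: measurable_normal_pdf.
  + by move=> E E01 mE; rewrite -g3.
Qed.

Lemma is_derive_normal_pdf (x : R) : is_derive x 1 pdf (- x / s ^+ 2 * pdf x).
Proof.
have -> : pdf = (fun x => normal_peak s * expR (- x ^+ 2 / (s ^+ 2 *+ 2))).
  by apply/funext => y; exact: pdfE.
have h : is_derive x 1 (fun x : R => - x ^+ 2 / (s ^+ 2 *+ 2)) (- x / s ^+ 2).
  apply: is_derive_eq.
  rewrite /GRing.scale/=; field.
  by rewrite s0.
have h2 := is_derive1_comp (is_derive_expR _) h.
apply: is_derive_eq.
rewrite /GRing.scale/=; ring.
Qed.

Lemma abs_le_expR (x : R) : `|x| <= expR (1 * x) + expR (- 1 * x).
Proof.
rewrite mul1r mulN1r; have [x0|x0] := ger0P x.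
- have := expR_ge1Dx x; have := expR_gt0 (- x); lra.
- have := expR_ge1Dx (- x); have := expR_gt0 x; lra.
Qed.

Lemma rint_normal_abs : rint nu (fun x => `|x|).
Proof.
apply: (rint_le _ (rintD (rint_normal_exp 1) (rint_normal_exp (- 1)))).
  exact: measurableT_comp.
by move=> x; rewrite normr_id abs_le_expR.
Qed.

(** Stein's identity. With [q] as below, [q * pdf] is the derivative of [psi * pdf], so its integral
    over [[-n, n]] is a boundary term, which vanishes in the limit because [psi] is bounded. *)
Lemma normal_ibp (psi psi' : R -> R) (C : R) :
  (forall x : R, is_derive x 1 psi (psi' x)) -> continuous psi' ->
  (forall x, `|psi x| <= C) -> (forall x, `|psi' x| <= C) ->
  Ex nu (fun x => x * psi x) = s ^+ 2 * Ex nu psi'.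
Proof.
move=> dpsi cpsi' bpsi bpsi'.
have cpsi : continuous psi.
  by move=> x; apply/differentiable_continuous/derivable1_diffP; exact: ex_derive.
have mpsi : measurable_fun setT psi by exact: continuous_measurable_fun.
have mpsi' : measurable_fun setT psi' by exact: continuous_measurable_fun.
have s2 : s ^+ 2 != 0 by rewrite expf_neq0.
pose q x := psi' x - x * psi x / s ^+ 2.
have mq : measurable_fun setT q.
  by apply: measurable_funB => //; apply: measurable_funM => //; exact: measurable_funM.
have cq : continuous q.
  move=> x; apply: cvgB; first exact: cpsi'.
  by apply: cvgM; [apply: cvgM; [exact: cvg_id|exact: cpsi]|exact: cvg_cst].
have ixpsi : rint nu (fun x => x * psi x).
  apply: (rint_le _ (rintZ C rint_normal_abs)); first exact: measurable_funM.
  by move=> x; rewrite normrM mulrC ler_wpM2r.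
have ipsi' : rint nu psi' by apply: (@rint_bnd _ _ _ nu psi' C).
have iq : rint nu q.
  rewrite (_ : q = fun x => psi' x - (s ^+ 2)^-1 * (x * psi x)); last first.
    by apply/funext => x; rewrite /q [_ / _]mulrC.
  by apply: rintB => //; exact: rintZ.
suff Exq0 : Ex nu q = 0.
  have : Ex nu q = Ex nu psi' - (s ^+ 2)^-1 * Ex nu (fun x => x * psi x).
    rewrite -ExZ// -ExB//; last exact: rintZ.
    by apply: eq_Ex => x; rewrite /q [_ / _]mulrC.
  rewrite Exq0 => /esym/eqP; rewrite subr_eq0 => /eqP ->.
  by rewrite mulVKf.
pose u x := psi x * pdf x.
have du (x : R) : is_derive x 1 u (q x * pdf x).
  have h1 := dpsi x; have h2 := is_derive_normal_pdf x.
  apply: is_derive_eq; rewrite /GRing.scale/= /q.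
  ring.
pose I n : set R := `[- n%:R, n%:R]%classic.
pose qn n x := q x * \1_(I n) x.
have mqn n : measurable_fun setT (qn n).
  by apply: measurable_funM => //; apply: measurable_indic; exact: measurable_itv.
have absqn n x : `|qn n x| <= `|q x|.
  rewrite /qn normrM indicE; case: (_ \in _); first by rewrite normr1 mulr1.
  by rewrite normr0 mulr0.
have lim1 : Ex nu (qn n) @[n --> \oo] --> Ex nu q.
  apply: (@Ex_dominated _ _ _ nu qn q (fun x => `|q x|)) => //.
    exact: rint_norm.
    apply: aeW => x; apply: cvg_near_cst.
    have [N xN] : exists N : nat, `|x| <= N%:R.
      by exists (Num.bound (`|x| : R)); exact/ltW/archi_boundP.
    exists N => // n /= Nn; rewrite /qn indicE mem_set ?mulr1//= /I/= in_itv/=.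
    by rewrite -ler_norml (le_trans xN)// ler_nat.
  by apply: aeW => x n; exact: absqn.
(* The index [n.+1] keeps the interval nondegenerate, as the fundamental theorem of calculus
   requires. *)
have Eqn n : Ex nu (qn n.+1) = u n.+1%:R - u (- n.+1%:R).
  have iqn : rint nu (qn n.+1) by apply: (@rint_le _ _ _ nu _ _ _ (rint_norm iq)) => //; exact: mqn.
  apply: EFin_inj; rewrite -integral_Ex// integral_normal//.
  rewrite EFinB -(@continuous_FTC2 _ (fun x => q x * pdf x) u (- n.+1%:R) n.+1%:R).
  - rewrite [RHS]integral_mkcond; apply: eq_integral => x _.
    rewrite patchE /qn indicE /I; case: ifPn => h.
      by rewrite mulr1.
    by rewrite mulr0 mul0r.
  - by rewrite gtrN// ltr0n.
  - apply: continuous_subspaceT => x; apply: cvgM; first exact: cq.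
    exact: continuous_normal_pdf.
  - split.
    + by move=> x _; exact: ex_derive.
    + apply: cvg_at_right_filter; apply/differentiable_continuous/derivable1_diffP.
      exact: ex_derive.
    + apply: cvg_at_left_filter; apply/differentiable_continuous/derivable1_diffP.
      exact: ex_derive.
  - by move=> x _; rewrite derive1E; exact: derive_val.
have pdf0 : pdf n.+1%:R @[n --> \oo] --> 0.
  rewrite -[X in _ --> X](mulr0 (normal_peak s)).
  under eq_fun do rewrite pdfE.
  apply: cvgM; first exact: cvg_cst.
  apply: (@squeeze_cvgr _ _ _ _ (cst 0) (fun n => (s ^+ 2 *+ 2) * n.+1%:R^-1)).
  - apply: nearW => n /=; rewrite expR_ge0/=.
    have a0 : 0 < n.+1%:R ^+ 2 / (s ^+ 2 *+ 2).
      by rewrite divr_gt0 ?exprn_gt0 ?ltr0n// pmulrn_rgt0// exprn_even_gt0.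
    rewrite mulNr expRN -[leRHS]invrK lef_pV2 ?posrE ?expR_gt0//; last first.
      by rewrite invr_gt0 mulr_gt0 ?invr_gt0 ?ltr0n// pmulrn_rgt0// exprn_even_gt0.
    apply: (@le_trans _ _ (n.+1%:R ^+ 2 / (s ^+ 2 *+ 2))); last first.
      by have := expR_ge1Dx (n.+1%:R ^+ 2 / (s ^+ 2 *+ 2)); lra.
    rewrite invfM invrK mulrC ler_pM2r; last first.
      by rewrite invr_gt0 pmulrn_rgt0// exprn_even_gt0.
    by rewrite -natrX ler_nat -mulnn leq_pmull.
  - exact: cvg_cst.
  - rewrite -[X in _ --> X](mulr0 (s ^+ 2 *+ 2)); apply: cvgM; first exact: cvg_cst.
    exact: cvg_harmonic.
have pdfN x : pdf (- x) = pdf x by rewrite !pdfE sqrrN.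
have lim2 : (u n.+1%:R - u (- n.+1%:R)) @[n --> \oo] --> 0.
  have uC x : `|u x| <= C * pdf x.
    by rewrite /u normrM [`|pdf x|]ger0_norm ?normal_pdf_ge0// ler_wpM2r// normal_pdf_ge0.
  apply: norm_cvg0; apply: (@squeeze_cvgr _ _ _ _ (cst 0) (fun n => C *+ 2 * pdf n.+1%:R)).
  - apply: nearW => n /=; rewrite normr_ge0/= (le_trans (ler_normB _ _))//.
    have -> : C *+ 2 * pdf n.+1%:R = C * pdf n.+1%:R + C * pdf (- n.+1%:R).
      by rewrite pdfN; ring.
    exact: lerD.
  - exact: cvg_cst.
  - rewrite -[X in _ --> X](mulr0 (C *+ 2)).
    by apply: cvgM => //; exact: cvg_cst.
have lim1' : Ex nu (qn n.+1) @[n --> \oo] --> Ex nu q by rewrite (cvg_shiftS (fun n => Ex nu (qn n))).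
move: lim1'; rewrite (_ : (fun n => _) = (fun n => u n.+1%:R - u (- n.+1%:R))); last first.
  exact/funext.
by move=> lim1'; apply: cvg_unique lim1' lim2.
Qed.

(* Translating a centred normal law by [c] tilts it by [expR (c x / s^2)]; the
   symmetrised tilt is [sinh], which has the sign of [x]. *)
Lemma normal_odd_shift (psi : R -> R) (C c : R) :
  continuous psi -> (forall x, `|psi x| <= C) -> (forall x, psi (- x) = - psi x) ->
  (forall x, 0 < x -> 0 < psi x) -> 0 < c -> 0 < Ex nu (fun x => psi (c + x)).
Proof.
move=> cpsi bpsi opsi psi0 c0.
have C0 : 0 <= C by rewrite (le_trans _ (bpsi 0)).
have mpsi : measurable_fun setT psi by exact: continuous_measurable_fun.
pose l := c / s ^+ 2.
have s2 : 0 < s ^+ 2 by rewrite exprn_even_gt0.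
have l0 : 0 < l by rewrite divr_gt0.
pose K := expR (- (c ^+ 2 / (s ^+ 2 *+ 2))).
have pdfc y : pdf (y - c) = K * expR (l * y) * pdf y.
  rewrite !pdfE /K mulrCA -!expRD; congr (_ * expR _).
  rewrite /l; field.
  by rewrite s0.
have mpsic : measurable_fun setT (fun x => psi (c + x)).
  by apply: (measurableT_comp mpsi); exact: measurable_funD.
have ipsic : rint nu (fun x => psi (c + x)) by apply: (@rint_bnd _ _ _ nu _ C).
have iexp := rint_normal_exp l.
have ipsie a : rint nu (fun x => psi x * expR (a * x)).
  apply: (@rint_le _ _ _ nu _ _ _ (rintZ C (rint_normal_exp a))).
    by apply: measurable_funM => //; exact: mexp.
  by move=> x; rewrite normrM [X in _ * X]ger0_norm ?expR_ge0// ler_wpM2r ?expR_ge0.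
have shift : Ex nu (fun x => psi (c + x)) = K * Ex nu (fun x => psi x * expR (l * x)).
  have psiC x : 0 <= psi x + C.
    by have := bpsi x; rewrite ler_norml => /andP[+ _]; rewrite lerNl -subr_ge0 opprK addrC.
  (* The translation formula is for nonnegative integrands, hence the added [C]; it is removed again
     below through the exponential moment, which equals [K^-1]. *)
  have e1 : Ex nu (fun x => psi (c + x) + C) = K * Ex nu (fun x => (psi x + C) * expR (l * x)).
    have iC : rint nu (fun x => (psi x + C) * expR (l * x)).
      rewrite (_ : (fun x => _) = (fun x => psi x * expR (l * x) + C * expR (l * x))); last first.
        by apply/funext => x; rewrite mulrDl.
      by apply: rintD; [exact: ipsie|exact: rintZ].
    rewrite -ExZ//; apply: EFin_inj; rewrite -!integral_Ex; last 2 first.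
    - exact: rintZ.
    - by apply: rintD => //; exact: rint_cst.
    rewrite !ge0_integral_normal.
    + rewrite -(ge0_integral_translation (- c)); first last.
      * by move=> x; rewrite -EFinM lee_fin mulr_ge0 ?normal_pdf_ge0.
      * apply: emeasurable_funM; apply/measurable_EFinP.
          exact: measurable_funD.
        exact: measurable_normal_pdf.
      apply: eq_integral => x _; rewrite -!EFinM pdfc addrCA subrr addr0.
      by congr EFin; ring.
    + by apply/measurable_EFinP; have /integrableP[/measurable_EFinP] := rintZ K iC.
    + by move=> x; rewrite lee_fin !mulr_ge0// ?expR_ge0.
    + by apply/measurable_EFinP; exact: measurable_funD.
    + by move=> x; rewrite lee_fin.
  move: e1; rewrite ExD//; last exact: rint_cst.
  rewrite (_ : (fun x => _ * expR _) = (fun x => psi x * expR (l * x) + C * expR (l * x))); last first.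
    by apply/funext => x; rewrite mulrDl.
  rewrite ExD//; [|exact: rintZ]; rewrite ExZ// Ex_cst.
  have -> : Ex nu (fun x => expR (l * x)) = K^-1.
    rewrite /Ex /Rintegral integral_normal_exp/= /K -expRN opprK; congr expR.
    by rewrite /l; field; rewrite s0.
  by rewrite mulrDr mulrCA divff ?gt_eqF ?expR_gt0// mulr1 => /addIr.
have sym (f : R -> R) : rint nu f -> rint nu (f \o -%R) -> Ex nu f = Ex nu (f \o -%R).
  move=> intf intf'; apply: EFin_inj; rewrite -!integral_Ex//.
  transitivity (\int[pushforward nu (-%R : R -> measurableTypeR R)]_x (EFin \o f) x)%E.
    apply/esym; apply: eq_measure_integral => A mA _.
    exact: (normal_probN mA).
  rewrite integral_pushforward//.
  by have /integrableP[] := intf.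
pose k x := psi x * (expR (l * x) - expR (- l * x)).
have ik : rint nu k.
  rewrite (_ : k = fun x => psi x * expR (l * x) - psi x * expR (- l * x)).
    by apply: rintB; exact: ipsie.
  by apply/funext => x; rewrite /k mulrBr.
have kE : Ex nu k = Ex nu (fun x => psi x * expR (l * x)) *+ 2.
  rewrite (_ : k = fun x => psi x * expR (l * x) - psi x * expR (- l * x)); last first.
    by apply/funext => x; rewrite /k mulrBr.
  rewrite ExB; [|exact: ipsie..].
  rewrite [X in _ - X]sym; [|exact: ipsie|].
    rewrite -ExN; last first.
      rewrite (_ : _ \o _ = fun x => - (psi x * expR (l * x))); first exact: rintN.
      by apply/funext => x /=; rewrite opsi mulNr mulrNN.
    rewrite mulr2n; congr (_ + _); apply: eq_Ex => x /=.
    by rewrite opsi mulNr mulrNN opprK.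
  rewrite (_ : _ \o _ = fun x => - (psi x * expR (l * x))); first exact: rintN.
  by apply/funext => x /=; rewrite opsi mulNr mulrNN.
have psi00 : psi 0 = 0 by have := opsi 0; rewrite oppr0; lra.
have kgt x : x != 0 -> 0 < k x.
  rewrite /k neq_lt => /orP[x0|x0]; last first.
    by rewrite mulr_gt0 ?psi0// subr_gt0 ltr_expR ltr_pM2r// gtrN.
  rewrite -[x]opprK opsi mulNr -mulrN mulr_gt0 ?psi0 ?oppr_gt0// subr_lt0 ltr_expR.
  have lx : l * x < 0 by rewrite pmulr_rlt0.
  rewrite !opprK mulNr; lra.
rewrite shift mulr_gt0 ?expR_gt0//.
suff : 0 < Ex nu k by rewrite kE pmulrn_lgt0.
have k0 x : 0 <= k x.
  by have [->|/kgt/ltW//] := eqVneq x 0; rewrite /k psi00 mul0r.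
(* Were the expectation zero, [k] would vanish almost everywhere; but it vanishes only at the
   origin, which is a null set. *)
rewrite lt_neqAle Ex_ge0// andbT; apply/negP => /eqP Ek0.
have : (\int[nu]_x `|(k x)%:E| = 0)%E.
  under eq_integral => x _ do rewrite gee0_abs ?lee_fin//.
  by rewrite integral_Ex// -Ek0.
have mk : measurable_fun setT (EFin \o k) by have /integrableP[] := ik.
move=> /(iffLR (ae_eq_integral_abs nu measurableT mk)) [N [mN N0 kN]].
have : (nu setT <= nu (N `|` [set (0 : R)%R]))%E.
  apply: le_measure; rewrite ?inE//; first exact: measurableU.
  move=> x _; have [->|x0] := eqVneq x 0; [by right|left; apply: kN => /= h].
  by have := kgt x x0; case: (h I) => ->; rewrite ltxx.
rewrite probability_setT leNgt => /negP; apply.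
rewrite (le_lt_trans (measureU2 _ mN _))//.
have nu0 : nu [set (0 : R)%R] = 0%E by rewrite /normal_prob integral_set1.
by rewrite [X in (X + _)%E]N0 [X in (_ + X)%E]nu0 adde0 lte01.
Qed.

End normal.

(** An interface shared by the normal law of standard deviation [s] and, for [s = 0], the point mass
    at the origin. [gauss_odd] encodes symmetry and unimodality in the form needed for the
    Curie-Weiss model. *)
Record gauss_law {R : realType} (nu : probability R R) (s : R) : Prop := GaussLaw {
  gauss_exp : forall l : R, rint nu (fun x => expR (l * x));
  gauss_sym : forall A : set R, measurable A -> nu (-%R @^-1` A) = nu A;
  gauss_ibp : forall (psi psi' : R -> R) (C : R),
    (forall x : R, is_derive x 1 psi (psi' x)) -> continuous psi' ->
    (forall x, `|psi x| <= C) -> (forall x, `|psi' x| <= C) ->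
    Ex nu (fun x => x * psi x) = s ^+ 2 * Ex nu psi';
  gauss_odd : forall (psi : R -> R) (C c : R),
    continuous psi -> (forall x, `|psi x| <= C) ->
    (forall x, psi (- x) = - psi x) ->
    (forall x, 0 < x -> 0 < psi x) -> 0 < c -> 0 < Ex nu (fun x => psi (c + x)) }.

Section law_eq.
Context {d} {T : measurableType d} {R : realType}.
Variables (nu nu' : probability T R).
Hypothesis nuE : forall A, measurable A -> nu A = nu' A.

Lemma Ex_law_eq (f : T -> R) : Ex nu f = Ex nu' f.
Proof. by rewrite /Ex /Rintegral (eq_measure_integral nu')// => A mA _; exact: nuE. Qed.

Lemma rint_law_eq (f : T -> R) : rint nu f -> rint nu' f.
Proof.
move=> /integrableP[mf foo]; apply/integrableP; split=> //.
by rewrite (eq_measure_integral nu)// => A mA _; exact/esym/nuE.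
Qed.

End law_eq.

Section normal_law.
Context {R : realType} (nu : probability R R) (s : R).
Hypothesis s0 : s != 0.
Hypothesis nuE : forall A : set R, measurable A -> nu A = normal_prob 0 s A.

(* [normal_prob] lives on [measurableTypeR R], whose display differs from the one
   of the canonical measurable structure of [R]; hence the transport along [id]. *)
Let idTR : measurableTypeR R -> R := idfun.
#[local] HB.instance Definition _ :=
  @isMeasurableFun.Build _ _ _ _ idTR (@measurable_id _ _ setT).

Let nuid (A : set R) : measurable A -> nu A = distribution (normal_prob 0 s) idTR A.
Proof. by move=> mA; rewrite nuE. Qed.

Lemma normal_law_transfer (f : R -> R) : rint (normal_prob 0 s) f ->
  rint nu f /\ Ex nu f = Ex (normal_prob 0 s) f.
Proof.
move=> intf.
have mf : measurable_fun (setT : set R) (EFin \o f) by have /integrableP[] := intf.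
split.
  apply: (@rint_law_eq _ _ _ (distribution (normal_prob 0 s) idTR)) => [A mA|].
    exact/esym/nuid.
  apply/integrableP; split=> //.
  rewrite ge0_integral_distribution//; first by have /integrableP[_] := intf.
  exact: measurableT_comp.
rewrite (Ex_law_eq nuid) /Ex /Rintegral; congr fine.
by rewrite (integral_distribution (X := idTR) mf).
Qed.

Lemma gauss_law_normal : gauss_law nu s.
Proof.
split.
- by move=> l; have [] := normal_law_transfer (rint_normal_exp s0 l).
- move=> A mA; rewrite !nuE ?normal_probN//.
  by rewrite -[X in measurable X]setTI; exact: oppr_measurable.
- move=> psi psi' C dpsi cpsi' bpsi bpsi'.
  have mpsi : measurable_fun setT psi.
    apply: continuous_measurable_fun => x.
    by apply/differentiable_continuous/derivable1_diffP; exact: ex_derive.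
  have mpsi' : measurable_fun setT psi' by exact: continuous_measurable_fun.
  have [|_ ->] := @normal_law_transfer (fun x => x * psi x).
    apply: (rint_le _ (rintZ C (rint_normal_abs s0))); first exact: measurable_funM.
    by move=> x; rewrite normrM mulrC ler_wpM2r.
  have [|_ ->] := @normal_law_transfer psi'.
    by apply: (@rint_bnd _ _ _ (normal_prob 0 s) psi' C).
  exact: (normal_ibp s0 dpsi).
- move=> psi C c cpsi bpsi opsi psi0 c0.
  have [|_ ->] := @normal_law_transfer (fun x => psi (c + x)).
    apply: (@rint_bnd _ _ _ (normal_prob 0 s) _ C) => //.
    apply: (measurableT_comp (continuous_measurable_fun cpsi)).
    exact: measurable_funD.
  exact: (@normal_odd_shift _ s s0 psi C).
Qed.

End normal_law.

Lemma gauss_lawP {R : realType} (nu : probability R R) (s : R) :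
  (forall A : set R, measurable A ->
    nu A = (if s == 0 then \d_(0 : R) A else normal_prob 0 s A)) ->
  gauss_law nu s.
Proof.
have [->|s0] := eqVneq s 0 => nuE.
- have EnuE (f : R -> R) : measurable_fun setT f -> Ex nu f = f 0.
    move=> mf; rewrite (@Ex_law_eq _ _ _ nu (\d_(0 : R)))//.
    rewrite /Ex /Rintegral integral_dirac//; last exact/measurable_EFinP.
    by rewrite diracT mul1e.
  split.
  + move=> l; apply: (@rint_law_eq _ _ _ (\d_(0 : R))) => [A mA|].
      by rewrite nuE.
    apply/integrableP; split; first by apply/measurable_EFinP; exact: mexp.
    rewrite integral_dirac//; last first.
      by apply/measurableT_comp => //; apply/measurable_EFinP; exact: mexp.
    by rewrite diracT mul1e ltry.
  + move=> A mA; rewrite !nuE//; last first.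
      by rewrite -[X in measurable X]setTI; exact: oppr_measurable.
    rewrite !diracE (_ : (0 \in -%R @^-1` A) = (0 \in A))//.
    by apply/idP/idP; rewrite !inE /preimage/= oppr0.
  + move=> psi psi' C dpsi cpsi' _ _; rewrite expr0n/= mul0r EnuE ?mul0r//.
    apply: measurable_funM => //; apply: continuous_measurable_fun => x.
    apply/differentiable_continuous/derivable1_diffP; exact: ex_derive.
  + move=> psi C c cpsi _ _ psi0 c0; rewrite EnuE ?addr0 ?psi0//.
    apply: (measurableT_comp (continuous_measurable_fun cpsi)).
    exact: measurable_funD.
- exact: gauss_law_normal.
Qed.

(** * Finite Gibbs measures *)

Lemma is_derive_bigsum {R : realType} (I : Type) (s : seq I) (h : I -> R -> R) (dh : I -> R) (x : R) :
  (forall i, is_derive x 1 (h i) (dh i)) ->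
  is_derive x 1 (fun t => \sum_(i <- s) h i t) (\sum_(i <- s) dh i).
Proof.
move=> dhi; elim: s => [|i s IH].
  rewrite big_nil; have -> : (fun t : R => \sum_(i <- [::]) h i t) = cst 0.
    by apply/funext => t; rewrite big_nil.
  exact: is_derive_cst.
rewrite big_cons; have -> : (fun t : R => \sum_(i <- i :: s) h i t) =
    h i + (fun t => \sum_(i <- s) h i t).
  by apply/funext => t; rewrite big_cons.
exact: is_deriveD.
Qed.

Section finite_gibbs.
Context {R : realType} {C : finType}.
Implicit Types (E f g : C -> R).

Definition Zf E : R := \sum_(c : C) expR (E c).
Definition lnZ E : R := ln (Zf E).
Definition av E f : R := (\sum_(c : C) expR (E c) * f c) / Zf E.

Lemma Zf_ge0 E : 0 <= Zf E.
Proof. by apply: sumr_ge0 => c _; exact: expR_ge0. Qed.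

Lemma avD E f g : av E (fun c => f c + g c) = av E f + av E g.
Proof. by rewrite /av -mulrDl -big_split/=; under eq_bigr do rewrite mulrDr. Qed.

Lemma avZ E a f : av E (fun c => a * f c) = a * av E f.
Proof.
by rewrite /av mulrA mulr_sumr; congr (_ / _); apply: eq_bigr => c _; rewrite mulrCA.
Qed.

Lemma av_sum (I : Type) (s : seq I) E (f : I -> C -> R) :
  av E (fun c => \sum_(i <- s) f i c) = \sum_(i <- s) av E (f i).
Proof.
rewrite /av -mulr_suml exchange_big/=; congr (_ / _).
by apply: eq_bigr => c _; rewrite mulr_sumr.
Qed.

Lemma eq_av E f g : f =1 g -> av E f = av E g.
Proof. by move=> /funext ->. Qed.

Lemma av_ge0 E f : (forall c, 0 <= f c) -> 0 <= av E f.
Proof.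
move=> f0; rewrite divr_ge0 ?Zf_ge0// sumr_ge0// => c _.
by rewrite mulr_ge0 ?expR_ge0.
Qed.

Section nonempty.
Variable c0 : C.

Lemma expR_le_Zf E c : expR (E c) <= Zf E.
Proof. by rewrite /Zf (bigD1 c)//= lerDl sumr_ge0// => i _; exact: expR_ge0. Qed.

Lemma Zf_gt0 E : 0 < Zf E.
Proof. by rewrite (lt_le_trans _ (expR_le_Zf E c0)) ?expR_gt0. Qed.

Lemma av_cst E a : av E (fun=> a) = a.
Proof. by rewrite /av -mulr_suml mulrAC divff ?mul1r// gt_eqF ?Zf_gt0. Qed.

Lemma av_le E f g : (forall c, f c <= g c) -> av E f <= av E g.
Proof.
move=> fg; rewrite ler_pM2r ?invr_gt0 ?Zf_gt0//; apply: ler_sum => c _.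
by rewrite ler_wpM2l ?expR_ge0.
Qed.

Lemma av_bnd E f M : (forall c, `|f c| <= M) -> `|av E f| <= M.
Proof.
move=> fM; rewrite ler_norml; apply/andP; split.
  rewrite -[leLHS](av_cst E); apply: av_le => c.
  by have := fM c; rewrite ler_norml => /andP[].
rewrite -[leRHS](av_cst E); apply: av_le => c.
by have := fM c; rewrite ler_norml => /andP[].
Qed.

Lemma lnZ_le E E' B : (forall c, E c <= E' c + B) -> lnZ E <= lnZ E' + B.
Proof.
move=> EB; rewrite -[B]expRK -lnM ?posrE ?Zf_gt0 ?expR_gt0//.
rewrite ler_ln ?posrE ?mulr_gt0 ?Zf_gt0 ?expR_gt0// mulr_suml.
by apply: ler_sum => c _; rewrite -expRD ler_expR.
Qed.

(** The log-partition function is 1-Lipschitz for the supremum norm; its integrability, its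
    truncation limit and its concentration all rest on this. *)
Lemma lnZ_lip E E' B : (forall c, `|E c - E' c| <= B) -> `|lnZ E - lnZ E'| <= B.
Proof.
move=> EB; rewrite ler_distl; apply/andP; split.
  rewrite lerBlDr; apply: lnZ_le => c.
  by have := EB c; rewrite ler_distl => /andP[]; rewrite lerBlDr.
by apply: lnZ_le => c; have := EB c; rewrite ler_distl => /andP[].
Qed.

Section derive.
Variables (Et : R -> C -> R) (D : C -> R) (t : R).
Hypothesis dE : forall c, is_derive t 1 (fun t => Et t c) (D c).

Let dexp c : is_derive t 1 (fun t => expR (Et t c)) (expR (Et t c) * D c).
Proof.
have h := is_derive1_comp (is_derive_expR _) (dE c).
by apply: is_derive_eq; rewrite /GRing.scale/= mulrC.
Qed.

Lemma is_derive_lnZ : is_derive t 1 (fun t => lnZ (Et t)) (av (Et t) D).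
Proof.
have dZ := is_derive_bigsum (index_enum C) dexp.
have h := is_derive1_comp (is_derive1_ln (Zf_gt0 (Et t))) dZ.
by apply: is_derive_eq; rewrite /GRing.scale/= mulrC.
Qed.

Lemma is_derive_av f : is_derive t 1 (fun t => av (Et t) f)
  (av (Et t) (fun c => f c * D c) - av (Et t) f * av (Et t) D).
Proof.
have dZ := is_derive_bigsum (index_enum C) dexp.
have Z0 : Zf (Et t) != 0 by rewrite gt_eqF ?Zf_gt0.
have dfe c : is_derive t 1 (fun t => expR (Et t c) * f c) (expR (Et t c) * (f c * D c)).
  have := dexp c => h.
  by apply: is_derive_eq; rewrite /GRing.scale/=; ring.
have dN := is_derive_bigsum (index_enum C) dfe.
have dV := is_deriveV Z0 dZ.
apply: is_derive_eq.
rewrite /GRing.scale/= /av -/(Zf (Et t)).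
move: (Zf (Et t)) Z0 => Z Z0; move: (\sum_i _) (\sum_i _) (\sum_i _) => a b c.
by field; rewrite Z0.
Qed.

End derive.

End nonempty.

Lemma measurable_sumR d (T : measurableType d) (I : Type) (s : seq I) (h : I -> T -> R) :
  (forall i, measurable_fun setT (h i)) ->
  measurable_fun setT (fun w => \sum_(i <- s) h i w).
Proof. by move=> mh; apply: measurable_sum. Qed.

Section measurability.
Context d (T : measurableType d) (E : T -> C -> R).
Hypothesis mE : forall c, measurable_fun setT (fun w => E w c).

Let mexpE c : measurable_fun setT (fun w => expR (E w c)).
Proof. exact: measurableT_comp (mE c). Qed.

Lemma measurable_lnZ : measurable_fun setT (fun w => lnZ (E w)).
Proof. by apply: measurableT_comp => //; exact: measurable_sumR. Qed.

Lemma measurable_av (c0 : C) f : measurable_fun setT (fun w => av (E w) f).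
Proof.
(* Division by [Zf] is rewritten as multiplication by [expR (- lnZ)], which is measurable by
   composition. *)
rewrite (_ : (fun w => _) = fun w =>
    (\sum_c expR (E w c) * f c) * expR (- lnZ (E w))); last first.
  by apply/funext => w; rewrite expRN lnK// posrE (Zf_gt0 c0).
apply: measurable_funM.
  by apply: measurable_sumR => c; exact: measurable_funM.
apply: measurableT_comp => //; apply: measurableT_comp => //.
exact: measurable_lnZ.
Qed.

End measurability.

Lemma cvg_sumR (I : Type) (s : seq I) (h : I -> nat -> R) (l : I -> R) :
  (forall i, h i n @[n --> \oo] --> l i) ->
  (\sum_(i <- s) h i n) @[n --> \oo] --> \sum_(i <- s) l i.
Proof.
move=> hl; elim: s => [|i s IH].
  by rewrite big_nil; under eq_fun do rewrite big_nil; exact: cvg_cst.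
by rewrite big_cons; under eq_fun do rewrite big_cons; exact: cvgD.
Qed.

Section limits.
Variables (c0 : C) (En : nat -> C -> R) (E : C -> R).
Hypothesis cE : forall c, En n c @[n --> \oo] --> E c.

Let cexp c : expR (En n c) @[n --> \oo] --> expR (E c).
Proof. by apply: continuous_cvg; [exact: continuous_expR|exact: cE]. Qed.

Lemma cvg_lnZ : lnZ (En n) @[n --> \oo] --> lnZ E.
Proof.
apply: continuous_cvg; first by apply: continuous_ln; exact: Zf_gt0.
exact: cvg_sumR.
Qed.

Lemma cvg_av f : av (En n) f @[n --> \oo] --> av E f.
Proof.
apply: cvgM.
  by apply: cvg_sumR => c; apply: cvgM; [exact: cexp|exact: cvg_cst].
apply: cvgV; first by rewrite gt_eqF ?Zf_gt0.
exact: cvg_sumR.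
Qed.

End limits.

End finite_gibbs.

(** * Concentration of Lipschitz functions *)

Lemma expR_sub1_le {R : realType} (y : R) : expR y <= 1 + y + y ^+ 2 * expR `|y|.
Proof.
have h1 (z : R) : expR z - 1 <= z * expR z.
  have := expR_ge1Dx (- z); rewrite expRN => h.
  have := ler_wpM2r (expR_ge0 z) h; rewrite mulVf ?gt_eqF ?expR_gt0//; lra.
have [y0|y0] := ger0P y.
  have h2 : expR y <= 1 + y + y * (expR y - 1) by have := h1 y; nra.
  by apply: (le_trans h2); rewrite lerD2l expr2 -mulrA ler_wpM2l.
have h2 : expR y <= 1 + y + y * (expR y - 1) by have := h1 y; nra.
apply: (le_trans h2); rewrite lerD2l.
have : y * (expR y - 1) <= y ^+ 2 by have := expR_ge1Dx y; nra.
move=> /le_trans; apply; rewrite ler_peMr ?sqr_ge0//.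
by rewrite -expR0 ler_expR oppr_ge0 ltW.
Qed.

Lemma sqr_le_expR {R : realType} (y : R) : 0 <= y -> y ^+ 2 <= 4 * expR y.
Proof.
move=> y0; have := expR_ge1Dx (y / 2) => h.
have -> : expR y = expR (y / 2) ^+ 2.
  by rewrite expr2 -expRD -splitr.
have := expR_gt0 (y / 2); nra.
Qed.

(** A Gaussian-type bound on the moment generating function of Lipschitz functions. The restriction
    to constants [c <= 1] makes it a consequence of exponential moments alone; later arguments
    rescale accordingly. *)
Definition subexp {R : realType} (nu : probability R R) (K : R) : Prop :=
  forall (phi : R -> R) (c : R), 0 <= c <= 1 ->
  (forall x y, `|phi x - phi y| <= c * `|x - y|) ->
  rint nu phi /\
  (\int[nu]_x (expR (phi x - Ex nu phi))%:E <= (expR (K * c ^+ 2))%:E)%E.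

Lemma lipschitz_measurable {R : realType} (phi : R -> R) (c : R) :
  (forall x y, `|phi x - phi y| <= c * `|x - y|) -> measurable_fun setT phi.
Proof.
move=> lphi; apply: continuous_measurable_fun => x.
apply/cvgrPdist_le => e e0.
have c0 : 0 < `|c| + 1 by rewrite ltr_wpDl.
exists (e / (`|c| + 1)) => /= [|y]; first by rewrite divr_gt0.
rewrite /ball_/= ltr_pdivlMr// => /ltW h.
apply: (le_trans (lphi x y)); apply: le_trans h; rewrite mulrC ler_wpM2l//.
by rewrite (le_trans (ler_norm c))// lerDl.
Qed.

Section subexp_gauss.
Context {R : realType} (nu : probability R R).
Hypothesis nuexp : forall l : R, rint nu (fun x => expR (l * x)).

Lemma rint_exp_abs (l : R) : rint nu (fun x => expR (l * `|x|)).
Proof.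
apply: (rint_le _ (rintD (nuexp l) (nuexp (- l)))).
  by apply: measurableT_comp => //; exact: measurable_funM.
move=> x; rewrite ger0_norm ?expR_ge0//.
have [x0|x0] := ger0P x; first by rewrite lerDl expR_ge0.
by rewrite mulrN mulNr lerDr expR_ge0.
Qed.

Lemma rint_abs : rint nu (fun x => `|x|).
Proof.
apply: (rint_le _ (rint_exp_abs 1)); first exact: measurableT_comp.
by move=> x; rewrite mul1r normr_id (le_trans _ (expR_ge1Dx _))// lerDr.
Qed.

(** The centred function [psi] satisfies [|psi x| <= c (|x| + a)] with [a] the mean of [|x|]. In the
    second-order expansion of its exponential the linear term integrates to 0 and the remainder is
    at most [4 c^2 G]. *)
Lemma subexp_gauss : exists2 K, 0 <= K & subexp nu K.
Proof.
pose a := Ex nu (fun x => `|x|).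
(* With [y = |x| + a] this is [e^(2y)], and [y^2 e^y <= 4 e^(2y)] by [sqr_le_expR]. *)
pose G (x : R) := expR (2 * `|x|) * expR (2 * a).
have iG : rint nu G.
  rewrite (_ : G = fun x : R => expR (2 * a) * expR (2 * `|x|)); last first.
    by apply/funext => x; rewrite /G mulrC.
  by apply: rintZ; exact: rint_exp_abs.
have G0 x : 0 <= G x by rewrite mulr_ge0 ?expR_ge0.
exists (4 * Ex nu G); first by rewrite mulr_ge0// Ex_ge0.
move=> phi c /andP[c0 c1] lphi.
have mphi := lipschitz_measurable lphi.
have iphi : rint nu phi.
  apply: (rint_le mphi (rintD (rint_cst nu `|phi 0|) (rintZ c rint_abs))) => x.
  have := lphi x 0; rewrite subr0 => h.
  by rewrite -[phi x](subrK (phi 0)) addrC (le_trans (ler_normD _ _))// lerD2l.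
split=> //.
pose psi x := phi x - Ex nu phi.
have ipsi : rint nu psi by apply: rintB => //; exact: rint_cst.
have psiE : Ex nu psi = 0 by rewrite ExB ?Ex_cst ?subrr//; exact: rint_cst.
have psib x : `|psi x| <= c * (`|x| + a).
  have -> : psi x = Ex nu (fun y => phi x - phi y).
    by rewrite ExB ?Ex_cst//; exact: rint_cst.
  have i1 : rint nu (fun y => phi x - phi y) by apply: rintB => //; exact: rint_cst.
  apply: (le_trans (normr_Ex i1)).
  have -> : c * (`|x| + a) = Ex nu (fun y => c * (`|x| + `|y|)).
    rewrite ExZ; last by apply: rintD; [exact: rint_cst|exact: rint_abs].
    by rewrite ExD ?Ex_cst//; [exact: rint_cst|exact: rint_abs].
  apply: Ex_le; first exact: rint_norm.
    by apply: rintZ; apply: rintD; [exact: rint_cst|exact: rint_abs].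
  move=> y; apply: (le_trans (lphi x y)); rewrite ler_wpM2l//.
  by rewrite (le_trans (ler_normB _ _)).
have a0 : 0 <= a by exact: Ex_ge0.
have bound x : expR (psi x) <= 1 + psi x + 4 * c ^+ 2 * G x.
  apply: (le_trans (expR_sub1_le _)); rewrite lerD2l.
  have y0 : 0 <= `|x| + a by rewrite addr_ge0.
  apply: (@le_trans _ _ (c ^+ 2 * (`|x| + a) ^+ 2 * expR (`|x| + a))).
    apply: ler_pM; rewrite ?sqr_ge0 ?expR_ge0//.
      by rewrite -exprMn -[psi x ^+ 2]real_normK ?num_real// lerXn2r ?nnegrE ?mulr_ge0.
    by rewrite ler_expR (le_trans (psib x))// ler_piMl.
  have GE : G x = expR (`|x| + a) * expR (`|x| + a).
    by rewrite /G -!expRD; congr expR; ring.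
  have -> : 4 * c ^+ 2 * G x = c ^+ 2 * (4 * expR (`|x| + a)) * expR (`|x| + a).
    by rewrite GE; ring.
  by rewrite ler_wpM2r ?expR_ge0// ler_wpM2l ?sqr_ge0// sqr_le_expR.
have iB : rint nu (fun x => 1 + psi x + 4 * c ^+ 2 * G x).
  by apply: rintD; [apply: rintD => //; exact: rint_cst|exact: rintZ].
apply: (@le_trans _ _ (Ex nu (fun x => 1 + psi x + 4 * c ^+ 2 * G x))%:E).
  rewrite -integral_Ex//; apply: ge0_le_integral => //.
  - by apply/measurable_EFinP/measurableT_comp => //; exact: measurable_funB.
  - by have /integrableP[] := iB.
  - by move=> x _; rewrite lee_fin bound.
have i1 : rint nu (fun=> 1) by exact: rint_cst.
rewrite ExD; [|exact: rintD|exact: rintZ].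
rewrite ExD// psiE [Ex nu (fun=> 1)]Ex_cst addr0 ExZ// lee_fin.
rewrite (le_trans _ (expR_ge1Dx _))// lerD2l le_eqVlt; apply/orP; left; apply/eqP; ring.
Qed.

End subexp_gauss.

Section concentration.
Context {d : measure_display} {T : measurableType d} {R : realType}.
Variable P : probability T R.

Definition l1lip n (c : 'I_n -> R) (Phi : n.-tuple R -> R) :=
  forall t t', `|Phi t - Phi t'| <= \sum_i c i * `|tnth t i - tnth t' i|.

Lemma rint_distribution (X : {RV P >-> R}) (f : R -> R) :
  rint (distribution P X) f -> rint P (f \o X).
Proof.
move=> /integrableP[mf foo]; apply/integrableP; split.
  by apply/measurable_EFinP/measurableT_comp => //; exact/measurable_EFinP.
move: foo; rewrite ge0_integral_distribution//.
exact/measurableT_comp.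
Qed.

Lemma tupleRV_cons n (X : 'I_n.+1 -> T -> R) w :
  tupleRV X w = [tuple of X ord0 w :: tupleRV (fun i => X (lift ord0 i)) w].
Proof.
apply: eq_from_tnth => i; rewrite tnth_mktuple.
by case: (unliftP ord0 i) => [j ->|->]; rewrite ?tnthS ?tnth_mktuple// tnth0.
Qed.

Lemma findep_lift n (X : 'I_n.+1 -> T -> R) : findep P X ->
  findep P (fun i => X (lift ord0 i)).
Proof.
move=> iX A mA.
have mA' i : measurable (oapp A setT (unlift ord0 i)).
  by case: (unlift ord0 i) => [j|] /=; [exact: mA|exact: measurableT].
have := iX _ mA'.
rewrite big_ord_recl unlift_none/= preimage_setT probability_setT mul1e.
under eq_bigr do rewrite liftK/=.
move=> <-; congr (P _); apply/seteqP; split=> w /= h i.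
  by case: (unliftP ord0 i) => [j ->|->]; rewrite ?liftK ?unlift_none.
by have := h (lift ord0 i); rewrite liftK.
Qed.

Lemma findep_cons_cyl n (X : 'I_n.+1 -> T -> R) : findep P X ->
  forall A B, measurable A -> (forall i : 'I_n, measurable (B i)) ->
  P (X ord0 @^-1` A `&` tupleRV (fun i => X (lift ord0 i)) @^-1` (cyl B)) =
  (P (X ord0 @^-1` A) * P (tupleRV (fun i => X (lift ord0 i)) @^-1` (cyl B)))%E.
Proof.
move=> iX A B mA mB.
have mB' i : measurable (oapp B A (unlift ord0 i)).
  by case: (unlift ord0 i) => [j|] /=; [exact: mB|exact: mA].
have := iX _ mB'.
rewrite big_ord_recl unlift_none/=.
under eq_bigr do rewrite liftK/=.
have cE : tupleRV (fun i => X (lift ord0 i)) @^-1` cyl B =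
    [set w | forall k, B k (X (lift ord0 k) w)].
  by apply/seteqP; split=> w /= h i; have := h i; rewrite tnth_mktuple.
rewrite cE (findep_lift iX mB) => <-; congr (P _); apply/seteqP; split=> w /=.
  move=> [h0 h] i.
  by case: (unliftP ord0 i) => [j ->|->]; rewrite ?liftK ?unlift_none.
move=> h; split; first by have := h ord0; rewrite unlift_none.
by move=> k; have := h (lift ord0 k); rewrite liftK.
Qed.

(** Induction on the number of coordinates. Averaging over the first one leaves a function [F] of
    the others with the same remaining Lipschitz constants, and the fluctuation around [F]
    contributes one factor [expR (K * c ord0 ^+ 2)]. *)
Lemma concentration n (X : 'I_n -> {RV P >-> R}) (c : 'I_n -> R) (K : R)
    (Phi : n.-tuple R -> R) :
  findep P (fun i => X i : T -> R) ->
  (forall i, subexp (distribution P (X i)) K) -> (forall i, 0 <= c i <= 1) ->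
  measurable_fun setT Phi -> l1lip c Phi ->
  let Y w := Phi (tupleRV (fun i => X i : T -> R) w) in
  rint P Y /\
  (\int[P]_w (expR (Y w - Ex P Y))%:E <= (expR (K * \sum_i c i ^+ 2))%:E)%E.
Proof.
elim: n X c Phi => [|n IH] X c Phi iX sX c01 mPhi lPhi Y.
  have -> : Y = cst (Phi [tuple]) by apply/funext => w; rewrite /Y tuple0.
  split; first exact: rint_cst.
  rewrite Ex_cst big_ord0 mulr0 expR0.
  under eq_integral => w _ do rewrite /= subrr expR0.
  by rewrite integral_cst// mul1e probability_le1.
have mX i : measurable_fun setT (X i : T -> R) by exact: measurable_funPT.
pose X' i : {RV P >-> R} := X (lift ord0 i).
have mX' : measurable_fun setT (tupleRV (fun i => X' i : T -> R)).
  by apply: measurable_tupleRV => i; exact: mX.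
pose V : {mfun T >-> n.-tuple R} := mfun_Sub (mem_set mX').
pose phi (z : R * n.-tuple R) := Phi [tuple of z.1 :: z.2].
have mphi : measurable_fun setT phi.
  by apply: (measurableT_comp mPhi); exact: measurable_cons.
have YE w : Y w = phi (X ord0 w, V w) by rewrite /Y tupleRV_cons.
have indV (A : set R) (B : 'I_n -> set R) : measurable A -> (forall i, measurable (B i)) ->
    P (X ord0 @^-1` A `&` V @^-1` (cyl B)) =
    (P (X ord0 @^-1` A) * P (V @^-1` (cyl B)))%E.
  exact: (findep_cons_cyl iX).
have iabs i : rint P (fun w => `|X i w|).
  have [||+ _] := sX i (fun x => `|x|) 1; first by rewrite ler01 lexx.
    by move=> x y; rewrite mul1r ler_dist_dist.
  by move=> /rint_distribution.
have lx y : forall x x', `|phi (x, y) - phi (x', y)| <= c ord0 * `|x - x'|.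
  move=> x x'; apply: (le_trans (lPhi _ _)).
  rewrite big_ord_recl !tnth0 big1 ?addr0// => i _.
  by rewrite !tnthS subrr normr0 mulr0.
have iY : rint P Y.
  apply: (@rint_le _ _ _ _ _ (fun w => `|Phi [tuple 0 | i < n.+1]| +
     \sum_i c i * `|X i w|)).
  - by apply: (measurableT_comp mPhi); exact: measurable_tupleRV.
  - apply: rintD; first exact: rint_cst.
    by apply: rint_sum => i _; exact: rintZ.
  - move=> w; rewrite -[Y w](subrK (Phi [tuple 0 | i < n.+1])) addrC.
    rewrite (le_trans (ler_normD _ _))// lerD2l (le_trans (lPhi _ _))//.
    apply: ler_sum => i _.
    by rewrite !tnth_mktuple subr0.
have iphi : rint P (fun w => phi (X ord0 w, V w)).
  by rewrite (_ : (fun w => _) = Y)//; apply/funext.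
have iphix y : rint (distribution P (X ord0)) (fun x => phi (x, y)).
  by have [] := sX ord0 (fun x => phi (x, y)) (c ord0) (c01 _) (lx y).
pose F y := Ex (distribution P (X ord0)) (fun x => phi (x, y)).
have [mF iF EF] := Ex_pair indV mphi iphi iphix.
have lF : l1lip (fun i => c (lift ord0 i)) F.
  move=> t t'; rewrite /F -ExB//.
  have i1 : rint (distribution P (X ord0)) (fun x => phi (x, t) - phi (x, t')).
    exact: rintB.
  apply: (le_trans (normr_Ex i1)); rewrite -[leRHS](@Ex_cst _ _ _ (distribution P (X ord0))).
  apply: Ex_le; [exact: rint_norm|exact: rint_cst|] => x /=.
  apply: (le_trans (lPhi _ _)).
  rewrite big_ord_recl !tnth0 subrr normr0 mulr0 add0r.
  by apply: ler_sum => i _; rewrite !tnthS.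
have [iFV boundF] := IH X' (fun i => c (lift ord0 i)) F (findep_lift iX)
  (fun i => sX _) (fun i => c01 _) mF lF.
split=> //.
have EY : Ex P Y = Ex P (fun w => F (V w)).
  by rewrite -EF; apply: eq_Ex.
set m := Ex P (fun w => F (V w)) in EY *.
under eq_integral => w _ do rewrite YE EY.
rewrite (ge0_integral_pair indV (f := fun z => (expR (phi z - m))%:E)); last 2 first.
- by apply/measurable_EFinP/measurableT_comp => //; exact: measurable_funB.
- by move=> z; rewrite lee_fin expR_ge0.
have mexp (G : R * n.-tuple R -> R) : measurable_fun setT G ->
    measurable_fun setT (fun z => (expR (G z))%:E).
  by move=> mG; apply/measurable_EFinP/measurableT_comp.
have mFV : measurable_fun setT (fun w => (expR (F (V w) - m))%:E).
  apply/measurable_EFinP/measurableT_comp => //; apply: measurable_funB => //.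
  exact: measurableT_comp.
rewrite big_ord_recl mulrDr expRD EFinM.
(* Split [phi - m] as [(phi - F) + (F - m)]: the second summand is constant in the first coordinate,
   and the first is controlled by [subexp] with the other coordinates frozen. *)
apply: (@le_trans _ _ (\int[P]_w ((expR (K * c ord0 ^+ 2))%:E * (expR (F (V w) - m))%:E))%E).
  apply: ge0_le_integral => //.
  - by move=> w _; apply: integral_ge0 => x _; rewrite lee_fin expR_ge0.
  - have := @measurable_fun_fubini_tonelli_G _ _ _ _ _ (distribution P (X ord0))
      (fun z => (expR (phi z - m))%:E) => h.
    apply: (measurableT_comp (h _ _)) => //.
    by apply/measurable_EFinP/measurableT_comp => //; exact: measurable_funB.
  - exact: emeasurable_funM.
  - move=> w _.
    have [_ h] := sX ord0 (fun x => phi (x, V w)) (c ord0) (c01 _) (lx (V w)).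
    rewrite muleC; apply: le_trans (lee_wpmul2l _ h); last by rewrite lee_fin expR_ge0.
    rewrite -ge0_integralZl_EFin ?expR_ge0//.
    + rewrite le_eqVlt; apply/orP; left; apply/eqP; apply: eq_integral => x _.
      by rewrite -EFinM -expRD; congr (expR _)%:E; rewrite /F; ring.
    + apply/measurable_EFinP/measurableT_comp => //; apply: measurable_funB => //.
      exact: (rint_meas (iphix (V w))).
rewrite ge0_integralZl_EFin ?expR_ge0//.
by apply: lee_wpmul2l => //; rewrite lee_fin expR_ge0.
Qed.

End concentration.

(** * Gaussian interpolation *)

Section finite_families.
Context {d : measure_display} {T : measurableType d} {R : realType}.
Variable P : probability T R.
Context {K : finType}.

Definition kval (t : #|K|.-tuple R) (k : K) : R := tnth t (enum_rank k).

Definition tupK (X : K -> T -> R) (w : T) : #|K|.-tuple R :=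
  tupleRV (fun i => X (enum_val i)) w.

Lemma kval_tupK X w : kval (tupK X w) = X^~ w.
Proof. by apply/funext => k; rewrite /kval tnth_mktuple enum_rankK. Qed.

Lemma measurable_kval k : measurable_fun setT (kval^~ k).
Proof. exact: measurable_tnth. Qed.

Lemma findep_enum (X : K -> T -> R) : findep P X ->
  findep P (fun i : 'I_#|K| => X (enum_val i)).
Proof.
move=> iX A mA.
have := iX (fun k => A (enum_rank k)) (fun k => mA _).
rewrite (reindex (@enum_val K predT))/=; last exact: onW_bij (enum_val_bij _).
under eq_bigr do rewrite enum_valK.
move=> <-; congr (P _); apply/seteqP; split=> w /= h k.
  by have := h (enum_rank k); rewrite enum_rankK.
by have := h (enum_val k); rewrite enum_valK.
Qed.

Lemma concentrationK (X : K -> {RV P >-> R}) (c : K -> R) (L : R)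
    (Phi : (K -> R) -> R) :
  findep P (fun k => X k : T -> R) ->
  (forall k, subexp (distribution P (X k)) L) -> (forall k, 0 <= c k <= 1) ->
  measurable_fun setT (Phi \o kval) ->
  (forall x y, `|Phi x - Phi y| <= \sum_k c k * `|x k - y k|) ->
  let Y w := Phi (fun k => X k w) in
  rint P Y /\
  (\int[P]_w (expR (Y w - Ex P Y))%:E <= (expR (L * \sum_k c k ^+ 2))%:E)%E.
Proof.
move=> iX sX c01 mPhi lPhi Y.
have YE : Y = (fun w => (Phi \o kval) (tupleRV (fun i : 'I_#|K| => X (enum_val i) : T -> R) w)).
  by apply/funext => w /=; rewrite -[tupleRV _ w]/(tupK X w) kval_tupK.
have sumE (F : K -> R) : \sum_k F k = \sum_(i < #|K|) F (enum_val i).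
  by rewrite (reindex (@enum_val K predT))//=; exact: onW_bij (enum_val_bij _).
rewrite YE sumE.
apply: (concentration (X := fun i : 'I_#|K| => X (enum_val i))) => //.
  exact: (findep_enum iX).
move=> t t' /=; apply: (le_trans (lPhi _ _)); rewrite sumE.
by apply: ler_sum => i _; rewrite /kval enum_valK.
Qed.

Lemma law_ExK (X X' : K -> T -> R) (Phi : (K -> R) -> R) :
  (forall k, measurable_fun setT (X k)) -> (forall k, measurable_fun setT (X' k)) ->
  findep P X -> findep P X' ->
  (forall k A, measurable A -> P (X k @^-1` A) = P (X' k @^-1` A)) ->
  measurable_fun setT (Phi \o kval) ->
  rint P (fun w => Phi (X^~ w)) -> rint P (fun w => Phi (X'^~ w)) ->
  Ex P (fun w => Phi (X^~ w)) = Ex P (fun w => Phi (X'^~ w)).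
Proof.
move=> mX mX' iX iX' XX' mPhi.
have E (V : K -> T -> R) : (fun w => Phi (V^~ w)) =
    (Phi \o kval) \o tupleRV (fun i : 'I_#|K| => V (enum_val i)).
  by apply/funext => w /=; rewrite -[tupleRV _ w]/(tupK V w) kval_tupK.
rewrite !E => iP iP'.
apply: tuple_law_Ex => //; [exact: (findep_enum iX)|exact: (findep_enum iX')|].
by move=> i A mA; exact: XX'.
Qed.

Section erase.
Variables (X : K -> {RV P >-> R}) (k : K).
Hypothesis iX : findep P (fun k => X k : T -> R).

Let mX j : measurable_fun setT (X j : T -> R). Proof. exact: measurable_funPT. Qed.

(** The [k]-th variable is overwritten by 0 rather than removed, so the index type does not change
    and energies can be evaluated on the result. *)
Definition eraseT (w : T) : #|K|.-tuple R :=
  tupK (fun j w => if j == k then 0 else X j w) w.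

Lemma measurable_eraseT : measurable_fun setT eraseT.
Proof. by apply: measurable_tupleRV => i; case: (enum_val i == k). Qed.

Definition eraseRV : {mfun T >-> #|K|.-tuple R} := mfun_Sub (mem_set measurable_eraseT).

Lemma indep_eraseRV A B : measurable A -> (forall i, measurable (B i)) ->
  P (X k @^-1` A `&` eraseRV @^-1` (cyl B)) =
  (P (X k @^-1` A) * P (eraseRV @^-1` (cyl B)))%E.
Proof.
move=> mA mB.
(* The erased coordinate is constantly 0: if 0 is not in the corresponding side, the box is never
   hit; otherwise that side imposes no condition. *)
have [Bk0|Bk0] := pselect (B (enum_rank k) 0); last first.
  have -> : eraseRV @^-1` cyl B = set0.
    apply/seteqP; split=> w //= h; apply: Bk0.
    by have := h (enum_rank k); rewrite tnth_mktuple enum_rankK eqxx.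
  by rewrite setI0 measure0 mule0.
pose BA (A : set R) j := if j == k then A else B (enum_rank j).
have mBA (A' : set R) : measurable A' -> forall j, measurable (BA A' j).
  by move=> mA' j; rewrite /BA; case: ifP.
have prodE (A' : set R) : measurable A' ->
    P [set w | forall j, BA A' j (X j w)] =
    (P (X k @^-1` A') * \prod_(j | j != k) P (X j @^-1` B (enum_rank j)))%E.
  move=> mA'; rewrite (iX (mBA _ mA')) (bigD1 k)//= /BA eqxx; congr (_ * _)%E.
  by apply: eq_bigr => j /negbTE ->.
have -> : eraseRV @^-1` cyl B = [set w | forall j, BA setT j (X j w)].
  apply/seteqP; split=> w /= h j; rewrite /BA.
    by have := h (enum_rank j); rewrite tnth_mktuple enum_rankK; case: ifP.
  have := h (enum_val j); rewrite tnth_mktuple /BA enum_valK.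
  by case: eqP => // ek _; rewrite -(enum_valK j) ek.
have -> : X k @^-1` A `&` [set w | forall j, BA setT j (X j w)] =
    [set w | forall j, BA A j (X j w)].
  apply/seteqP; split=> w /=.
    by move=> [Aw h] j; have := h j; rewrite /BA; case: eqP => // ->.
  move=> h; split; first by have := h k; rewrite /BA eqxx.
  by move=> j; have := h j; rewrite /BA; case: eqP.
by rewrite !prodE// preimage_setT probability_setT mul1e.
Qed.

Lemma kval_eraseRV w j : kval (eraseRV w) j = if j == k then 0 else X j w.
Proof. by rewrite /= /eraseT kval_tupK. Qed.

End erase.

Section gaussian.
Variables (X : K -> {RV P >-> R}) (s : K -> R).
Hypothesis iX : findep P (fun k => X k : T -> R).
Hypothesis gX : forall k, gauss_law (distribution P (X k)) (s k).
Context {C : finType} (c0 : C).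

Let mX j : measurable_fun setT (X j : T -> R). Proof. exact: measurable_funPT. Qed.

Lemma rint_gauss_abs k : rint P (fun w => `|X k w|).
Proof. exact: (rint_distribution (rint_abs (gauss_exp (gX k)))). Qed.

Definition linE (e : C -> R) (a : C -> K -> R) (x : K -> R) (c : C) : R :=
  e c + \sum_k a c k * x k.

Lemma measurable_linE e a c : measurable_fun setT (fun w => linE e a (X^~ w) c).
Proof.
apply: measurable_funD => //; apply: measurable_sumR => k.
exact: measurable_funM.
Qed.

Lemma measurable_av_linE e a f :
  measurable_fun setT (fun w => av (linE e a (X^~ w)) f).
Proof.
apply: (@measurable_av _ _ _ _ (fun w => linE e a (X^~ w)) _ c0) => c.
exact: measurable_linE.
Qed.

Definition cov (E : C -> R) (f g : C -> R) : R :=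
  av E (fun c => f c * g c) - av E f * av E g.

Lemma cov_bnd E f g M N : (forall c, `|f c| <= M) -> (forall c, `|g c| <= N) ->
  `|cov E f g| <= M * N *+ 2.
Proof.
move=> fM gN; rewrite /cov (le_trans (ler_normB _ _))// mulr2n lerD//.
  by apply: av_bnd => // c; rewrite normrM ler_pM.
by rewrite normrM ler_pM//; exact: av_bnd.
Qed.

(** With the other variables frozen, the energy is affine in the [k]-th one with slope [a c k]. The
    derivative of the Gibbs average is then the covariance of [f] with the slope, and the
    one-dimensional identity applies. *)
Lemma gauss_ibp_av (e : C -> R) (a : C -> K -> R) (f : C -> R) (M : R) k :
  (forall c, `|f c| <= M) ->
  Ex P (fun w => X k w * av (linE e a (X^~ w)) f) =
  s k ^+ 2 * Ex P (fun w => cov (linE e a (X^~ w)) f (a^~ k)).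
Proof.
move=> fM.
pose A := \sum_c `|a c k|.
have aA c : `|a c k| <= A by rewrite /A (bigD1 c)//= lerDl sumr_ge0.
pose E (y : #|K|.-tuple R) (x : R) c := linE e a (kval y) c + a c k * x.
pose V := eraseRV X k.
have EV w : E (V w) (X k w) = linE e a (X^~ w).
  apply/funext => c; rewrite /E /linE -addrA; congr (_ + _).
  rewrite (bigD1 k)//= [in RHS](bigD1 k)//= kval_eraseRV eqxx mulr0 add0r addrC.
  by congr (_ + _); apply: eq_bigr => j /negbTE jk; rewrite kval_eraseRV jk.
have indV := @indep_eraseRV X k iX.
have mE c : measurable_fun setT (fun z : R * #|K|.-tuple R => E z.2 z.1 c).
  apply: measurable_funD; last exact: measurable_funM.
  apply: measurable_funD => //; apply: measurable_sumR => j.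
  apply: measurable_funM => //.
  exact: (measurableT_comp (measurable_kval j) measurable_snd).
have mav g : measurable_fun setT (fun z : R * #|K|.-tuple R => av (E z.2 z.1) g).
  exact: measurable_av.
pose phi1 (z : R * #|K|.-tuple R) := z.1 * av (E z.2 z.1) f.
pose phi2 (z : R * #|K|.-tuple R) := s k ^+ 2 * cov (E z.2 z.1) f (a^~ k).
have mphi1 : measurable_fun setT phi1 by exact: measurable_funM.
have mphi2 : measurable_fun setT phi2.
  apply: measurable_funM => //; apply: measurable_funB => //.
  exact: measurable_funM.
have phi1b z : `|phi1 z| <= M * `|z.1|.
  by rewrite normrM mulrC ler_wpM2r//; exact: av_bnd.
have phi2b z : `|phi2 z| <= s k ^+ 2 * (M * A *+ 2).
  by rewrite normrM ger0_norm ?sqr_ge0// ler_wpM2l ?sqr_ge0//; exact: cov_bnd.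
have mpair : measurable_fun setT (fun w => (X k w, V w)).
  exact: measurable_fun_pair.
have -> : (fun w => X k w * av (linE e a (X^~ w)) f) = fun w => phi1 (X k w, V w).
  by apply/funext => w; rewrite /phi1/= EV.
have i2 : rint P (fun w => phi2 (X k w, V w)).
  apply: (@rint_bnd _ _ _ _ _ (s k ^+ 2 * (M * A *+ 2))) => //.
  exact: (measurableT_comp mphi2 mpair).
have icov : rint P (fun w => cov (linE e a (X^~ w)) f (a^~ k)).
  apply: (@rint_bnd _ _ _ _ _ (M * A *+ 2)); last by move=> w; exact: cov_bnd.
  apply: measurable_funB; first exact: measurable_av_linE.
  by apply: measurable_funM; exact: measurable_av_linE.
rewrite -ExZ//.
have -> : (fun w => s k ^+ 2 * cov (linE e a (X^~ w)) f (a^~ k)) =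
    fun w => phi2 (X k w, V w).
  by apply/funext => w; rewrite /phi2/= EV.
have i1 : rint P (fun w => phi1 (X k w, V w)).
  apply: (@rint_le _ _ _ _ _ (fun w => M * `|X k w|)) => //.
    exact: (measurableT_comp mphi1 mpair).
  exact/rintZ/rint_gauss_abs.
have mx y : measurable_fun setT (fun x : R => (x, y : #|K|.-tuple R)).
  exact: measurable_fun_pair.
have i1x y : rint (distribution P (X k)) (fun x => phi1 (x, y)).
  apply: (@rint_le _ _ _ _ _ (fun x : R => M * `|x|)) => //.
  - exact: (measurableT_comp mphi1 (mx y)).
  - exact/rintZ/(rint_abs (gauss_exp (gX k))).
have i2x y : rint (distribution P (X k)) (fun x => phi2 (x, y)).
  apply: (@rint_bnd _ _ _ _ _ (s k ^+ 2 * (M * A *+ 2))) => //.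
  exact: (measurableT_comp mphi2 (mx y)).
have [_ _ ->] := Ex_pair indV mphi1 i1 i1x.
have [_ _ ->] := Ex_pair indV mphi2 i2 i2x.
apply: eq_Ex => w; rewrite /phi1 /phi2/=.
set y := V w.
have dE c (x : R) : is_derive x 1 (fun x => E y x c) (a c k).
  by rewrite /E; apply: is_derive_eq; rewrite /GRing.scale/=; ring.
have dav g (x : R) : is_derive x 1 (fun x => av (E y x) g) (cov (E y x) g (a^~ k)).
  exact: is_derive_av.
have cav g : continuous (fun x => av (E y x) g).
  by move=> x; apply/differentiable_continuous/derivable1_diffP; exact: ex_derive.
have ccov : continuous (fun x => cov (E y x) f (a^~ k)).
  by move=> x; apply: cvgB; [exact: cav|apply: cvgM; exact: cav].
have bnd1 x : `|av (E y x) f| <= Num.max M (M * A *+ 2).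
  by rewrite le_max av_bnd.
have bnd2 x : `|cov (E y x) f (a^~ k)| <= Num.max M (M * A *+ 2).
  by rewrite le_max cov_bnd ?orbT.
rewrite (gauss_ibp (gX k) (dav f) ccov bnd1 bnd2) ExZ//.
apply: (@rint_bnd _ _ _ _ _ (Num.max M (M * A *+ 2))) => //.
exact: continuous_measurable_fun.
Qed.

Lemma normr_lnZ_linE e a x :
  `|lnZ (linE e a x)| <= `|lnZ e| + \sum_k (\sum_c `|a c k|) * `|x k|.
Proof.
rewrite -[lnZ (linE e a x)](subrK (lnZ e)) addrC (le_trans (ler_normD _ _))// lerD2l.
apply: lnZ_lip => // c; rewrite /linE addrAC subrr add0r.
rewrite (le_trans (ler_norm_sum _ _ _))//; apply: ler_sum => k _.
by rewrite normrM ler_wpM2r// (bigD1 c)//= lerDl sumr_ge0.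
Qed.

Lemma measurable_lnZ_linE e a : measurable_fun setT (fun w => lnZ (linE e a (X^~ w))).
Proof.
apply: (@measurable_lnZ _ _ _ _ (fun w => linE e a (X^~ w))) => c.
exact: measurable_linE.
Qed.

Lemma rint_lnZ_linE e a : rint P (fun w => lnZ (linE e a (X^~ w))).
Proof.
apply: (rint_le (measurable_lnZ_linE e a) _ (fun w => normr_lnZ_linE e a (X^~ w))).
apply: rintD; first exact: rint_cst.
by apply: rint_sum => k _; apply: rintZ; exact: rint_gauss_abs.
Qed.

Section interpolation.
Variables (e : C -> R) (a : C -> K -> R) (u du : K -> R -> R).
Hypothesis du1 : forall k (t : R), is_derive t 1 (u k) (du k t).
Hypothesis du_le1 : forall k t, `|du k t| <= 1.

Definition path t c k := u k t * a c k.

(** Differentiation under the integral, dominated by [G] because [|du| <= 1], produces one term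
    linear in each [X k]. Integration by parts replaces [X k] by a covariance with the slope
    [u k t * a c k], whence the product [u * du]. *)
Lemma is_derive_interpolation (t : R) :
  is_derive t 1 (fun t => Ex P (fun w => lnZ (linE e (path t) (X^~ w))))
    (\sum_k u k t * du k t * s k ^+ 2 *
       Ex P (fun w => cov (linE e (path t) (X^~ w)) (a^~ k) (a^~ k))).
Proof.
pose f (t : R) w := lnZ (linE e (path t) (X^~ w)).
pose A k : R := \sum_c `|a c k|.
have aA c k : `|a c k| <= A k by rewrite /A (bigD1 c)//= lerDl sumr_ge0.
pose G w : R := \sum_k A k * `|X k w|.
have G0 w : 0 <= G w.
  by apply: sumr_ge0 => k _; rewrite mulr_ge0// sumr_ge0.
have iG : rint P G by apply: rint_sum => k _; apply: rintZ; exact: rint_gauss_abs.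
have df (t' : R) w : is_derive t' 1 (f ^~ w)
    (av (linE e (path t') (X^~ w)) (fun c => \sum_k du k t' * a c k * X k w)).
  apply: is_derive_lnZ => // c.
  have h k : is_derive t' 1 (fun t => path t c k * X k w) (du k t' * a c k * X k w).
    have := du1 k t' => h1.
    by rewrite /path; apply: is_derive_eq; rewrite /GRing.scale/=; ring.
  have h2 := is_derive_bigsum (index_enum K) h.
  by have := is_deriveD (is_derive_cst (e c) t' 1) h2; rewrite add0r.
have d1E t' w : partial1of2 f t' w =
    av (linE e (path t') (X^~ w)) (fun c => \sum_k du k t' * a c k * X k w).
  by rewrite /partial1of2 derive1E; exact: derive_val.
have Gub t' w : `|partial1of2 f t' w| <= G w.
  rewrite d1E; apply: av_bnd => // c.
  rewrite (le_trans (ler_norm_sum _ _ _))//; apply: ler_sum => k _.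
  rewrite !normrM ler_wpM2r// -[leRHS]mul1r ler_pM//.
have It : (`]t - 1, t + 1[%classic : set R) t.
  by rewrite /= in_itv/= gtrBl ltr01 ltrDl ltr01.
have intf t' : (`]t - 1, t + 1[%classic : set R) t' -> rint P (f t').
  by move=> _; exact: rint_lnZ_linE.
have derf t' w : (`]t - 1, t + 1[%classic : set R) t' -> setT w -> derivable (f ^~ w) t' 1.
  by move=> _ _; exact: ex_derive.
have Gub' t' w : (`]t - 1, t + 1[%classic : set R) t' -> setT w -> `|partial1of2 f t' w| <= G w.
  by move=> _ _; exact: Gub.
have dif := derivable_under_integral measurableT It intf derf G0 iG Gub'.
have val := differentiation_under_integral measurableT It intf derf G0 iG Gub'.
apply: DeriveDef => //; rewrite -derive1E val.
under eq_Rintegral => w _ do rewrite d1E.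
have iterm k : rint P (fun w => X k w * av (linE e (path t) (X^~ w)) (a^~ k)).
  apply: (@rint_le _ _ _ _ _ (fun w => A k * `|X k w|)).
  - by apply: measurable_funM => //; exact: measurable_av_linE.
  - exact/rintZ/rint_gauss_abs.
  - by move=> w; rewrite normrM mulrC ler_wpM2r//; exact: av_bnd.
have -> : (\int[P]_x av (linE e (path t) (X^~ x))
    (fun c => \sum_k du k t * a c k * X k x))%R =
    Ex P (fun w => \sum_k du k t * (X k w * av (linE e (path t) (X^~ w)) (a^~ k))).
  apply: eq_Ex => w; rewrite av_sum; apply: eq_bigr => k _.
  rewrite mulrA -avZ; apply: eq_av => c; ring.
rewrite Ex_sum; last by move=> k _; exact: rintZ.
apply: eq_bigr => k _; rewrite ExZ// (gauss_ibp_av _ _ _ (aA^~ k)).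
have -> : Ex P (fun w => cov (linE e (path t) (X^~ w)) (a^~ k) ((path t)^~ k)) =
    u k t * Ex P (fun w => cov (linE e (path t) (X^~ w)) (a^~ k) (a^~ k)).
  rewrite -ExZ; last first.
    apply: (@rint_bnd _ _ _ _ _ (A k * A k *+ 2)); last first.
      by move=> w; apply: cov_bnd.
    apply: measurable_funB; first exact: measurable_av_linE.
    by apply: measurable_funM; exact: measurable_av_linE.
  apply: eq_Ex => w; rewrite /cov; set EE := linE _ _ _.
  rewrite -[(path t)^~ k]/(fun c => u k t * a c k) avZ mulrBr mulrCA; congr (_ - _).
  by rewrite -avZ; apply: eq_av => c; rewrite mulrCA.
ring.
Qed.

End interpolation.

End gaussian.
End finite_families.

(** * Measurable limits, convexity of powers, superadditive sequences *)

Section generic_lemmas.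
Context {R : realType}.

(** The tolerances are countable, so the set where a sequence of measurable functions converges is a
    countable combination of measurable sets. *)
Lemma cvgn_cauchyE (u : nat -> R) :
  cvgn u <-> forall k : nat, exists N : nat, forall m n : nat,
    (N <= m)%N -> (N <= n)%N -> `|u m - u n| <= k.+1%:R^-1.
Proof.
split=> [cu k|h].
  have /cvgrPdist_le/(_ (k.+1%:R^-1 / 2)) := cu.
  case; first by rewrite divr_gt0 ?invr_gt0 ?ltr0n.
  move=> N _ hN; exists N => m n Nm Nn.
  rewrite -(subrKA (limn u)) (le_trans (ler_normD _ _))// [leRHS]splitr.
  by rewrite lerD// ?hN// distrC hN.
apply: cauchy_cvg; apply/cauchy_exP => e e0.
have [k ke] : exists k : nat, k.+1%:R^-1 < e.
  by have [k _ /(_ k (leqnn _))] := near_infty_natSinv_lt (PosNum e0); exists k.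
have [N hN] := h k; exists (u N); exists N => // n /= Nn.
by rewrite /ball/= (le_lt_trans _ ke)// hN.
Qed.

Lemma measurable_limn d (T : measurableType d) (X : nat -> T -> R) :
  (forall n, measurable_fun setT (X n)) ->
  measurable_fun setT (fun w => limn (X ^~ w)).
Proof.
move=> mX.
pose C := \bigcap_(k : nat) \bigcup_(N : nat) \bigcap_(m in [set m | (N <= m)%N])
  \bigcap_(n in [set n | (N <= n)%N]) [set w | `|X m w - X n w| <= k.+1%:R^-1].
have CE w : C w <-> cvgn (X ^~ w).
  rewrite cvgn_cauchyE; split=> [h k|h k _].
    by have [N _ hN] := h k I; exists N => m n Nm Nn; exact: hN.
  by have [N hN] := h k; exists N => // m Nm n Nn; exact: hN.
have mC : measurable C.
  apply: bigcap_measurable => // k _; apply: bigcup_measurable => N _.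
  apply: bigcap_measurable => [|m Nm]; first by exists N => /=.
  apply: bigcap_measurable => [|n Nn]; first by exists N => /=.
  rewrite -[X in measurable X]setTI; apply: measurable_fun_le => //.
  by apply: measurableT_comp => //; exact: measurable_funB.
pose Y n w : R := X n w * \1_C w + (point : R) * \1_(~` C) w.
(* Where the sequence diverges, [limn] takes the default value [point]; [Y] is made constant equal
   to it there, and thus converges everywhere. *)
apply: (@measurable_fun_cvg _ T R setT Y).
  move=> n; apply: measurable_funD; apply: measurable_funM => //.
  by apply: measurable_indic; exact: measurableC.
move=> w _; rewrite /Y !indicE in_setC; have [Cw|Cw] := boolP (w \in C).
  rewrite /= mulr0; under eq_fun do rewrite mulr1 addr0.
  by apply/CE; rewrite inE in Cw.
rewrite /= mulr1; under eq_fun do rewrite mulr0 add0r.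
rewrite (_ : limn _ = point); first exact: cvg_cst.
by apply: dvgP => /CE; rewrite notin_setE in Cw.
Qed.

Lemma sum_tuple_prod (I : finType) (f : I -> R) n :
  \sum_(t : n.-tuple I) \prod_(i <- t) f i = (\sum_i f i) ^+ n.
Proof.
elim: n => [|n IH].
  rewrite expr0 (big_pred1 [tuple]) ?big_nil// => t.
  by apply/esym/eqP; rewrite tuple0.
rewrite exprS -IH big_distrlr/= pair_big/=.
rewrite (reindex (fun p : I * n.-tuple I => [tuple of p.1 :: p.2]))/=; last first.
  exists (fun t => (thead t, [tuple of behead t])) => [[i t]|t] _ /=.
    by congr pair; exact/val_inj.
  exact/esym/tuple_eta.
by apply: eq_bigr => -[i t] _; rewrite big_cons.
Qed.

Lemma powX_convex (a b x y : R) p : 0 <= a -> 0 <= b -> a + b = 1 ->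
  0 <= x -> 0 <= y -> (a * x + b * y) ^+ p <= a * x ^+ p + b * y ^+ p.
Proof.
move=> a0 b0 ab1 x0 y0; elim: p => [|p IH]; first by rewrite !expr0 !mulr1 ab1.
rewrite exprSr.
apply: (@le_trans _ _ ((a * x ^+ p + b * y ^+ p) * (a * x + b * y))).
  by rewrite ler_wpM2r// addr_ge0// mulr_ge0.
have xy : 0 <= (x ^+ p - y ^+ p) * (x - y).
  have [xy|yx] := leP x y.
    by rewrite mulr_le0// subr_le0// lerXn2r.
  by rewrite mulr_ge0// subr_ge0 ?lerXn2r// ltW.
rewrite !exprSr -subr_ge0.
have -> : a * (x ^+ p * x) + b * (y ^+ p * y) -
    (a * x ^+ p + b * y ^+ p) * (a * x + b * y) =
    a * b * ((x ^+ p - y ^+ p) * (x - y)).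
  have -> : b = 1 - a by lra.
  ring.
by apply: mulr_ge0 => //; exact: mulr_ge0.
Qed.

(** The arguments will be overlaps, which may be negative: squares are taken first, then convexity
    of the power on nonnegative numbers is used. *)
Lemma even_powX_convex (a b x y : R) p : 0 <= a -> 0 <= b -> a + b = 1 ->
  (a * x + b * y) ^+ p.*2 <= a * x ^+ p.*2 + b * y ^+ p.*2.
Proof.
move=> a0 b0 ab1; rewrite -!mul2n !exprM.
apply: (@le_trans _ _ ((a * x ^+ 2 + b * y ^+ 2) ^+ p)).
  apply: lerXn2r; rewrite ?nnegrE ?sqr_ge0//.
    by apply: addr_ge0; apply: mulr_ge0 => //; exact: sqr_ge0.
  rewrite -subr_ge0.
  have -> : a * x ^+ 2 + b * y ^+ 2 - (a * x + b * y) ^+ 2 = a * b * (x - y) ^+ 2.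
    have -> : b = 1 - a by lra.
    ring.
  by apply: mulr_ge0; [exact: mulr_ge0|exact: sqr_ge0].
by apply: powX_convex => //; exact: sqr_ge0.
Qed.

(** Writing [n = q m + r], superadditivity and nonnegativity give [a n >= q a m], so that [a n / n]
    falls short of [a m / m] by at most [a m / n]. *)
Lemma fekete (a : nat -> R) (B : R) :
  (forall n, 0 <= a n) -> (forall n, (0 < n)%N -> a n <= n%:R * B) ->
  (forall m n, (0 < m)%N -> (0 < n)%N -> a m + a n <= a (m + n)%N) ->
  cvgn (fun n => n%:R^-1 * a n).
Proof.
move=> a0 aB asup.
pose S := [set n%:R^-1 * a n | n in [set n | (0 < n)%N]].
have S0 : has_sup S.
  split; first by exists (1%:R^-1 * a 1%N); exists 1%N.
  exists B => _ [n n0 <-].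
  by rewrite ler_pdivrMl ?ltr0n// aB.
have amul m q : (0 < m)%N -> q%:R * a m <= a (q * m)%N.
  move=> m0; elim: q => [|q IH]; first by rewrite mul0r mul0n.
  rewrite mulSn; have [->|q0] := posnP q; first by rewrite mul1r mul0n addn0.
  rewrite -natr1 mulrDl mul1r addrC (le_trans _ (asup _ _ _ _))// ?lerD2l//.
  by rewrite muln_gt0 q0.
have amono m q r : (0 < m)%N -> q%:R * a m <= a (q * m + r)%N.
  move=> m0; have [->|r0] := posnP r; first by rewrite addn0 amul.
  have [->|q0] := posnP q; first by rewrite mul0r.
  rewrite (le_trans (amul m q m0))// (le_trans _ (asup _ _ _ _))// ?lerDl//.
  by rewrite muln_gt0 q0.
apply/cvg_ex; exists (sup S); apply/cvgrPdist_le => e e0.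
have e2 : 0 < e / 2 by rewrite divr_gt0.
have [_ [m m0 <-] hm] := sup_adherent e2 S0.
have M0 : 0 <= m%:R^-1 * a m by rewrite mulr_ge0// invr_ge0.
(* Beyond this rank the loss [a m / n] is at most [e / 2]. *)
have [N hN] : exists N : nat, a m / (e / 2) <= N%:R.
  by exists (Num.bound (a m / (e / 2))); apply/ltW/archi_boundP; rewrite divr_ge0// ltW.
exists N.+1 => // n /= Nn; have n0 : (0 < n)%N by rewrite (leq_trans _ Nn).
have ub : n%:R^-1 * a n <= sup S by apply: sup_upper_bound => //; exists n.
rewrite ger0_norm ?subr_ge0// lerBlDr.
suff : m%:R^-1 * a m - e / 2 <= n%:R^-1 * a n by move: hm; lra.
have h1 := amono m (n %/ m)%N (n %% m)%N m0.
rewrite -divn_eq in h1.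
have hn : n%:R <= ((n %/ m)%:R + 1) * m%:R :> R.
  by rewrite natr1 -natrM ler_nat ltnW// ltn_ceil.
have mp : 0 < m%:R :> R by rewrite ltr0n.
have np : 0 < n%:R :> R by rewrite ltr0n.
rewrite lerBlDr.
have am : a m <= (e / 2) * n%:R.
  rewrite -ler_pdivrMl// mulrC (le_trans hN)// ler_nat ltnW//.
rewrite -(ler_pM2l np) mulrDr mulVKf ?gt_eqF//.
apply: (@le_trans _ _ (((n %/ m)%:R + 1) * m%:R * (m%:R^-1 * a m))).
  by rewrite ler_wpM2r.
rewrite -mulrA mulVKf ?gt_eqF// mulrDl mul1r lerD// mulrC.
by rewrite mulrC [leRHS]mulrC.
Qed.

End generic_lemmas.

(** Integration by parts against the constant function 1. *)
Lemma gauss_mean0 {R : realType} (nu : probability R R) (s : R) :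
  gauss_law nu s -> Ex nu id = 0.
Proof.
move=> gnu.
have d1 (x : R) : is_derive x 1 (cst 1 : R -> R) ((cst 0 : R -> R) x).
  exact: is_derive_cst.
have c0 : continuous (cst 0 : R -> R) by move=> x; exact: cvg_cst.
have := gauss_ibp gnu d1 c0 (C := 1).
rewrite Ex_cst mulr0 => <- //; last 2 first.
- by move=> x; rewrite /= normr1.
- by move=> x; rewrite /= normr0.
by apply: eq_Ex => x /=; rewrite mulr1.
Qed.

Lemma normr_le_expR {R : realType} (x : R) : `|x| <= expR x + expR (- x).
Proof. by have := abs_le_expR x; rewrite mul1r mulN1r. Qed.

Section linear_forms.
Context {d : measure_display} {T : measurableType d} {R : realType}.
Variable P : probability T R.
Context {K : finType} (X : K -> {RV P >-> R}) (L : R).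
Hypothesis L0 : 0 <= L.
Hypothesis iX : findep P (fun k => X k : T -> R).
Hypothesis sX : forall k, subexp (distribution P (X k)) L.
Hypothesis X0 : forall k, rint P (X k) /\ Ex P (X k) = 0.

(** After division by [v] the coefficients are at most 1 and their squares sum to at most 1, so the
    exponential moments of the form and of its opposite are bounded by [expR L]. Then
    [|z| <= e^z + e^(-z)]. *)
Lemma Ex_abs_linear (a : K -> R) (v : R) : 0 < v -> \sum_k a k ^+ 2 <= v ^+ 2 ->
  rint P (fun w => `|\sum_k a k * X k w|) /\
  Ex P (fun w => `|\sum_k a k * X k w|) <= v * (2 * expR L).
Proof.
move=> v0 av2.
pose c k := `|a k| / v.
have sc2 : \sum_k c k ^+ 2 <= 1.
  rewrite (_ : \sum_k c k ^+ 2 = (\sum_k a k ^+ 2) / v ^+ 2).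
    by rewrite ler_pdivrMr ?exprn_gt0// mul1r.
  by rewrite mulr_suml; apply: eq_bigr => k _; rewrite /c exprMn exprVn real_normK ?num_real.
have c01 k : 0 <= c k <= 1.
  have c0 : 0 <= c k by rewrite divr_ge0// ltW.
  rewrite c0/= -(expr_le1 (n := 2))// (le_trans _ sc2)// (bigD1 k)//= lerDl.
  by apply: sumr_ge0 => j _; exact: sqr_ge0.
pose S e (x : K -> R) := \sum_k (e * a k / v) * x k.
have iaX : rint P (fun w => \sum_k a k * X k w).
  by apply: rint_sum => k _; apply: rintZ; have [] := X0 k.
have exp1 e : `|e| = 1 ->
    rint P (fun w => expR (S e (fun k => X k w))) /\
    Ex P (fun w => expR (S e (fun k => X k w))) <= expR L.
  move=> e1.
  have mS : measurable_fun setT (S e \o kval).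
    apply: measurable_sumR => k; apply: measurable_funM => //.
    exact: measurable_kval.
  have lS x y : `|S e x - S e y| <= \sum_k c k * `|x k - y k|.
    rewrite /S -sumrB (le_trans (ler_norm_sum _ _ _))//; apply: ler_sum => k _.
    by rewrite -mulrBr !normrM e1 mul1r [`|v^-1|]ger0_norm// invr_ge0 ltW.
  have [iS bS] := concentrationK iX sX c01 mS lS.
  have ES : Ex P (fun w => S e (fun k => X k w)) = 0.
    rewrite /S Ex_sum; last by move=> k _; apply: rintZ; have [] := X0 k.
    by apply: big1 => k _; have [ik ek] := X0 k; rewrite ExZ// ek mulr0.
  move: bS; rewrite ES; under eq_integral do rewrite subr0; move=> bS.
  have bS' : (\int[P]_w (expR (S e (fun k => X k w)))%:E <= (expR L)%:E)%E.
    by rewrite (le_trans bS)// lee_fin ler_expR ler_piMr.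
  have iexp : rint P (fun w => expR (S e (fun k => X k w))).
    apply/integrableP; split.
      by apply/measurable_EFinP/measurableT_comp => //; exact: rint_meas iS.
    under eq_integral => w _ do rewrite /= ger0_norm ?expR_ge0//.
    by rewrite (le_lt_trans bS')// ltry.
  by split=> //; rewrite -lee_fin -integral_Ex.
have [i1 b1] := exp1 1 (normr1 _).
have [i2 b2] := exp1 (- 1) (normrN1 _).
have sE e w : S e (fun k => X k w) = e * (v^-1 * \sum_k a k * X k w).
  rewrite /S !mulr_sumr; apply: eq_bigr => k _; rewrite -!mulrA; congr (_ * _).
  by rewrite mulrCA.
have pt w : `|\sum_k a k * X k w| <=
    v * (expR (S 1 (fun k => X k w)) + expR (S (- 1) (fun k => X k w))).
  rewrite -ler_pdivrMl// !sE mul1r mulN1r.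
  rewrite (le_trans _ (normr_le_expR _))// normrM ger0_norm//.
  by rewrite invr_ge0 ltW.
split; first exact: rint_norm.
apply: (@le_trans _ _ (Ex P (fun w =>
    v * (expR (S 1 (fun k => X k w)) + expR (S (- 1) (fun k => X k w)))))).
  apply: Ex_le => //; first exact: rint_norm.
  by apply: rintZ; exact: rintD.
rewrite ExZ ?ExD//; last exact: rintD.
by rewrite ler_wpM2l ?(ltW v0)//; move: b1 b2; lra.
Qed.

End linear_forms.

(** * The truncated model *)

Section spins.
Context {R : realType}.

Lemma normr_spin N (c : config N) (i : 'I_N) : `|spin c i : R| = 1.
Proof. by rewrite /spin normrX normrN1 expr1n. Qed.

Lemma normr_prod_spin N (c : config N) (t : seq 'I_N) :
  `|\prod_(i <- t) (spin c i : R)| = 1.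
Proof.
elim: t => [|i t IH]; first by rewrite big_nil normr1.
by rewrite big_cons normrM normr_spin mul1r.
Qed.

(* Index of a coupling of order at most [n]: [(p, t)] stands for [g_t] with
   [t] a tuple of length [2(p+1)]. *)
Definition coupling (n N : nat) : finType := {p : 'I_n & (p.+1).*2.-tuple 'I_N}.

Definition coef (bp : nat -> R) (N p : nat) : R :=
  bp p.+1 / (N%:R `^ (p.+1%:R - 2^-1)).

Definition acoupling bp n N (c : config N) (k : coupling n N) : R :=
  coef bp N (tag k) * \prod_(i <- tagged k) spin c i.

Definition mkcoupling n N (p : 'I_n) (t : (p.+1).*2.-tuple 'I_N) : coupling n N :=
  existT (fun p : 'I_n => (p.+1).*2.-tuple 'I_N) p t.

Lemma sum_coupling n N (F : coupling n N -> R) :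
  \sum_k F k = \sum_(p < n) \sum_(t : (p.+1).*2.-tuple 'I_N) F (mkcoupling t).
Proof.
rewrite (sig_big_dep xpredT (fun _ => xpredT) (fun p t => F (mkcoupling t)))/=.
by apply: eq_bigr => -[p t].
Qed.

(** The normalisation [N^(p-1/2)] is chosen so that the [N^(2p)] couplings of one order give each
    configuration an energy of variance [N beta_p^2]. *)
Lemma coef_sqr bp N p : (0 < N)%N ->
  coef bp N p ^+ 2 * N%:R ^+ (p.+1).*2 = N%:R * bp p.+1 ^+ 2.
Proof.
move=> N0; have N0' : (N%:R : R) != 0 by rewrite pnatr_eq0 -lt0n.
rewrite /coef; set q := N%:R `^ _.
have q0 : q != 0 by rewrite gt_eqF// powR_gt0// ltr0n.
have qE : q ^+ 2 * N%:R = N%:R ^+ (p.+1).*2.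
  rewrite expr2 -powRD ?N0' ?implybT// -{2}[N%:R](@powRr1 _ N%:R) ?ler0n//.
  rewrite -powRD ?N0' ?implybT// -powR_mulrn ?ler0n//; congr (_ `^ _).
  by rewrite -muln2 natrM; lra.
by rewrite -qE; field; rewrite q0.
Qed.

Lemma normr_coef_le bp N p : (0 < N)%N -> `|coef bp N p| <= `|bp p.+1|.
Proof.
move=> N0; rewrite /coef normrM ler_piMr// normfV invf_le1 ?normr_gt0; last first.
  by rewrite gt_eqF// powR_gt0// ltr0n.
rewrite ger0_norm ?powR_ge0// -[leLHS](powRr0 N%:R) ler_powR//.
  by rewrite ler1n.
by rewrite -natr1; have := ler0n R p; lra.
Qed.

(** The value at 1 of [xi] truncated at order [n]. *)
Definition xin (bp : nat -> R) n : R := \sum_(p < n) bp p.+1 ^+ 2.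

Lemma normr_acoupling bp n N (c : config N) (k : coupling n N) :
  `|acoupling bp c k| = `|coef bp N (tag k)|.
Proof. by rewrite /acoupling normrM normr_prod_spin mulr1. Qed.

Lemma sum_coef_sqr bp n N : (0 < N)%N ->
  \sum_(k : coupling n N) coef bp N (tag k) ^+ 2 = N%:R * xin bp n.
Proof.
move=> N0; rewrite sum_coupling /xin mulr_sumr; apply: eq_bigr => p _ /=.
rewrite sumr_const card_tuple card_ord -coef_sqr// -natrX.
by rewrite mulr_natr.
Qed.

(** Covariance of the energies of two configurations: the sum over tuples factorises, leaving a
    function of their overlap with even powers only. *)
Lemma sum_acoupling2 bp n N (c c' : config N) :
  \sum_(k : coupling n N) acoupling bp c k * acoupling bp c' k =
  \sum_(p < n) coef bp N p ^+ 2 * (\sum_i spin c i * spin c' i) ^+ (p.+1).*2.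
Proof.
rewrite sum_coupling; apply: eq_bigr => p _.
rewrite -sum_tuple_prod mulr_sumr; apply: eq_bigr => t _.
by rewrite /acoupling /= big_split/=; ring.
Qed.

End spins.

(** * Finite pieces of the disorder *)

Section disorder_families.
Context {d : measure_display} {T : measurableType d} {R : realType}.
Variable P : probability T R.
Implicit Types (hs : nat -> {RV P >-> R}) (g : disorder P).

Definition sdev (s : R) (j : joint_index) : R := if j is inl _ then s else 1.

Definition same_kind (j j' : joint_index) : bool :=
  match j, j' with inl _, inl _ | inr _, inr _ => true | _, _ => false end.

(** What the rest of the proof uses of the disorder. One constant [L] serves fields and couplings
    alike, while [disorder_same] compares laws only within one of the two kinds. *)
Record gaussian_disorder hs g (s L : R) : Prop := GaussianDisorder {
  disorder_indep : mutually_independent joint_domain (joint_family hs g);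
  disorder_gauss : forall j, joint_domain j ->
    gauss_law (distribution P (joint_family hs g j)) (sdev s j);
  disorder_L0 : 0 <= L;
  disorder_subexp : forall j, joint_domain j ->
    subexp (distribution P (joint_family hs g j)) L;
  disorder_same : forall j j', joint_domain j -> joint_domain j' ->
    same_kind j j' -> forall A : set R, measurable A ->
    P (joint_family hs g j @^-1` A) = P (joint_family hs g j' @^-1` A) }.

Variables (hs : nat -> {RV P >-> R}) (g : disorder P) (s L : R).
Local Notation X := (joint_family hs g).
Hypothesis HM : gaussian_disorder hs g s L.
Let iX := disorder_indep HM.
Let gX := disorder_gauss HM.
Let L0 := disorder_L0 HM.
Let sX := disorder_subexp HM.
Let lawX := disorder_same HM.
Let mX j : measurable_fun setT (X j : T -> R). Proof. exact: measurable_funPT. Qed.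

Lemma findep_emb (K : finType) (emb : K -> joint_index) : injective emb ->
  (forall k, joint_domain (emb k)) -> findep P (fun k => X (emb k) : T -> R).
Proof.
move=> iemb demb A mA.
pose A' j := if [pick k | emb k == j] is Some k then A k else setT.
have A'E k : A' (emb k) = A k.
  rewrite /A'; case: pickP => [k' /eqP /iemb ->//|/(_ k)].
  by rewrite eqxx.
have mA' j : measurable (A' j) by rewrite /A'; case: pickP.
have := @iX [seq emb k | k <- enum K] A' _ _ mA'.
rewrite map_inj_uniq ?enum_uniq// => /(_ isT) h.
have {}h := h (fun j => _).
rewrite big_map big_enum/= in h.
have -> : [set w | forall k, A k (X (emb k) w)] =
    \bigcap_(i in [set` [seq emb k | k <- enum K]]) (X i @^-1` A' i).
  apply/seteqP; split=> w /=.
    by move=> h' _ /= /mapP[k _ ->]; rewrite /preimage/= A'E.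
  move=> h' k; have := h' (emb k); rewrite /preimage/= A'E; apply.
  by apply: map_f; rewrite mem_enum.
rewrite h; last by move=> j /mapP[k _ ->]; exact: demb.
by apply: eq_bigr => k _; rewrite A'E.
Qed.

(** Shifting the sites by [o] extracts fresh copies of the couplings from the single infinite
    family, as comparison with independent subsystems requires. *)
Definition embC n N (o : nat) (k : coupling n N) : joint_index :=
  inr (existT (fun p => p.*2.-tuple nat) (tag k).+1
    (map_tuple (fun i : 'I_N => (o + i)%N) (tagged k))).

(** An invariant that tells copies with disjoint ranges of sites apart. *)
Definition first_site (j : joint_index) : nat :=
  match j with inl i => i | inr u => head 0%N (tagged u) end.

Lemma first_site_embC n N o (k : coupling n N) :
  (o <= first_site (embC o k) < o + N)%N.
Proof.
case: k => p t; rewrite /first_site /embC/=.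
have : size t = (p.+1).*2 by rewrite size_tuple.
by case: (tval t) => [|i l]; rewrite ?doubleS//= => _; rewrite leq_addr ltn_add2l ltn_ord.
Qed.

Lemma embC_inj n N o : injective (@embC n N o).
Proof.
move=> [p t] [p' t'] /= e.
pose f (j : joint_index) : nat * seq nat :=
  match j with inl _ => (0%N, [::]) | inr u => (tag u, tval (tagged u)) end.
have := congr1 f e; rewrite /f/= => -[pp' tt'].
have {}pp' : p = p' by exact/val_inj.
subst p'; congr existT; apply/val_inj => /=.
by apply: inj_map tt' => i i' /addnI /val_inj.
Qed.

(** Couplings and fields have separate offsets, because a subsystem receives fresh couplings but
    keeps its share of the fields of the large system. *)
Definition emb n N (o f : nat) (k : coupling n N + 'I_N) : joint_index :=
  match k with inl k => embC o k | inr i => inl (f + i)%N end.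

Lemma emb_inj n N o f : injective (@emb n N o f).
Proof.
move=> [k|i] [k'|i']//=.
- by move=> /embC_inj ->.
- by move=> [/addnI/val_inj ->].
Qed.

Lemma emb_domain n N o f k : joint_domain (@emb n N o f k).
Proof. by case: k. Qed.

Variable bp : nat -> R.

Definition config0 N : config N := [ffun=> false].

Section family.
Variables (K : finType) (em : K -> joint_index).
Hypothesis iem : injective em.
Hypothesis dem : forall k, joint_domain (em k).
Definition Xem k := X (em k).

Lemma gauss_Xem k : gauss_law (distribution P (Xem k)) (sdev s (em k)).
Proof. exact: gX. Qed.

Lemma mean_Xem k : rint P (Xem k) /\ Ex P (Xem k) = 0.
Proof.
have i1 : rint P (Xem k).
  have h := rint_gauss_abs gauss_Xem k.
  by apply: (@rint_le _ _ _ _ _ (fun w => `|Xem k w|)); rewrite ?/Xem.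
split=> //.
have := gauss_mean0 (gauss_Xem k).
by rewrite /Ex /Rintegral integral_distribution.
Qed.

End family.

Lemma lnZ_law (K : finType) (em em' : K -> joint_index) (C : finType) (c0 : C)
    (e : C -> R) (a : C -> K -> R) :
  injective em -> (forall k, joint_domain (em k)) ->
  injective em' -> (forall k, joint_domain (em' k)) ->
  (forall k, same_kind (em k) (em' k)) ->
  Ex P (fun w => lnZ (linE e a (fun k => X (em k) w))) =
  Ex P (fun w => lnZ (linE e a (fun k => X (em' k) w))).
Proof.
move=> iem dem iem' dem' kem.
apply: (law_ExK (Phi := fun x => lnZ (linE e a x))).
- by move=> k.
- by move=> k.
- exact: findep_emb.
- exact: findep_emb.
- by move=> k A mA; exact: lawX.
- apply: (@measurable_lnZ _ _ _ _ (fun t => linE e a (kval t))) => c.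
  apply: measurable_funD => //; apply: measurable_sumR => k.
  by apply: measurable_funM => //; exact: measurable_kval.
- exact: (rint_lnZ_linE (gauss_Xem dem) c0).
- exact: (rint_lnZ_linE (gauss_Xem dem') c0).
Qed.

Definition amodel n N (c : config N) (k : coupling n N + 'I_N) : R :=
  match k with inl k => acoupling bp c k | inr i => spin c i end.

(** Energy truncated at order [n]. The deterministic part [e] is left free: it will be a constant
    external field or the quadratic mean-field term. *)
Definition Em n N o f (e : config N -> R) (w : T) : config N -> R :=
  linE e (@amodel n N) (fun k => X (emb o f k) w).

Lemma lnZ_Em_law n N o f o' f' e :
  Ex P (fun w => lnZ (@Em n N o f e w)) = Ex P (fun w => lnZ (@Em n N o' f' e w)).
Proof.
apply: lnZ_law; try exact: emb_inj; try exact: emb_domain; first exact: config0.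
by case.
Qed.

End disorder_families.

Lemma le_of_derive {R : realType} (f df : R -> R) (a b : R) : a <= b ->
  (forall t : R, is_derive t 1 f (df t)) -> (forall t, a < t < b -> 0 <= df t) ->
  f a <= f b.
Proof.
move=> ab fd df0.
have cf : continuous f.
  by move=> t; apply/differentiable_continuous/derivable1_diffP; exact: ex_derive.
apply: (@ger0_derive1_le_cc R f a b) => //; rewrite ?in_itv/= ?lexx ?ab//.
- move=> t; rewrite in_itv/= => tab; rewrite derive1E derive_val; exact: df0.
- exact: continuous_subspaceT.
Qed.

Lemma rint_comp_law d (T : measurableType d) (R : realType) (P : probability T R)
    (X : {RV P >-> R}) (f : R -> R) : measurable_fun setT f ->
  rint P (fun w => f (X w)) -> rint (distribution P X) f.
Proof.
move=> mf /integrableP[_ foo]; apply/integrableP; split; first exact/measurable_EFinP.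
rewrite ge0_integral_distribution//; apply/measurableT_comp => //.
exact/measurable_EFinP.
Qed.

Lemma Ex_comp_law d (T : measurableType d) (R : realType) (P : probability T R)
    (X : {RV P >-> R}) (f : R -> R) : measurable_fun setT f ->
  rint P (fun w => f (X w)) -> Ex P (fun w => f (X w)) = Ex (distribution P X) f.
Proof.
by move=> mf iX; rewrite /Ex /Rintegral integral_distribution//; exact/measurable_EFinP.
Qed.

Lemma Ex_same_law d (T : measurableType d) (R : realType) (P : probability T R)
    (X Y : {RV P >-> R}) (f : R -> R) :
  (forall A : set R, measurable A -> P (X @^-1` A) = P (Y @^-1` A)) ->
  measurable_fun setT f -> rint P (fun w => f (X w)) ->
  rint P (fun w => f (Y w)) /\ Ex P (fun w => f (X w)) = Ex P (fun w => f (Y w)).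
Proof.
move=> XY mf iX.
have iY : rint P (fun w => f (Y w)).
  apply: rint_distribution; apply: (rint_law_eq (nu := distribution P X)) => //.
  exact: rint_comp_law.
split=> //; rewrite !Ex_comp_law//; exact: Ex_law_eq.
Qed.

Section cosh_lemmas.
Context {R : realType}.
Implicit Type x : R.

Lemma cosh_gt0 x : 0 < cosh x.
Proof. by rewrite /cosh divr_gt0// addr_gt0// expR_gt0. Qed.

Lemma lncosh_ge0 x : 0 <= ln (cosh x).
Proof.
rewrite ln_ge0// /cosh ler_pdivlMr// mul1r.
by have := expR_ge1Dx x; have := expR_ge1Dx (- x); lra.
Qed.

Lemma lncosh_le x : ln (cosh x) <= `|x|.
Proof.
rewrite -[leRHS]expRK ler_ln ?posrE ?cosh_gt0 ?expR_gt0// /cosh ler_pdivrMr//.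
rewrite mulr_natr mulr2n lerD// ler_expR ?ler_norm//.
by rewrite -normrN ler_norm.
Qed.

Lemma measurable_lncosh : measurable_fun setT (fun x => ln (cosh x)).
Proof.
apply: (@measurableT_comp _ _ _ _ _ _ (@ln R)); first exact: measurable_ln.
apply: measurable_funM => //; apply: measurable_funD => //.
by apply: measurableT_comp => //; exact: measurable_funN.
Qed.

End cosh_lemmas.

Section covariance_sums.
Context {R : realType} {C : finType} (c0 : C).
Implicit Type E : C -> R.

(** The square of a Gibbs average is an average over two independent replicas. *)
Lemma sum_sqr_av (K : finType) E (a : C -> K -> R) :
  \sum_k av E (a^~ k) ^+ 2 =
  av E (fun c => av E (fun c' => \sum_k a c k * a c' k)).
Proof.
under [RHS]eq_av => c do rewrite av_sum.
rewrite av_sum; apply: eq_bigr => k _.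
under [RHS]eq_av => c do rewrite avZ mulrC.
by rewrite avZ expr2.
Qed.

(** All configurations have the same self-overlap [v], so the derivative of an interpolation depends
    on the Gibbs measure only through the overlap of two replicas. *)
Lemma sum_cov (K : finType) E (a : C -> K -> R) (v : R) :
  (forall c, \sum_k a c k ^+ 2 = v) ->
  \sum_k cov E (a^~ k) (a^~ k) =
  v - av E (fun c => av E (fun c' => \sum_k a c k * a c' k)).
Proof.
move=> av2; rewrite -sum_sqr_av /cov sumrB; congr (_ - _).
rewrite -av_sum -[RHS](av_cst c0 E); apply: eq_av => c; rewrite -(av2 c).
by apply: eq_bigr => k _; rewrite expr2.
Qed.

Lemma cov_ge0 E (f : C -> R) : 0 <= cov E f f.
Proof.
have -> : cov E f f = av E (fun c => (f c - av E f) ^+ 2).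
  rewrite /cov; set m := av E f.
  have -> : (fun c => (f c - m) ^+ 2) =
      (fun c => (f c * f c + (- (2 * m)) * f c) + m ^+ 2).
    by apply/funext => c; ring.
  by rewrite !avD avZ av_cst// -/m; ring.
by apply: av_ge0 => c; exact: sqr_ge0.
Qed.

End covariance_sums.

Section interpolation_bounds.
Context {d : measure_display} {T : measurableType d} {R : realType}.
Variable P : probability T R.
Context {K C : finType} (X : K -> {RV P >-> R}) (s : K -> R) (c0 : C).
Hypothesis iX : findep P (fun k => X k : T -> R).
Hypothesis gX : forall k, gauss_law (distribution P (X k)) (s k).

Definition interp (e : C -> R) a u (t : R) : R :=
  Ex P (fun w => lnZ (linE e (path a u t) (X^~ w))).

(** The hypothesis is required for every energy [E], hence pointwise in the disorder, and survives
    the expectation. Lower bounds take [eps = 1], upper bounds [eps = - 1]. *)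
Lemma interpolation_mono (e : C -> R) (a : C -> K -> R) (u du : K -> R -> R)
    (f df : R -> R) (eps t0 t1 : R) :
  (forall k (t : R), is_derive t 1 (u k) (du k t)) ->
  (forall k t, `|du k t| <= 1) ->
  (forall t : R, is_derive t 1 f (df t)) -> t0 <= t1 ->
  (forall t E, t0 < t < t1 -> df t <=
     eps * \sum_k u k t * du k t * s k ^+ 2 * cov E (a^~ k) (a^~ k)) ->
  f t1 - f t0 <= eps * (interp e a u t1 - interp e a u t0).
Proof.
move=> du1 du_le1 dff t01 dfE; set F := interp e a u.
have dF (t : R) := is_derive_interpolation iX gX c0 e a du1 du_le1 t.
rewrite -subr_ge0.
have rE (x y z t : R) : eps * (x - y) - (z - t) = (eps * x - z) - (eps * y - t).
  by ring.
rewrite rE {rE}.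
rewrite subr_ge0.
apply: (@le_of_derive _ (fun t => eps * F t - f t)) => //.
move=> t ht /=; set D := \sum_k _; rewrite /GRing.scale/= subr_ge0.
pose Et w := linE e (path a u t) (X^~ w).
have icov k : rint P (fun w => cov (Et w) (a^~ k) (a^~ k)).
  have [M aM] : exists M : R, forall c, `|a c k| <= M.
    exists (\sum_c `|a c k|) => c.
    by rewrite (bigD1 c)//= lerDl sumr_ge0.
  apply: (@rint_bnd _ _ _ _ _ (M * M *+ 2)); last by move=> w; exact: cov_bnd.
  apply: measurable_funB; first exact: measurable_av_linE.
  by apply: measurable_funM; exact: measurable_av_linE.
have -> : D = Ex P (fun w => \sum_k u k t * du k t * s k ^+ 2 *
    cov (Et w) (a^~ k) (a^~ k)).
  rewrite Ex_sum; last by move=> k _; exact: rintZ.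
  by apply: eq_bigr => k _; rewrite ExZ.
rewrite -ExZ; last by apply: rint_sum => k _; exact: rintZ.
rewrite -[leLHS](Ex_cst P); apply: Ex_le; first exact: rint_cst.
  by apply: rintZ; apply: rint_sum => k _; exact: rintZ.
by move=> w; exact: dfE.
Qed.

End interpolation_bounds.

(** * Superadditivity and two-sided bounds for the truncated free energy *)

Section truncated_model.
Context {d : measure_display} {T : measurableType d} {R : realType}.
Variable P : probability T R.
Variables (hs : nat -> {RV P >-> R}) (g : disorder P) (s L : R).
Local Notation X := (joint_family hs g).
Hypothesis HM : gaussian_disorder hs g s L.
Variable bp : nat -> R.

Definition ext_field N (x : R) (c : config N) : R := x * \sum_(i < N) spin c i.

Definition EL n N x : R := Ex P (fun w => lnZ (Em hs g bp n 0 0 (@ext_field N x) w)).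

Definition logcosh_mean (x : R) : R := ln 2 + Ex P (fun w => ln (cosh (x + hs 0%N w))).

Section superadditivity.
Variables (n N1 N2 : nat).
Hypotheses (N10 : (0 < N1)%N) (N20 : (0 < N2)%N).
Local Notation N := (N1 + N2)%N.
Let K : finType := ((coupling n N + (coupling n N1 + coupling n N2)) + 'I_N)%type.

Definition lconf (c : config N) : config N1 := [ffun i => c (lshift N2 i)].
Definition rconf (c : config N) : config N2 := [ffun i => c (rshift N1 i)].

(** The couplings of the large system use sites below [N], those of the subsystems the ranges
    starting at [N] and at [N + N1], so the three families are independent. The fields are common to
    all. *)
Let em (k : K) : joint_index :=
  match k with
  | inl (inl k) => embC 0 k
  | inl (inr (inl k)) => embC N k
  | inl (inr (inr k)) => embC (N + N1) k
  | inr i => inl (i : nat)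
  end.

Let em_inj : injective em.
Proof.
move=> [[k|[k|k]]|i] [[k'|[k'|k']]|i'] e; rewrite /em in e => //.
all: try by move/embC_inj: e => ->.
all: try by (case: e => /val_inj ->).
all: have := congr1 first_site e; have := first_site_embC 0 k.
all: have := first_site_embC N k; have := first_site_embC (N + N1) k.
all: have := first_site_embC 0 k'; have := first_site_embC N k'.
all: by have := first_site_embC (N + N1) k'; move=> *; exfalso; lia.
Qed.

Let em_dom k : joint_domain (em k).
Proof. by case: k => [[k|[k|k]]|i]. Qed.

Let a (c : config N) (k : K) : R :=
  match k with
  | inl (inl k) => acoupling bp c k
  | inl (inr (inl k)) => acoupling bp (lconf c) k
  | inl (inr (inr k)) => acoupling bp (rconf c) k
  | inr i => spin c i
  end.

Let u (k : K) (t : R) : R :=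
  match k with inl (inl _) => sin t | inl (inr _) => cos t | inr _ => 1 end.

Let du (k : K) (t : R) : R :=
  match k with inl (inl _) => cos t | inl (inr _) => - sin t | inr _ => 0 end.

Let du1 k (t : R) : is_derive t 1 (u k) (du k t).
Proof.
case: k => [[k|k]|i] /=.
- exact: is_derive_sin.
- exact: is_derive_cos.
- exact: is_derive_cst.
Qed.

Let du_le1 k (t : R) : `|du k t| <= 1.
Proof.
case: k => [[k|k]|i] /=.
- by rewrite ler_norml cos_geN1 cos_le1.
- by rewrite normrN ler_norml sin_geN1 sin_le1.
- by rewrite normr0.
Qed.

(** With the normalisation, each order compares [N ((x + y) / N)^(2p)] with
    [N1 (x / N1)^(2p) + N2 (y / N2)^(2p)]: convexity with weights [N1 / N] and [N2 / N]. *)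
Lemma coupling_convexity (c c' : config N) :
  \sum_(k : coupling n N) acoupling bp c k * acoupling bp c' k <=
  \sum_(k : coupling n N1) acoupling bp (lconf c) k * acoupling bp (lconf c') k +
  \sum_(k : coupling n N2) acoupling bp (rconf c) k * acoupling bp (rconf c') k.
Proof.
rewrite !sum_acoupling2 -big_split/=; apply: ler_sum => p _.
have -> : \sum_i spin c i * spin c' i =
    \sum_i spin (lconf c) i * spin (lconf c') i +
    \sum_i spin (rconf c) i * spin (rconf c') i :> R.
  by rewrite big_split_ord/=; congr (_ + _); apply: eq_bigr => i _;
    rewrite /spin !ffunE.
set x := \sum_i _; set y := \sum_i _.
have M0 M : (0 < M)%N -> (M%:R : R) != 0 by rewrite pnatr_eq0 -lt0n.
have coefE M z : (0 < M)%N -> coef bp M p ^+ 2 * z ^+ (p.+1).*2 =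
    bp p.+1 ^+ 2 * (M%:R * (z / M%:R) ^+ (p.+1).*2).
  move=> M1; have MX := expf_neq0 (p.+1).*2 (M0 _ M1).
  rewrite [(z / _) ^+ _]exprMn exprVn -[coef bp M p ^+ 2](mulfK MX) coef_sqr//.
  by move: (_^-1) => v; ring.
rewrite !coefE ?addn_gt0 ?N10// -mulrDr ler_wpM2l ?sqr_ge0//.
have N0 : (0 < N)%N by rewrite addn_gt0 N10.
have := @even_powX_convex R (N1%:R / N%:R) (N2%:R / N%:R) (x / N1%:R) (y / N2%:R) p.+1.
have -> : N1%:R / N%:R * (x / N1%:R) + N2%:R / N%:R * (y / N2%:R) = (x + y) / N%:R.
  move: (M0 _ N0) (M0 _ N10) (M0 _ N20).
  by move: N%:R N1%:R N2%:R => q q1 q2 q0 q10 q20; field; rewrite q0 q10 q20.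
have -> : N1%:R / N%:R + N2%:R / N%:R = 1 :> R.
  by rewrite -mulrDl -natrD divff// M0.
move=> /(_ _ _ erefl) h.
have /(ler_wpM2l (ler0n R N)) := h (divr_ge0 (ler0n _ _) (ler0n _ _))
  (divr_ge0 (ler0n _ _) (ler0n _ _)).
move/le_trans; apply; move: (_ ^+ _) (_ ^+ _) => v v'.
by rewrite mulrDr [N%:R * (_ * v)]mulrCA [N%:R * (_ * v')]mulrCA !(mulrA (_ / _)) !divfK ?M0.
Qed.

Lemma acoupling_sqr M (c : config M) : (0 < M)%N ->
  \sum_(k : coupling n M) acoupling bp c k ^+ 2 = M%:R * xin bp n.
Proof.
move=> M0; rewrite -sum_coef_sqr//; apply: eq_bigr => k _.
by rewrite -real_normK ?num_real// normr_acoupling real_normK ?num_real.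
Qed.

Lemma lnZ_split (E1 : config N1 -> R) (E2 : config N2 -> R) :
  lnZ (fun c : config N => E1 (lconf c) + E2 (rconf c)) = lnZ E1 + lnZ E2.
Proof.
have Z1 : Zf E1 \is Num.pos by rewrite posrE; exact: Zf_gt0 (config0 N1) _.
have Z2 : Zf E2 \is Num.pos by rewrite posrE; exact: Zf_gt0 (config0 N2) _.
rewrite /lnZ -(lnM Z1 Z2); congr ln.
rewrite /Zf big_distrlr/= pair_bigA/=.
pose glue (p : config N1 * config N2) : config N :=
  [ffun i => match fintype.split i with inl j => p.1 j | inr j => p.2 j end].
have lK p : lconf (glue p) = p.1.
  by apply/ffunP => i; rewrite !ffunE (unsplitK (inl i)).
have rK p : rconf (glue p) = p.2.
  by apply/ffunP => i; rewrite !ffunE (unsplitK (inr i)).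
rewrite (reindex glue)/=.
  by apply: eq_bigr => p _; rewrite lK rK expRD.
exists (fun c => (lconf c, rconf c)) => [p _|c _].
  by rewrite lK rK -surjective_pairing.
apply/ffunP => i; rewrite ffunE; case: splitP => j ij; rewrite ffunE;
  by congr (c _); apply: val_inj.
Qed.

(* At [t = pi / 2] the interpolation [sin t, cos t] is the system of size
   [N1 + N2], at [t = 0] it is two independent systems of sizes [N1] and [N2]. *)
Lemma EL_superadditive x : EL n N1 x + EL n N2 x <= EL n N x.
Proof.
have N0 : (0 < N)%N by rewrite addn_gt0 N10.
have pi20 : 0 <= (pi : R) / 2 by rewrite divr_ge0 ?pi_ge0.
have h := @interpolation_mono _ _ _ P K (config N) (fun k => X (em k))
  (fun k => sdev s (em k)) (config0 N) (findep_emb HM em_inj em_dom)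
  (fun k => disorder_gauss HM (em_dom k)) (@ext_field N x) a u du (cst 0) (cst 0) 1
  0 (pi / 2) du1 du_le1 (fun t => is_derive_cst _ _ _) pi20.
move: h; rewrite mul1r subr0 subr_ge0 => h.
pose e1 := @ext_field N1 x; pose e2 := @ext_field N2 x.
have i1 o f : rint P (fun w => lnZ (Em hs g bp n o f e1 w)).
  exact: (rint_lnZ_linE (gauss_Xem HM (@emb_domain n N1 o f)) (config0 N1)).
have i2 o f : rint P (fun w => lnZ (Em hs g bp n o f e2 w)).
  exact: (rint_lnZ_linE (gauss_Xem HM (@emb_domain n N2 o f)) (config0 N2)).
(* By equality in law the subsystems are realised with their own couplings and with the fields of
   the first [N1] and the last [N2] sites. *)
rewrite {1}/EL (lnZ_Em_law HM _ _ 0 0 N 0) [EL n N2 x](lnZ_Em_law HM _ _ 0 0 (N + N1) N1).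
rewrite -ExD//.
suff [eq1 ->] : interp (fun k => X (em k)) (@ext_field N x) a u 0 =
    Ex P (fun w => lnZ (Em hs g bp n N 0 e1 w) + lnZ (Em hs g bp n (N + N1) N1 e2 w)) /\
    EL n N x = interp (fun k => X (em k)) (@ext_field N x) a u (pi / 2).
  rewrite -eq1; apply: h => t E /andP[t0 t2]; rewrite mul1r !big_sumType/=.
  have D0 : 0 <= sin t * cos t.
    rewrite mulr_ge0// ltW//; first by rewrite sin_gt0_pi// t0/= (lt_trans t2)//; have := pi_gt0 R; lra.
    rewrite cos_gt0_pihalf// (lt_trans _ t0) ?oppr_lt0//=.
    by rewrite divr_gt0 ?pi_gt0.
  have -> : \sum_(i < N) 1 * 0 * s ^+ 2 * cov E (fun c => spin c i) (fun c => spin c i) = 0.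
    by apply: big1 => i _; rewrite mulr0 !mul0r.
  pose SA := \sum_(k : coupling n N) cov E (fun c => acoupling bp c k) (fun c => acoupling bp c k).
  pose SB := \sum_(k : coupling n N1) cov E (fun c => acoupling bp (lconf c) k) (fun c => acoupling bp (lconf c) k).
  pose SC := \sum_(k : coupling n N2) cov E (fun c => acoupling bp (rconf c) k) (fun c => acoupling bp (rconf c) k).
  suff : SB + SC <= SA.
    move=> /(ler_wpM2l D0); rewrite -subr_ge0 /SA /SB /SC !mulrDr !mulr_sumr => H.
    apply: (le_trans H); rewrite le_eqVlt; apply/orP; left; apply/eqP.
    rewrite addr0 opprD -!sumrN; congr (_ + (_ + _));
      by apply: eq_bigr => k _; rewrite expr1n; ring.
  rewrite /SA /SB /SC.
  rewrite (sum_cov (config0 N) E (fun c => acoupling_sqr c N0)).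
  rewrite (sum_cov (config0 N) E (fun c => acoupling_sqr (lconf c) N10)).
  rewrite (sum_cov (config0 N) E (fun c => acoupling_sqr (rconf c) N20)).
  (* The self-overlap terms cancel because [N = N1 + N2]; the overlap of two replicas remains, where
     convexity decides the sign. *)
  rewrite addrACA -opprD natrD mulrDl lerD2l lerN2 -avD.
  apply: (av_le (config0 N)) => c; rewrite -avD; apply: (av_le (config0 N)) => c'.
  exact: coupling_convexity.
split; apply: eq_Ex => w.
  rewrite -lnZ_split; congr lnZ; apply/funext => c.
  rewrite /linE /path !big_sumType/= sin0 cos0.
  rewrite [X in _ + (X + _ + _)]big1 ?add0r; last by move=> k _; rewrite !mul0r.
  rewrite /Em /linE !big_sumType/=.
  have -> : ext_field x c = e1 (lconf c) + e2 (rconf c).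
    rewrite /ext_field /e1 /e2 /ext_field -mulrDr big_split_ord/=.
    by congr (_ * (_ + _)); apply: eq_bigr => i _; rewrite /spin ffunE.
  have -> : \sum_(i < N) 1 * spin c i * hs i w =
      \sum_(i < N1) spin (lconf c) i * hs (0 + i)%N w +
      \sum_(i < N2) spin (rconf c) i * hs (N1 + i)%N w.
    by rewrite big_split_ord/=; congr (_ + _); apply: eq_bigr => i _;
      rewrite mul1r /spin ffunE.
  rewrite [X in _ + X = _]addrACA [LHS]addrACA.
  by congr (_ + (_ + _) + (_ + (_ + _))); apply: eq_bigr => k _; rewrite mul1r.
congr lnZ; apply/funext => c.
rewrite /Em /linE /path !big_sumType/= sin_pihalf cos_pihalf.
congr (_ + (_ + _)); last by apply: eq_bigr => i _; rewrite mul1r.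
rewrite [X in _ = _ + (X + _)]big1 => [|k _]; last by rewrite !mul0r.
rewrite [X in _ = _ + (_ + X)]big1 => [|k _]; last by rewrite !mul0r.
by rewrite !addr0; apply: eq_bigr => k _; rewrite mul1r.
Qed.

End superadditivity.

Lemma lnZ_field N (y : 'I_N -> R) :
  lnZ (fun c : config N => \sum_i y i * spin c i) = \sum_i (ln 2 + ln (cosh (y i))).
Proof.
have prodE : Zf (fun c : config N => \sum_i y i * spin c i) =
    \prod_i (2 * cosh (y i)).
  have twoE i : 2 * cosh (y i) = \sum_(b : bool) expR (y i * (-1) ^+ b).
    by rewrite big_bool/= expr0 expr1 mulr1 mulrN1 addrC /cosh mulrC divfK.
  under eq_bigr do rewrite twoE.
  rewrite bigA_distr_bigA/=; apply: eq_bigr => c _.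
  by rewrite expR_sum.
rewrite /lnZ prodE {prodE}.
suff [] : 0 < \prod_i (2 * cosh (y i)) /\
  ln (\prod_i (2 * cosh (y i))) = \sum_i (ln 2 + ln (cosh (y i))) by [].
elim/big_rec2: _ => [|i z p _ [p0 pE]]; first by rewrite ln1.
have c2 : 0 < 2 * cosh (y i) by rewrite mulr_gt0 ?cosh_gt0.
split; first exact: mulr_gt0.
by rewrite lnM ?posrE// pE lnM ?posrE ?cosh_gt0.
Qed.

Lemma rint_lncosh x i : rint P (fun w => ln (cosh (x + hs i w))).
Proof.
have h : rint P (fun w => `|hs i w|).
  exact: (rint_gauss_abs (gauss_Xem HM (em := fun _ : unit => inl i) (fun=> I)) tt).
apply: (@rint_le _ _ _ _ _ (fun w => `|x| + `|hs i w|)).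
- by apply: (measurableT_comp measurable_lncosh); exact: measurable_funD.
- by apply: rintD => //; exact: rint_cst.
- move=> w; rewrite ger0_norm ?lncosh_ge0// (le_trans (lncosh_le _))//.
  exact: ler_normD.
Qed.

(** Only the couplings are interpolated, with weight [sin t], from the decoupled system at 0 to the
    full one at [pi / 2]. The derivative is [sin t * cos t] times a total covariance lying between 0
    and [N * xin bp n]. *)
Lemma EL_bounds n N x : (0 < N)%N ->
  N%:R * logcosh_mean x <= EL n N x <= N%:R * (logcosh_mean x + xin bp n / 2).
Proof.
move=> N0.
pose K : finType := (coupling n N + 'I_N)%type.
pose u (k : K) (t : R) : R := if k is inl _ then sin t else 1.
pose du (k : K) (t : R) : R := if k is inl _ then cos t else 0.
have du1 k (t : R) : is_derive t 1 (u k) (du k t).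
  by case: k => [k|i]; [exact: is_derive_sin|exact: is_derive_cst].
have du_le1 k (t : R) : `|du k t| <= 1.
  by case: k => [k|i]; rewrite /du ?normr0// ler_norml cos_geN1 cos_le1.
have pi20 : 0 <= (pi : R) / 2 by rewrite divr_ge0 ?pi_ge0.
have h := @interpolation_mono _ _ _ P K (config N) (fun k => X (emb 0 0 k))
  (fun k => sdev s (emb 0 0 k)) (config0 N)
  (findep_emb HM (@emb_inj n N 0 0) (@emb_domain n N 0 0))
  (fun k => disorder_gauss HM (emb_domain 0 0 k)) (@ext_field N x)
  (@amodel _ bp n N) u du.
have sumE t E : \sum_k u k t * du k t * sdev s (emb 0 0 k) ^+ 2 *
    cov E (@amodel _ bp n N ^~ k) (@amodel _ bp n N ^~ k) =
    sin t * cos t * \sum_(k : coupling n N)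
      cov E (fun c => acoupling bp c k) (fun c => acoupling bp c k).
  rewrite big_sumType/= [X in _ + X]big1; last by move=> i _; rewrite mulr0 !mul0r.
  by rewrite addr0 mulr_sumr; apply: eq_bigr => k _; rewrite expr1n mulr1.
have D0 (t : R) : 0 < t < pi / 2 -> 0 <= sin t * cos t.
  move=> /andP[t0 t2].
  rewrite mulr_ge0// ltW//; first by rewrite sin_gt0_pi// t0/= (lt_trans t2)//; have := pi_gt0 R; lra.
  rewrite cos_gt0_pihalf// (lt_trans _ t0) ?oppr_lt0//=.
  by rewrite divr_gt0 ?pi_gt0.
have endE : interp (fun k => X (emb 0 0 k)) (@ext_field N x) (@amodel _ bp n N) u (pi / 2) = EL n N x.
  apply: eq_Ex => w; congr lnZ; apply/funext => c.
  rewrite /Em /linE /path; congr (_ + _); apply: eq_bigr => -[k|i] _ /=.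
    by rewrite sin_pihalf mul1r.
  by rewrite mul1r.
have startE : interp (fun k => X (emb 0 0 k)) (@ext_field N x) (@amodel _ bp n N) u 0 = N%:R * logcosh_mean x.
  transitivity (Ex P (fun w => \sum_(i < N) (ln 2 + ln (cosh (x + hs i w))))).
    apply: eq_Ex => w; rewrite -lnZ_field; congr lnZ; apply/funext => c.
    rewrite /linE /path big_sumType/= sin0 big1 ?add0r; last by move=> k _; rewrite !mul0r.
    rewrite /ext_field mulr_sumr -big_split/=; apply: eq_bigr => i _.
    by rewrite mul1r mulrDl [hs i w * _]mulrC.
  have i0 i : rint P (fun w => ln 2 + ln (cosh (x + hs i w))).
    by apply: rintD; [exact: rint_cst|exact: rint_lncosh].
  rewrite Ex_sum; last by move=> i _; exact: i0.
  transitivity (\sum_(i < N) logcosh_mean x); last first.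
    by rewrite sumr_const card_ord mulr_natl.
  apply: eq_bigr => i _; rewrite ExD ?Ex_cst; [|exact: rint_cst|exact: rint_lncosh].
  have lawE (A : set R) : measurable A -> P (hs i @^-1` A) = P (hs 0%N @^-1` A).
    exact: (disorder_same HM (j := inl (i : nat)) (j' := inl 0%N)).
  have mf : measurable_fun setT (fun y : R => ln (cosh (x + y))).
    by apply: (measurableT_comp measurable_lncosh); exact: measurable_funD.
  have [_] := Ex_same_law lawE mf (rint_lncosh x i).
  by rewrite /logcosh_mean => ->.
apply/andP; split.
  have := h (cst 0) (cst 0) 1 0 (pi / 2) du1 du_le1 (fun t => is_derive_cst _ _ _) pi20.
  rewrite mul1r endE startE subr0 subr_ge0; apply => t E ht; rewrite mul1r sumE.
  apply: mulr_ge0; first exact: D0.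
  by apply: sumr_ge0 => k _; exact: (cov_ge0 (config0 N)).
pose M := N%:R * xin bp n.
(* The primitive of [sin t * cos t] is [sin t ^+ 2 / 2], which is the origin of the factor 1/2 in
   front of [xin]. *)
have df (t : R) : is_derive t 1 (fun t : R => - (M / 2) * sin t ^+ 2) (- (M * (sin t * cos t))).
  by apply: is_derive_eq; rewrite /GRing.scale/=; move: M (sin t) (cos t) => m x1 x2; field.
have := h _ _ (- 1) 0 (pi / 2) du1 du_le1 df pi20.
rewrite endE startE sin0 sin_pihalf mulN1r => H.
suff : - (M / 2) * 1 ^+ 2 - - (M / 2) * 0 ^+ 2 <= - (EL n N x - N%:R * logcosh_mean x).
  rewrite /M expr1n expr0n/= mulr0 oppr0 addr0 mulr1 {H h}.
  move: (EL n N x) (logcosh_mean x) (xin bp n) (N%:R : R) => p q r m H.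
  by rewrite mulrDr mulrA -lerBlDl -lerN2.
apply: H => t E ht; rewrite mulN1r sumE lerN2 [M * _]mulrC ler_wpM2l ?D0//.
rewrite (sum_cov (config0 N) E (fun c => acoupling_sqr _ _ N0)).
rewrite lerBlDr lerDl -sum_sqr_av; apply: sumr_ge0 => k _; exact: sqr_ge0.
Qed.

End truncated_model.

(** * Removing the truncation *)

Lemma cvg_sum_from1 {R : realType} (u : nat -> R) (l : R) :
  series (fun p => u p.+1) n @[n --> \oo] --> l ->
  \sum_(1 <= p < n) u p @[n --> \oo] --> l.
Proof.
move=> h; have := cvg_shiftS (fun n => \sum_(1 <= p < n) u p) (nbhs l).
rewrite (_ : (fun n : nat => _) = series (fun p => u p.+1)); first by move=> <-.
by apply/funext => n; rewrite /series/= big_add1.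
Qed.

Lemma cvgn_sum_from1 {R : realType} (u : nat -> R) :
  cvgn (fun n => \sum_(1 <= p < n) u p) <-> cvgn (series (fun p => u p.+1)).
Proof.
split=> /cvg_ex[/= l h]; apply/cvg_ex; exists l => /=; last exact: cvg_sum_from1.
have := cvg_shiftS (fun n => \sum_(1 <= p < n) u p) (nbhs l).
rewrite (_ : (fun n : nat => _) = series (fun p => u p.+1)); first by move=> ->.
by apply/funext => n; rewrite /series/= big_add1.
Qed.

Section summability.
Context {R : realType}.
Variable bp : nat -> R.
Hypothesis bpB : cvgn (fun n => \sum_(1 <= p < n) 2 ^+ p * bp p ^+ 2).

(** The inequality [|b| <= q b^2 + 2 / q] with [q = 2^(p+1)] passes from weighted squares to
    absolute values. The added geometric term keeps the summands positive, as [Ex_abs_linear]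
    needs. *)
Lemma cvgn_normr_coefs : cvgn (series (fun p => `|bp p.+1| + 2^-1 ^+ p)).
Proof.
have c1 : cvgn (series (fun p => 2 ^+ p.+1 * bp p.+1 ^+ 2)).
  exact/(cvgn_sum_from1 (fun p => 2 ^+ p * bp p ^+ 2)).
have c2 : cvgn (series (fun p => 2^-1 ^+ p : R)).
  have h : `|2^-1 : R| < 1 by rewrite ger0_norm// invf_lt1// ltr1n.
  have := @is_cvg_geometric_series R 1 _ h.
  by rewrite /geometric/=; under eq_fun do rewrite mul1r.
have c3 : cvgn (series (fun p => 2 ^+ p.+1 * bp p.+1 ^+ 2 + 2 * 2^-1 ^+ p)).
  have -> : series (fun p => 2 ^+ p.+1 * bp p.+1 ^+ 2 + 2 * 2^-1 ^+ p) =
      series (fun p => 2 ^+ p.+1 * bp p.+1 ^+ 2) \+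
      (fun n => 2 * series (fun p => 2^-1 ^+ p) n).
    by apply/funext => n; rewrite /series/= big_split/= mulr_sumr.
  by apply: is_cvgD => //; apply: is_cvgMr.
apply: (series_le_cvg _ _ _ c3).
- by move=> p; rewrite addr_ge0// exprn_ge0.
- move=> p; apply: addr_ge0; apply: mulr_ge0; rewrite ?sqr_ge0 ?exprn_ge0//.
move=> p; rewrite [2 * _]mulr_natl mulr2n addrA lerD2r.
have q0 : 0 < 2 ^+ p.+1 :> R by rewrite exprn_gt0.
have -> : 2^-1 ^+ p = 2 * (2 ^+ p.+1)^-1 :> R.
  by rewrite exprVn exprS invfM mulrA divff// mul1r.
rewrite -[bp p.+1 ^+ 2]real_normK ?num_real//; move: (2 ^+ p.+1) `|_| (normr_ge0 (bp p.+1)) q0 => q b b0 q0.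
rewrite -subr_ge0.
have -> : q * b ^+ 2 + 2 * q^-1 - b = q * ((b - q^-1 / 2) ^+ 2 + 7 / 4 * q^-1 ^+ 2).
  by field; rewrite gt_eqF.
apply: mulr_ge0; first exact: ltW.
by rewrite addr_ge0 ?sqr_ge0// mulr_ge0 ?sqr_ge0.
Qed.

Lemma xin_le_xi n : xin bp n <= xi bp 1.
Proof.
have c1 : cvgn (series (fun p => bp p.+1 ^+ 2)).
  have h : cvgn (series (fun p => 2 ^+ p.+1 * bp p.+1 ^+ 2)).
    exact/(cvgn_sum_from1 (fun p => 2 ^+ p * bp p ^+ 2)).
  apply: (series_le_cvg _ _ _ h) => [p|p|p]; rewrite ?sqr_ge0//.
    by rewrite mulr_ge0 ?sqr_ge0// exprn_ge0.
  by rewrite ler_peMl ?sqr_ge0// exprn_ege1// ler1n.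
have -> : xin bp n = series (fun p => bp p.+1 ^+ 2) n.
  by rewrite /xin /series/= big_mkord.
rewrite (_ : xi bp 1 = limn (series (fun p => bp p.+1 ^+ 2))).
  apply: nondecreasing_cvgn_le => //.
  by apply: nondecreasing_series => k _ _; exact: sqr_ge0.
apply: (cvg_lim (@Rhausdorff R)).
rewrite /xi; under eq_fun do under eq_bigr do rewrite expr1n mulr1.
exact: (cvg_sum_from1 c1).
Qed.

End summability.

Section model_limit.
Context {d : measure_display} {T : measurableType d} {R : realType}.
Variable P : probability T R.
Variables (hs : nat -> {RV P >-> R}) (g : disorder P) (s L : R).
Local Notation X := (joint_family hs g).
Hypothesis HM : gaussian_disorder hs g s L.
Variable bp : nat -> R.
Hypothesis bpB : cvgn (fun n => \sum_(1 <= p < n) 2 ^+ p * bp p ^+ 2).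

Definition HU N p (c : config N) (w : T) : R :=
  coef bp N p * \sum_(t : (p.+1).*2.-tuple 'I_N)
    g (map_tuple (@nat_of_ord N) t) w * \prod_(i <- t) spin c i.

Definition field N (c : config N) (w : T) : R := \sum_(i < N) hs i w * spin c i.

(** The full energy, almost sure limit of [Em] as the truncation order grows. *)
Definition Elim N (e : config N -> R) (w : T) (c : config N) : R :=
  e c + H_SK g bp w c + field c w.

Lemma Em_HU n N e w (c : config N) :
  Em hs g bp n 0 0 e w c = e c + series (fun p => HU p c w) n + field c w.
Proof.
rewrite /Em /linE big_sumType/= addrA; congr (_ + _ + _).
  rewrite sum_coupling /series/= big_mkord; apply: eq_bigr => p _.
  rewrite /HU mulr_sumr; apply: eq_bigr => t _.
  rewrite /acoupling/= mulrAC -mulrA; congr (_ * (_ * _)).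
by apply: eq_bigr => i _; rewrite mulrC.
Qed.

Lemma H_SK_HU N w (c : config N) : cvgn (series (fun p => HU p c w)) ->
  H_SK g bp w c = limn (series (fun p => HU p c w)).
Proof.
move=> h; apply: (cvg_lim (@Rhausdorff R)).
exact: (@cvg_sum_from1 _ (fun p => bp p / (N%:R `^ (p%:R - 2^-1)) *
  \sum_(t : p.*2.-tuple 'I_N) g (map_tuple (@nat_of_ord N) t) w * \prod_(i <- t) spin c i)).
Qed.

Lemma measurable_HU N p (c : config N) : measurable_fun setT (HU p c).
Proof.
apply: measurable_funM => //; apply: measurable_sumR => t.
by apply: measurable_funM => //; exact: measurable_funPT.
Qed.

Lemma Ex_HU N p (c : config N) : (0 < N)%N ->
  rint P (fun w => `|HU p c w|) /\
  Ex P (fun w => `|HU p c w|) <= (N%:R * (`|bp p.+1| + 2^-1 ^+ p)) * (2 * expR L).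
Proof.
move=> N0.
pose K : finType := (p.+1).*2.-tuple 'I_N.
pose em (t : K) := embC 0 (mkcoupling (n := p.+1) (p := ord_max) t).
have iem : injective em.
  move=> t t' /embC_inj e.
  have := congr1 (fun k : coupling p.+1 N => tval (tagged k)) e => /= e'.
  exact: val_inj.
have dem t : joint_domain (em t) by [].
(* A positive upper bound for the standard deviation [sqrt N |beta|] of this term, summable over the
   orders; the crude factor [N] does no harm since [N] is fixed. *)
have v0 : 0 < N%:R * (`|bp p.+1| + 2^-1 ^+ p).
  by rewrite mulr_gt0 ?ltr0n// ltr_wpDl// exprn_gt0// invr_gt0.
have aE w : HU p c w = \sum_(t : K) (coef bp N p * \prod_(i <- t) spin c i) * X (em t) w.
  rewrite /HU mulr_sumr; apply: eq_bigr => t _.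
  by rewrite [X in _ * X]mulrC mulrA.
under eq_fun do rewrite aE.
apply: (Ex_abs_linear (disorder_L0 HM) (findep_emb HM iem dem) (fun k => disorder_subexp HM (dem k)) (mean_Xem HM dem) v0).
have -> : \sum_(t : K) (coef bp N p * \prod_(i <- t) spin c i) ^+ 2 = N%:R * bp p.+1 ^+ 2.
  rewrite (eq_bigr (fun=> coef bp N p ^+ 2)) => [|t _]; last first.
    rewrite exprMn -[X in _ * X]real_normK ?num_real// normr_prod_spin.
    by rewrite expr1n mulr1.
  by rewrite sumr_const card_tuple card_ord -coef_sqr// -natrX mulr_natr.
rewrite exprMn ler_pM ?sqr_ge0//; first by rewrite -natrX ler_nat -{1}(expn1 N) leq_pexp2l.
rewrite -[leLHS]real_normK ?num_real// lerXn2r ?nnegrE ?addr_ge0 ?exprn_ge0//.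
by rewrite lerDl exprn_ge0.
Qed.

Lemma dominated_HU N : (0 < N)%N -> exists D : T -> R,
  [/\ rint P D, (forall w, 0 <= D w) &
   {ae P, forall w, forall c : config N,
     (series (fun p => HU p c w) n @[n --> \oo] --> H_SK g bp w c) /\
     forall n, `|series (fun p => HU p c w) n| <= D w}].
Proof.
move=> N0.
pose a p : R := (#|{: config N}|%:R * (N%:R * (2 * expR L))) * (`|bp p.+1| + 2^-1 ^+ p).
pose Y p w := \sum_(c : config N) `|HU p c w|.
have iY p : rint P (Y p) by apply: rint_sum => c _; exact: (Ex_HU p c N0).1.
have Y0 p w : 0 <= Y p w by exact: sumr_ge0.
have Ya p : Ex P (Y p) <= a p.
  rewrite /Y Ex_sum; last by move=> c _; exact: (Ex_HU p c N0).1.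
  apply: (@le_trans _ _ (\sum_(c : config N) N%:R * (`|bp p.+1| + 2^-1 ^+ p) * (2 * expR L))).
    by apply: ler_sum => c _; exact: (Ex_HU p c N0).2.
  rewrite sumr_const /a -[leLHS]mulr_natl le_eqVlt; apply/orP; left; apply/eqP.
  by rewrite -!mulrA; congr (_ * (_ * _)); rewrite mulrC -mulrA.
have ca : cvgn (series a).
  rewrite /a (_ : series _ = fun n => (#|{: config N}|%:R * (N%:R * (2 * expR L))) *
      series (fun p => `|bp p.+1| + 2^-1 ^+ p) n).
    by apply: is_cvgMr; exact: cvgn_normr_coefs.
  by apply/funext => n; rewrite /series/= mulr_sumr.
have [D [iD D0 hD]] := series_Ex iY Y0 Ya ca.
exists D; split=> //; apply: filterS hD => w [cD bD] c.
have leY n : series (fun p => `|HU p c w|) n <= series (Y^~ w) n.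
  by apply: ler_sum => p _; rewrite /Y (bigD1 c)//= lerDl sumr_ge0.
have cHU : cvgn (series (fun p => HU p c w)).
  apply: normed_cvg; apply: (series_le_cvg _ _ _ (cvgP _ cD)) => // p /=; first exact: normr_ge0.
  by rewrite /Y (bigD1 c)//= lerDl sumr_ge0.
split; first by rewrite H_SK_HU.
move=> n; apply: le_trans (bD n); apply: le_trans (leY n).
exact: ler_norm_sum.
Qed.

Lemma measurable_H_SK N (c : config N) : measurable_fun setT (fun w => H_SK g bp w c).
Proof.
apply: measurable_limn => n; apply: measurable_sumR => p.
apply: measurable_funM => //; apply: measurable_sumR => t.
by apply: measurable_funM => //; exact: measurable_funPT.
Qed.

Lemma measurable_field N (c : config N) : measurable_fun setT (field c).
Proof.
by apply: measurable_sumR => i; exact: measurable_funM.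
Qed.

Lemma measurable_Elim N (e : config N -> R) c :
  measurable_fun setT (fun w => Elim e w c).
Proof.
apply: measurable_funD; last exact: measurable_field.
by apply: measurable_funD => //; exact: measurable_H_SK.
Qed.

Lemma measurable_Em n N (e : config N -> R) c :
  measurable_fun setT (fun w => Em hs g bp n 0 0 e w c).
Proof.
under eq_fun do rewrite Em_HU.
apply: measurable_funD; last exact: measurable_field.
apply: measurable_funD => //; apply: measurable_sumR => p; exact: measurable_HU.
Qed.

Lemma Elim_limit N : (0 < N)%N -> exists G : T -> R,
  [/\ rint P G, (forall w, 0 <= G w) &
   {ae P, forall w, forall e (c : config N),
     (Em hs g bp n 0 0 e w c @[n --> \oo] --> Elim e w c) /\
     (forall n, `|Em hs g bp n 0 0 e w c - e c| <= G w) /\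
     `|Elim e w c - e c| <= G w}].
Proof.
move=> N0; have [D [iD D0 hD]] := dominated_HU N0.
exists (fun w => D w + \sum_(i < N) `|hs i w|); split.
- apply: rintD => //; apply: rint_sum => i _.
  exact: (rint_gauss_abs (gauss_Xem HM (em := fun _ : unit => inl (i : nat)) (fun=> I)) tt).
- by move=> w; apply: addr_ge0 => //; exact: sumr_ge0.
apply: filterS hD => w h e c; have [c1 c2] := h c.
have c0 : Em hs g bp n 0 0 e w c @[n --> \oo] --> Elim e w c.
  under eq_fun do rewrite Em_HU.
  by apply: cvgD; [apply: cvgD => //|]; exact: cvg_cst.
suff bE n : `|Em hs g bp n 0 0 e w c - e c| <= D w + \sum_(i < N) `|hs i w|.
  split=> //; split=> //.
  have c3 : `|Em hs g bp n 0 0 e w c - e c| @[n --> \oo] --> `|Elim e w c - e c|.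
    by apply: cvg_norm; apply: cvgB => //; exact: cvg_cst.
  rewrite -(cvg_lim (@Rhausdorff R) c3); apply: limr_le; first exact: cvgP c3.
  by apply: nearW => n; exact: bE.
rewrite Em_HU addrAC [e c + _ - _]addrAC subrr add0r (le_trans (ler_normD _ _))// lerD//.
rewrite (le_trans (ler_norm_sum _ _ _))//; apply: ler_sum => i _.
by rewrite normrM normr_spin mulr1.
Qed.

(** The transfer from truncated to full model: [Elim_limit] bounds the distance to [e] uniformly in
    [n], so affine growth in that distance provides the majorant. It is applied to [lnZ] with
    [b = 1] and to bounded functionals with [b = 0]. *)
Lemma cvg_Ex_lim N (F : (config N -> R) -> R) (e : config N -> R) (a b : R) :
  (0 < N)%N -> 0 <= a -> 0 <= b ->
  (forall d' (T' : measurableType d') (E : T' -> config N -> R),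
    (forall c, measurable_fun setT (E^~ c)) -> measurable_fun setT (fun w => F (E w))) ->
  (forall (En : nat -> config N -> R) E, (forall c, En n c @[n --> \oo] --> E c) ->
     F (En n) @[n --> \oo] --> F E) ->
  (forall E B, (forall c, `|E c - e c| <= B) -> `|F E| <= a + b * B) ->
  rint P (fun w => F (Elim e w)) /\
  Ex P (fun w => F (Em hs g bp n 0 0 e w)) @[n --> \oo] --> Ex P (fun w => F (Elim e w)).
Proof.
move=> N0 a0 b0 mF cF bF; have [G [iG G0 hG]] := Elim_limit N0.
have mFE : measurable_fun setT (fun w => F (Elim e w)).
  by apply: mF => c; exact: measurable_Elim.
have iG' : rint P (fun w => a + b * G w).
  by apply: rintD; [exact: rint_cst|exact: rintZ].
split.
  apply: (rint_le_ae mFE iG'); apply: filterS hG => w h.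
  by apply: bF => c; have [_ [_ ?]] := h e c.
apply: (Ex_dominated _ mFE iG').
- by move=> n; apply: mF => c; exact: measurable_Em.
- by apply: filterS hG => w h; apply: cF => c; have [? _] := h e c.
- by apply: filterS hG => w h n; apply: bF => c; have [_ [? _]] := h e c.
Qed.

Definition ELlim N x : R := Ex P (fun w => lnZ (Elim (@ext_field R N x) w)).

Lemma cvg_EL N x : (0 < N)%N -> rint P (fun w => lnZ (Elim (@ext_field R N x) w)) /\
  EL hs g bp n N x @[n --> \oo] --> ELlim N x.
Proof.
move=> N0.
apply: (cvg_Ex_lim (a := `|lnZ (@ext_field R N x)|) (b := 1)) => //.
- by move=> d' T' E mE; exact: measurable_lnZ.
- by move=> En E; exact: (cvg_lnZ (config0 N)).
move=> E B EB; rewrite mul1r -[lnZ E](subrK (lnZ (@ext_field R N x))) addrC.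
by rewrite (le_trans (ler_normD _ _))// lerD2l; apply: (lnZ_lip (config0 N)).
Qed.

Lemma ELlim_superadditive x N1 N2 : (0 < N1)%N -> (0 < N2)%N ->
  ELlim N1 x + ELlim N2 x <= ELlim (N1 + N2) x.
Proof.
move=> N10 N20; have N0 : (0 < N1 + N2)%N by rewrite addn_gt0 N10.
have [_ c1] := cvg_EL x N10; have [_ c2] := cvg_EL x N20; have [_ c3] := cvg_EL x N0.
have c12 : EL hs g bp n N1 x + EL hs g bp n N2 x @[n --> \oo] -->
  ELlim N1 x + ELlim N2 x by exact: cvgD.
rewrite -(cvg_lim (@Rhausdorff R) c12) -(cvg_lim (@Rhausdorff R) c3).
apply: ler_lim; [exact: cvgP c12|exact: cvgP c3|].
by apply: nearW => n; exact: (EL_superadditive HM).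
Qed.

Lemma ELlim_bounds N x : (0 < N)%N ->
  N%:R * logcosh_mean hs x <= ELlim N x <= N%:R * (logcosh_mean hs x + xi bp 1 / 2).
Proof.
move=> N0; have [_ c] := cvg_EL x N0; rewrite -(cvg_lim (@Rhausdorff R) c).
have b n := @EL_bounds _ _ _ _ _ _ _ _ HM bp n N x N0.
apply/andP; split.
  apply: limr_ge; first exact: cvgP c.
  by apply: nearW => n; have /andP[] := b n.
apply: limr_le; first exact: cvgP c.
apply: nearW => n; have /andP[_ /le_trans] := b n; apply.
by rewrite ler_wpM2l// lerD2l ler_wpM2r// xin_le_xi.
Qed.

Lemma logcosh_mean_ge0 x : 0 <= logcosh_mean hs x.
Proof.
rewrite addr_ge0 ?ln_ge0 ?ler1n//; apply: Ex_ge0 => w; exact: lncosh_ge0.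
Qed.

Lemma free_energy_Elim N x :
  free_energy g 0 bp (fun i w => x + hs i w) N = N%:R^-1 * ELlim N x.
Proof.
have E : (fun w => ln (partition_function g 0 bp (fun i w => x + hs i w) N w)) =
    (fun w => lnZ (Elim (@ext_field R N x) w)).
  apply/funext => w; congr ln; apply: eq_bigr => c _; congr expR.
  rewrite /hamiltonian /Elim !mul0r add0r [ext_field x c + _]addrC -addrA.
  congr (_ + _); rewrite /ext_field /field mulr_sumr -big_split/=.
  by apply: eq_bigr => i _; rewrite mulrDl.
by rewrite /free_energy expectE E.
Qed.

Lemma cvg_F_SK x :
  N%:R^-1 * ELlim N x @[N --> \oo] --> F_SK g bp (fun i w => x + hs i w).
Proof.
have -> : F_SK g bp (fun i w => x + hs i w) = limn (fun N => N%:R^-1 * ELlim N x).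
  by congr (limn _); apply/funext => N; exact: free_energy_Elim.
(* The bounds are known for positive sizes only. Resetting the value at 0 changes nothing, since it
   is multiplied by [0%:R^-1 = 0]. *)
pose a N : R := if (0 < N)%N then ELlim N x else 0.
have aE : (fun N : nat => N%:R^-1 * ELlim N x) = (fun N => N%:R^-1 * a N).
  by apply/funext => -[|N]; rewrite /a// invr0 !mul0r.
rewrite aE; apply: (@fekete R a (logcosh_mean hs x + xi bp 1 / 2)).
- move=> [|N]; rewrite /a//=; have /andP[h _] := @ELlim_bounds N.+1 x isT.
  by apply: le_trans h; rewrite mulr_ge0// logcosh_mean_ge0.
- by move=> n n0; rewrite /a n0; have /andP[] := ELlim_bounds x n0.
- move=> m n m0 n0; rewrite /a m0 n0 addn_gt0 m0; exact: ELlim_superadditive.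
Qed.

Lemma F_SK_bounds x : logcosh_mean hs x <= F_SK g bp (fun i w => x + hs i w) <=
  logcosh_mean hs x + xi bp 1 / 2.
Proof.
have c := @cvg_F_SK x; rewrite -(cvg_lim (@Rhausdorff R) c).
apply/andP; split.
  apply: limr_ge; first exact: cvgP c.
  exists 1%N => // N /= N0; have /andP[h _] := ELlim_bounds x N0.
  by rewrite ler_pdivlMl ?ltr0n.
apply: limr_le; first exact: cvgP c.
exists 1%N => // N /= N0; have /andP[_ h] := ELlim_bounds x N0.
by rewrite ler_pdivrMl ?ltr0n.
Qed.

(** * Almost sure convergence of the free energy *)

Lemma normr_bp_bounded : exists2 B : R, 0 <= B & forall p, `|bp p.+1| <= B.
Proof.
have c := cvgn_normr_coefs bpB.
exists (limn (series (fun p => `|bp p.+1| + 2^-1 ^+ p))).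
  apply: limr_ge => //; apply: nearW => n; apply: sumr_ge0 => p _.
  by rewrite addr_ge0 ?exprn_ge0.
move=> p; apply: (@le_trans _ _ (series (fun p => `|bp p.+1| + 2^-1 ^+ p) p.+1)).
  rewrite /series/= big_nat_recr//= ler_wpDl//.
    by apply: sumr_ge0 => q _; rewrite addr_ge0 ?exprn_ge0.
  by rewrite lerDl exprn_ge0.
apply: nondecreasing_cvgn_le => //.
by apply: nondecreasing_series => k _ _; rewrite addr_ge0 ?exprn_ge0.
Qed.

(** The sensitivity of [lnZ] is 1 to a field and at most [B] to a coupling, so the condition on [l]
    brings all Lipschitz constants below 1. Their squares sum to [l^2 N (1 + xin)], which yields a
    bound uniform in [n]. *)
Lemma EL_exp_moment B n N x (l : R) : (0 < N)%N -> 0 <= B ->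
  (forall p, `|bp p.+1| <= B) -> `|l| * (1 + B) <= 1 ->
  let Y w := l * (lnZ (Em hs g bp n 0 0 (@ext_field R N x) w) - EL hs g bp n N x) in
  rint P (fun w => expR (Y w)) /\
  Ex P (fun w => expR (Y w)) <= expR (L * (l ^+ 2 * (N%:R * (1 + xi bp 1)))).
Proof.
move=> N0 B0 bB lB Y.
pose K : finType := (coupling n N + 'I_N)%type.
pose c0 (k : K) : R := match k with inl k => `|coef bp N (tag k)| | inr _ => 1 end.
pose c (k : K) : R := `|l| * c0 k.
pose Phi (y : K -> R) : R := l * lnZ (linE (@ext_field R N x) (@amodel _ bp n N) y).
have c01 k : 0 <= c k <= 1.
  rewrite /c; case: k => [k|i].
    rewrite mulr_ge0//=; apply: le_trans lB; rewrite ler_wpM2l//.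
    by rewrite ler_wpDl// (le_trans (normr_coef_le _ _ N0)).
  by rewrite mulr_ge0//=; apply: le_trans lB; rewrite ler_wpM2l// lerDl.
have mPhi : measurable_fun setT (Phi \o @kval R K).
  apply: measurable_funM => //.
  apply: (@measurable_lnZ _ _ _ _ (fun t => linE _ _ (kval t))) => c'.
  apply: measurable_funD => //; apply: measurable_sumR => k.
  by apply: measurable_funM => //; exact: measurable_kval.
have lPhi y z : `|Phi y - Phi z| <= \sum_k c k * `|y k - z k|.
  rewrite /Phi -mulrBr normrM.
  rewrite /c; under eq_bigr do rewrite -mulrA.
  rewrite -mulr_sumr ler_wpM2l//; apply: (lnZ_lip (config0 N)) => c'.
  rewrite /linE opprD addrACA subrr add0r -sumrB (le_trans (ler_norm_sum _ _ _))//.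
  apply: ler_sum => k _; rewrite -mulrBr normrM ler_wpM2r//.
  by case: k => [k|i] /=; rewrite ?normr_acoupling ?normr_spin.
have [iY bY] := concentrationK (findep_emb HM (@emb_inj n N 0 0) (@emb_domain n N 0 0))
  (fun k => disorder_subexp HM (emb_domain 0 0 k)) c01 mPhi lPhi.
have E0 : Ex P (fun w => Phi (fun k => X (emb 0 0 k) w)) = l * EL hs g bp n N x.
  by rewrite ExZ//; exact: (rint_lnZ_linE (gauss_Xem HM (@emb_domain n N 0 0)) (config0 N)).
have YE w : expR (Y w) = expR (Phi (fun k => X (emb 0 0 k) w) - l * EL hs g bp n N x).
  by rewrite /Y mulrBr.
rewrite E0 in bY.
have iexp : rint P (fun w => expR (Y w)).
  under eq_fun do rewrite YE; apply/integrableP; split.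
    apply/measurable_EFinP/measurableT_comp => //.
    by apply: measurable_funB => //; exact: rint_meas iY.
  under eq_integral => w _ do rewrite /= ger0_norm ?expR_ge0//.
  by rewrite (le_lt_trans bY)// ltry.
split=> //; rewrite -lee_fin -integral_Ex//.
under eq_integral => w _ do rewrite YE.
rewrite (le_trans bY)// lee_fin ler_expR.
rewrite ler_wpM2l ?(disorder_L0 HM)//.
have -> : \sum_k c k ^+ 2 = l ^+ 2 * (N%:R * (1 + xin bp n)).
  rewrite /c; under eq_bigr do rewrite exprMn real_normK ?num_real//.
  rewrite -mulr_sumr; congr (_ * _); rewrite big_sumType/=.
  under eq_bigr do rewrite real_normK ?num_real//.
  by rewrite sum_coef_sqr// expr1n sumr_const card_ord mulrDr mulr1 addrC.
by rewrite ler_wpM2l ?sqr_ge0// ler_wpM2l// lerD2l xin_le_xi.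
Qed.

(* A bounded substitute for [expR], through which the truncation level can be
   sent to infinity by dominated convergence. *)
Definition logistic (u : R) : R := (1 + expR (- u))^-1.

Lemma logistic_bounds u : 0 <= logistic u <= 1.
Proof.
have := expR_ge0 (- u) => h; rewrite /logistic invr_ge0 addr_ge0//=.
by rewrite invf_le1 ?lerDl// ltr_wpDr.
Qed.

Lemma logistic_le_expR u : logistic u <= expR u.
Proof.
rewrite /logistic -[leRHS]invrK -expRN lef_pV2 ?posrE ?addr_gt0 ?expR_gt0//.
by rewrite lerDr.
Qed.

Lemma logistic_ge (u : R) : 0 <= u -> 2^-1 <= logistic u.
Proof.
move=> u0; rewrite /logistic lef_pV2 ?posrE ?addr_gt0 ?expR_gt0//.
by rewrite -[2]/(1 + 1) lerD2l -expR0 ler_expR oppr_le0.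
Qed.

Lemma continuous_logistic : continuous logistic.
Proof.
move=> u; apply: cvgV; first by rewrite gt_eqF// addr_gt0 ?expR_gt0.
apply: cvgD; first exact: cvg_cst.
apply: continuous_comp; first exact: opp_continuous.
exact: continuous_expR.
Qed.

(** Chernoff's bound, with [e] selecting the tail. The logistic function lies below the exponential,
    so it inherits the truncated moment bound, and it is bounded, so the bound passes to the limit
    in [n]. *)
Lemma lnZ_deviation x (e eps : R) : `|e| = 1 -> 0 < eps ->
  exists2 l : R, 0 < l & exists2 r : R, 0 <= r < 1 & forall N, (0 < N)%N ->
  let Z w := logistic (l * (e * (lnZ (Elim (@ext_field R N x) w) - ELlim N x) - eps * N%:R)) in
  rint P Z /\ Ex P Z <= r ^+ N.
Proof.
move=> e1 eps0; have [B B0 bB] := normr_bp_bounded.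
have L0 := disorder_L0 HM.
have xi0 : 0 <= xi bp 1 by apply: le_trans (xin_le_xi bpB 0); rewrite /xin big_ord0.
pose M : R := L * (1 + xi bp 1) + 1.
have M0 : 0 < M by rewrite ltr_wpDl// mulr_ge0// addr_ge0.
(* The first entry meets the Lipschitz restriction. The second makes the quadratic cost at most half
   of the linear gain [l * eps * N], leaving the rate [l * eps / 2]. *)
pose l : R := Num.min (1 + B)^-1 (eps / (2 * M)).
have l0 : 0 < l.
  by rewrite /l lt_min invr_gt0 ltr_wpDr//= divr_gt0// mulr_gt0.
have lB : l * (1 + B) <= 1.
  by rewrite -ler_pdivlMr ?ltr_wpDr// mul1r /l ge_min lexx.
have lM : l * M <= eps / 2.
  rewrite -ler_pdivlMr// /l ge_min invfM mulrA lexx orbT //.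
exists l => //; exists (expR (- (l * eps / 2))).
  by rewrite expR_ge0/= expR_lt1 oppr_lt0 divr_gt0// mulr_gt0.
move=> N N0 Z.
pose Zn n w : R := logistic (l * (e * (lnZ (Em hs g bp n 0 0 (@ext_field R N x) w) - EL hs g bp n N x) - eps * N%:R)).
have mlog : measurable_fun setT logistic.
  exact: continuous_measurable_fun continuous_logistic.
have [iY cEL] := cvg_EL x N0.
have mZ : measurable_fun setT Z.
  apply: (measurableT_comp mlog); apply: measurable_funM => //.
  apply: measurable_funB => //; apply: measurable_funM => //.
  by apply: measurable_funB => //; exact: rint_meas iY.
have mZn n : measurable_fun setT (Zn n).
  apply: (measurableT_comp mlog); apply: measurable_funM => //.
  apply: measurable_funB => //; apply: measurable_funM => //.
  apply: measurable_funB => //.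
  apply: (@measurable_lnZ _ _ _ _ (fun w => Em hs g bp n 0 0 (@ext_field R N x) w)) => c.
  exact: measurable_Em.
have norm_log u : `|logistic u| <= 1.
  by have /andP[h1 h2] := logistic_bounds u; rewrite ger0_norm.
have iZ : rint P Z := rint_bnd P mZ (fun w => norm_log _).
split=> //.
have cZ : Ex P (Zn n) @[n --> \oo] --> Ex P Z.
  apply: (Ex_dominated mZn mZ (rint_cst P 1)).
    have [G [_ _ hG]] := Elim_limit N0; apply: filterS hG => w h.
    apply: continuous_cvg; first exact: continuous_logistic.
    apply: cvgM; first exact: cvg_cst.
    apply: cvgB; last exact: cvg_cst.
    apply: cvgM; first exact: cvg_cst.
    apply: cvgB => //; apply: (cvg_lnZ (config0 N)) => c.
    by have [] := h (@ext_field R N x) c.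
  by apply: aeW => w n; exact: norm_log.
rewrite -(cvg_lim (@Rhausdorff R) cZ); apply: limr_le; first exact: cvgP cZ.
apply: nearW => n.
have lB' : `|l * e| * (1 + B) <= 1 by rewrite normrM e1 mulr1 gtr0_norm.
have [iE bE] := EL_exp_moment n x N0 B0 bB lB'.
have iZn : rint P (Zn n) := rint_bnd P (mZn n) (fun w => norm_log _).
pose V w : R := expR (l * e * (lnZ (Em hs g bp n 0 0 (@ext_field R N x) w) - EL hs g bp n N x)).
apply: (@le_trans _ _ (Ex P (fun w => expR (- (l * eps * N%:R)) * V w))).
  apply: Ex_le => //; first exact: rintZ.
  move=> w; rewrite (le_trans (logistic_le_expR _))// /V -expRD ler_expR.
  by rewrite le_eqVlt; apply/orP; left; apply/eqP; ring.
rewrite ExZ//; apply: (le_trans (ler_wpM2l (expR_ge0 _) bE)).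
rewrite -expRD -expRM_natl ler_expR.
have e2 : e ^+ 2 = 1 by rewrite -real_normK ?num_real// e1 expr1n.
have h : l * (L * (1 + xi bp 1)) <= eps / 2.
  by apply: le_trans lM; rewrite ler_wpM2l ?(ltW l0)// lerDl.
have -> : (l * e) ^+ 2 = l ^+ 2 by rewrite exprMn e2 mulr1.
have -> : - (l * eps * N%:R) + L * (l ^+ 2 * (N%:R * (1 + xi bp 1))) =
  (N%:R * l) * (l * (L * (1 + xi bp 1)) - eps) by ring.
have -> : N%:R * - (l * eps / 2) = (N%:R * l) * (eps / 2 - eps) by field.
by rewrite ler_wpM2l ?lerD2r// mulr_ge0// ltW.
Qed.

Lemma cvg_lnZ_ae x : {ae P, forall w,
  N%:R^-1 * lnZ (Elim (@ext_field R N x) w) @[N --> \oo] --> F_SK g bp (fun i w => x + hs i w)}.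
Proof.
have tail (e eps : R) : `|e| = 1 -> 0 < eps -> {ae P, forall w, \forall N \near \oo,
    e * (lnZ (Elim (@ext_field R N x) w) - ELlim N x) <= eps * N%:R}.
  move=> e1 eps0; have [l l0 [r /andP[r0 r1] h]] := lnZ_deviation x e1 eps0.
  pose Z N w := logistic (l * (e * (lnZ (Elim (@ext_field R N.+1 x) w) - ELlim N.+1 x) - eps * N.+1%:R)).
  have Zr N : Ex P (Z N) <= geometric 1 r N.
    have [_ /le_trans] := h N.+1 isT; apply.
    by rewrite /geometric/= mul1r exprS ler_piMl ?exprn_ge0// ltW.
  have cg : cvgn (series (geometric 1 r)).
    by apply: (@is_cvg_geometric_series R 1 r); rewrite ger0_norm.
  have [D [_ _ hD]] := series_Ex (fun N => (h N.+1 isT).1)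
    (fun N w => (andP (logistic_bounds _)).1) Zr cg.
  apply: filterS hD => w [/cvgP/cvg_series_cvg_0 c0 _].
  (* A logistic value below 1/2 means a negative argument, that is, a deviation smaller than
     [eps * N]. *)
  have /cvgrPdist_lt/(_ 2^-1) := c0; case; first by rewrite invr_gt0.
  move=> N1 _ hN1; exists N1.+1 => // -[//|N] /= N1N.
  have := hN1 N N1N; rewrite sub0r normrN; apply: contraTT.
  rewrite -ltNge -leNgt => hlt; apply: le_trans (ler_norm _); apply: logistic_ge.
  by apply: mulr_ge0; [exact: ltW|rewrite subr_ge0 ltW].
(* Countably many tolerances [1 / (k + 1)] allow one null set for all of them. *)
have {}tail : {ae P, forall w, forall k : nat, \forall N \near \oo,
    `|lnZ (Elim (@ext_field R N x) w) - ELlim N x| <= k.+1%:R^-1 * N%:R}.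
  apply: ae_foralln => k.
  have k0 : (0 : R) < k.+1%:R^-1 by rewrite invr_gt0.
  have h1 := tail 1 _ (normr1 _) k0; have h2 := tail (- 1) _ (normrN1 _) k0.
  apply: filterS2 h1 h2 => w {}h1 {}h2.
  apply: filterS2 h1 h2 => N; rewrite mul1r mulN1r => h1 h2.
  by rewrite ler_norml lerNl h1 h2.
apply: filterS tail => w h.
have -> : (fun N => N%:R^-1 * lnZ (Elim (@ext_field R N x) w)) =
   (fun N => N%:R^-1 * (lnZ (Elim (@ext_field R N x) w) - ELlim N x) + N%:R^-1 * ELlim N x).
  by apply/funext => N; rewrite -mulrDr subrK.
rewrite -[F_SK _ _ _]add0r; apply: cvgD; last exact: cvg_F_SK.
apply/cvgrPdist_lt => eps eps0.
have [k ke] : exists k : nat, k.+1%:R^-1 < eps.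
  by have [k _ /(_ k (leqnn _))] := near_infty_natSinv_lt (PosNum eps0); exists k.
near=> N; rewrite sub0r normrN normrM (le_lt_trans _ ke)//.
have N0 : (0 < N)%N by near: N; exists 1%N.
rewrite ger0_norm ?invr_ge0// ler_pdivrMl ?ltr0n// mulrC.
by near: N; exact: h.
Unshelve. all: by end_near.
Qed.

End model_limit.

(** * Concentration of the magnetization *)

Lemma cvg_affine {R : realType} (u v : nat -> R) (c x y : R) :
  u @ \oo --> x -> v @ \oo --> y -> c + (u n - v n) @[n --> \oo] --> c + (x - y).
Proof. by move=> ux vy; apply: cvgD; [exact: cvg_cst|exact: cvgB]. Qed.

Lemma cvgD0 {R : realType} (u v : nat -> R) : u @ \oo --> (0 : R) ->
  v @ \oo --> (0 : R) -> u n + v n @[n --> \oo] --> (0 : R).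
Proof. by move=> u0 v0; have := cvgD u0 v0; rewrite addr0; exact. Qed.

Section magnetization_weights.
Context {R : realType}.

Definition mean_field N (b : R) (c : config N) : R :=
  b * N%:R / 2 * magnetization c ^+ 2.

Definition near_ind N (x eps : R) (c : config N) : R :=
  (`|magnetization c - x| <= eps)%R%:R.

Lemma near_ind_bnd N x eps (c : config N) : `|near_ind x eps c| <= 1.
Proof. by rewrite /near_ind normr_nat lern1 leq_b1. Qed.

Lemma normr_magnetization N (c : config N) : `|magnetization c : R| <= 1.
Proof.
rewrite /magnetization normrM ger0_norm ?invr_ge0//.
case: N c => [c|N c]; first by rewrite invr0 mul0r.
rewrite ler_pdivrMl ?ltr0n// mulr1 (le_trans (ler_norm_sum _ _ _))//.
by under eq_bigr do rewrite normr_spin; rewrite sumr_const card_ord.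
Qed.

Lemma sum_spin N (c : config N) : \sum_i spin c i = N%:R * magnetization c :> R.
Proof.
case: N c => [c|N c]; first by rewrite big_ord0 mul0r.
by rewrite /magnetization mulrA divff ?mul1r// pnatr_eq0.
Qed.

(* [m^2 = (m - q)^2 + 2 q m - q^2] linearises the quadratic interaction. *)
Lemma near_weight_le N (U : config N -> R) (b q mu delta : R) : 0 < b ->
  av (fun c => mean_field b c + U c) (near_ind q delta) <=
  expR (N%:R * (b * delta ^+ 2 / 2 - b * q ^+ 2 / 2 + b * mu ^+ 2 / 2) +
    (lnZ (fun c => ext_field (b * q) c + U c) -
     lnZ (fun c => ext_field (b * mu) c + U c))).
Proof.
move=> b0.
set Eq := (fun c => ext_field (b * q) c + U c).
set Em := (fun c => ext_field (b * mu) c + U c).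
set Eb := (fun c => mean_field b c + U c).
have Zq0 : 0 < Zf Eq := Zf_gt0 (config0 N) Eq.
have Zm0 : 0 < Zf Em := Zf_gt0 (config0 N) Em.
have Zb0 : 0 < Zf Eb := Zf_gt0 (config0 N) Eb.
have EbE x c : Eb c = N%:R * (b * (magnetization c - x) ^+ 2 / 2 - b * x ^+ 2 / 2) +
    (ext_field (b * x) c + U c).
  rewrite /Eb /mean_field /ext_field sum_spin.
  by move: (magnetization c) (U c) (N%:R : R) => m v n; field.
(* Dropping the square around [mu] bounds the partition function from below; in the window around
   [q] the square is at most [delta ^+ 2], which gives [upper]. *)
have lower : expR (- (N%:R * (b * mu ^+ 2 / 2))) * Zf Em <= Zf Eb.
  rewrite /Zf mulr_sumr; apply: ler_sum => c _; rewrite -expRD ler_expR (EbE mu).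
  rewrite lerD2r -mulrN ler_wpM2l// lerDr.
  by rewrite divr_ge0// mulr_ge0 ?sqr_ge0// ltW.
have upper : \sum_c expR (Eb c) * near_ind q delta c <=
    expR (N%:R * (b * delta ^+ 2 / 2 - b * q ^+ 2 / 2)) * Zf Eq.
  rewrite /Zf mulr_sumr; apply: ler_sum => c _.
  rewrite /near_ind; have [h|_] := leP `|magnetization c - q| delta; last first.
    by rewrite mulr0 mulr_ge0// expR_ge0.
  rewrite mulr1 -expRD ler_expR (EbE q) lerD2r ler_wpM2l// lerD2r.
  rewrite ler_wpM2r// ler_wpM2l ?(ltW b0)// -real_normK ?num_real//.
  by rewrite lerXn2r ?nnegrE// (le_trans _ h).
rewrite /av ler_pdivrMr//; apply: (le_trans upper).
have lnE : expR (lnZ Eq - lnZ Em) = Zf Eq / Zf Em.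
  by rewrite expRB /lnZ !lnK// posrE.
have {}lower : Zf Em <= expR (N%:R * (b * mu ^+ 2 / 2)) * Zf Eb.
  by rewrite -ler_pdivrMl ?expR_gt0// -expRN.
rewrite expRD lnE.
have -> : expR (N%:R * (b * delta ^+ 2 / 2 - b * q ^+ 2 / 2 + b * mu ^+ 2 / 2)) =
    expR (N%:R * (b * delta ^+ 2 / 2 - b * q ^+ 2 / 2)) *
    expR (N%:R * (b * mu ^+ 2 / 2)) by rewrite -expRD -mulrDr.
move: (expR (N%:R * (b * mu ^+ 2 / 2))) (expR _) (expR_ge0 (N%:R * (b * delta ^+ 2 / 2 - b * q ^+ 2 / 2))) lower => B A.
move: (Zf Eq) (Zf Em) (Zf Eb) Zq0 Zm0 => zq zm zb zq0 zm0 A0 lower.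
have -> : A * B * (zq / zm) * zb = A * zq * ((B * zb) / zm) by field; rewrite gt_eqF.
by rewrite ler_peMr ?mulr_ge0// ?(ltW zq0)// ler_pdivlMr// mul1r.
Qed.

Lemma cvg_expR_lin (a : nat -> R) (l : R) : a @ \oo --> l -> l < 0 ->
  expR (n%:R * a n) @[n --> \oo] --> (0 : R).
Proof.
move=> al l0.
have r1 : `|expR (l / 2)| < 1.
  by rewrite ger0_norm ?expR_ge0// expR_lt1 pmulr_llt0// invr_gt0.
apply: (@squeeze_cvgr _ _ _ _ (cst 0) (fun n => expR (l / 2) ^+ n)); last 2 first.
- exact: cvg_cst.
- exact: cvg_expr.
have l2 : l < l / 2 by lra.
have h : \forall n \near \oo, a n < l / 2 by exact: cvgr_lt al _ l2.
apply: filterS h => n an.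
by rewrite /= expR_ge0/= -expRM_natl ler_expR ler_wpM2l// ltW.
Qed.

End magnetization_weights.

Section magnetization_limit.
Context {d : measure_display} {T : measurableType d} {R : realType}.
Variable P : probability T R.
Variables (hs : nat -> {RV P >-> R}) (g : disorder P) (s L : R).
Hypothesis HM : gaussian_disorder hs g s L.
Variable bp : nat -> R.
Hypothesis bpB : cvgn (fun n => \sum_(1 <= p < n) 2 ^+ p * bp p ^+ 2).
Variable b : R.
Hypothesis b0 : 0 < b.
Local Notation F x := (F_SK g bp (fun i w => x + hs i w)).
Local Notation Eb N w := (Elim hs g bp (@mean_field R N b) w).

Lemma gibbs_near_av x eps N w :
  gibbs_near g b bp hs x eps N w = av (Eb N w) (near_ind x eps).
Proof. by rewrite /gibbs_near /av mulr_suml; apply: eq_bigr => c _; rewrite mulrAC. Qed.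

(** Divided by [N], the exponent in [near_weight_le] converges almost surely to a limit that the
    hypothesis makes negative, so the weight decays exponentially. *)
Lemma cvg_near_weight q mu delta :
  F (b * q) - b * q ^+ 2 / 2 + b * delta ^+ 2 / 2 < F (b * mu) - b * mu ^+ 2 / 2 ->
  {ae P, forall w, av (Eb N w) (near_ind q delta) @[N --> \oo] --> (0 : R)}.
Proof.
move=> hlt.
have cq := cvg_lnZ_ae HM bpB (b * q); have cm := cvg_lnZ_ae HM bpB (b * mu).
apply: filterS2 cq cm => w cq cm.
pose U N (c : config N) : R := H_SK g bp w c + field hs c w.
have EU N (e : config N -> R) : Elim hs g bp e w = fun c => e c + U N c.
  by apply/funext => c; rewrite /Elim addrA.
pose a N : R := b * delta ^+ 2 / 2 - b * q ^+ 2 / 2 + b * mu ^+ 2 / 2 +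
  (N%:R^-1 * lnZ (Elim hs g bp (@ext_field R N (b * q)) w) -
   N%:R^-1 * lnZ (Elim hs g bp (@ext_field R N (b * mu)) w)).
have ca : a @ \oo --> b * delta ^+ 2 / 2 - b * q ^+ 2 / 2 + b * mu ^+ 2 / 2 +
    (F (b * q) - F (b * mu)).
  exact: (cvg_affine cq cm).
have l0 : b * delta ^+ 2 / 2 - b * q ^+ 2 / 2 + b * mu ^+ 2 / 2 +
    (F (b * q) - F (b * mu)) < 0.
  by move: hlt; move: (F _) (F _) => x y; lra.
have c0 := cvg_expR_lin ca l0.
apply: (@squeeze_cvgr _ _ _ _ (cst 0) (fun n => expR (n%:R * a n))) => //; last exact: cvg_cst.
exists 1%N => // N /= N0; apply/andP; split.
  by apply: av_ge0 => c; rewrite /near_ind.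
rewrite EU (le_trans (near_weight_le (U N) q mu delta b0))// ler_expR.
rewrite /a [leRHS]mulrDr lerD2l -mulrBr mulrA divff ?pnatr_eq0 -?lt0n// mul1r.
by rewrite !EU.
Qed.

(* By compactness, finitely many instances of [cvg_near_weight] suffice. *)
Lemma cvg_far_weight mu eps : 0 < eps ->
  (forall q, -1 <= q <= 1 -> q != mu -> q != - mu ->
    F (b * q) - b * q ^+ 2 / 2 < F (b * mu) - b * mu ^+ 2 / 2) ->
  {ae P, forall w,
    av (Eb N w) (fun c => (eps < `| `|magnetization c| - `|mu| |)%R%:R)
      @[N --> \oo] --> (0 : R)}.
Proof.
move=> eps0 hlt.
pose pot q := F (b * q) - b * q ^+ 2 / 2.
pose K := `[-1, 1] `&` [set q : R | eps <= `| `|q| - `|mu| |].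
have Kq q : K q -> -1 <= q <= 1 /\ pot q < pot mu.
  move=> [/= q1 qe]; rewrite in_itv/= in q1; split=> //.
  apply: hlt => //; apply: contraTneq qe => ->; rewrite ?normrN subrr normr0 -ltNge//.
(* With this radius the loss [b * rad q ^+ 2 / 2] from linearising around [q] is half of the gap
   [pot mu - pot q]. *)
pose rad q := Num.sqrt ((pot mu - pot q) / b).
have rad_gt0 q : K q -> 0 < rad q.
  by move=> /Kq[_ h]; rewrite sqrtr_gt0 divr_gt0// subr_gt0.
have rad2 q : K q -> pot q + b * rad q ^+ 2 / 2 < pot mu.
  move=> /Kq[_ h]; rewrite /rad sqr_sqrtr ?divr_ge0 ?subr_ge0 ?ltW//.
  by rewrite [b * _]mulrC divfK ?gt_eqF//; move: h; move: (pot q) (pot mu) => x y; lra.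
have cK : compact K.
  rewrite /K; apply: compact_closedI; first exact: segment_compact.
  have -> : [set q : R | eps <= `| `|q| - `|mu| |] =
      (fun q : R => `| `|q| - `|mu| |) @^-1` [set x | eps <= x] by [].
  apply: closed_comp; last exact: closed_ge.
  move=> q _; apply: cvg_norm; apply: cvgB; last exact: cvg_cst.
  exact: cvg_norm.
rewrite compact_cover in cK.
have [] := cK R K (fun q => ball q (rad q)).
- by move=> q Kq'; apply: ball_open; exact: rad_gt0.
- by move=> q Kq'; exists q => //; apply: ballxx; exact: rad_gt0.
move=> D0 DK0 KD0.
have [D [uD DK KD]] : exists D : seq R, [/\ uniq D, (forall q, q \in D -> K q) &
    forall m, K m -> exists2 q, q \in D & ball q (rad q) m].
  exists (finmap.enum_fset D0); split; first exact: finmap.fset_uniq.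
    by move=> q qD; have := DK0 q qD; rewrite inE.
  by move=> m /KD0[q qD qb]; exists q.
have aeD : {ae P, forall w, forall k : nat, K (nth 0 D k) ->
    av (Eb N w) (near_ind (nth 0 D k) (rad (nth 0 D k))) @[N --> \oo] --> (0 : R)}.
  apply: ae_foralln => k; have [hK|nK] := pselect (K (nth 0 D k)).
    apply: filterS (@cvg_near_weight (nth 0 D k) mu _ (rad2 _ hK)) => w h _; exact: h.
  by apply: aeW => w /nK.
apply: filterS aeD => w h.
have hD q : q \in D -> av (Eb N w) (near_ind q (rad q)) @[N --> \oo] --> (0 : R).
  move=> qD; have := h (index q D); rewrite nth_index//; apply.
  exact: DK.
have c0 : \sum_(q <- D) av (Eb N w) (near_ind q (rad q)) @[N --> \oo] --> (0 : R).
  have : forall r : seq R, {subset r <= D} ->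
      \sum_(q <- r) av (Eb N w) (near_ind q (rad q)) @[N --> \oo] --> (0 : R).
    elim=> [|q r IH] rD.
      by under eq_fun do rewrite big_nil; exact: cvg_cst.
    under eq_fun do rewrite big_cons.
    apply: cvgD0.
      by apply: hD; apply: rD; rewrite mem_head.
    by apply: IH => x xr; apply: rD; rewrite inE xr orbT.
  by apply.
apply: (@squeeze_cvgr _ _ _ _ (cst 0)
  (fun N => \sum_(q <- D) av (Eb N w) (near_ind q (rad q)))) => //; last exact: cvg_cst.
apply: nearW => N /=; rewrite av_ge0//= -av_sum.
apply: (av_le (config0 N)) => c; have [hc|_] := ltP; last first.
  by apply: sumr_ge0 => q _; rewrite /near_ind.
have mK : K (magnetization c).
  by split; [rewrite /= in_itv/= -ler_norml normr_magnetization|exact: ltW].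
have [q qD qb] := KD _ mK.
rewrite (bigD1_seq q)//= -[leLHS]addr0 lerD//; last first.
  by apply: sumr_ge0 => q' _; rewrite /near_ind.
by rewrite /near_ind; move: qb; rewrite /ball/= distrC => /ltW ->.
Qed.

Definition Wp mu eps N w := av (Eb N w) (@near_ind R N mu eps).

(** Since [eps < mu] the windows around [mu] and [- mu] lie on opposite sides of 0; being disjoint,
    their indicators sum to that of [||m| - mu| <= eps]. *)
Lemma cvg_two_peaks mu eps : 0 < eps < mu ->
  (forall q, -1 <= q <= 1 -> q != mu -> q != - mu ->
    F (b * q) - b * q ^+ 2 / 2 < F (b * mu) - b * mu ^+ 2 / 2) ->
  {ae P, forall w, Wp mu eps N w + Wp (- mu) eps N w @[N --> \oo] --> (1 : R)}.
Proof.
move=> /andP[e0 em] /(cvg_far_weight e0); apply: filterS => w h.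
have -> : (fun N => Wp mu eps N w + Wp (- mu) eps N w) = (fun N => 1 -
    av (Eb N w) (fun c => (eps < `| `|magnetization c| - `|mu| |)%R%:R)).
  apply/funext => N; apply/eqP; rewrite eq_sym subr_eq /Wp -!avD; apply/eqP.
  rewrite -{1}(av_cst (config0 N) (Eb N w) 1); apply: eq_av => c.
  rewrite /near_ind opprK; move: (magnetization c) => m.
  have mu0 : 0 < mu by exact: lt_trans em.
  rewrite (gtr0_norm mu0); have [m0|m0] := leP 0 m.
    rewrite (ger0_norm m0) [`|m + mu|]ger0_norm ?addr_ge0// ?(ltW mu0)//.
    have -> : (m + mu <= eps) = false by apply/negbTE; rewrite -ltNge; lra.
    by rewrite addr0 ltNge; case: (_ <= _); rewrite ?addr0 ?add0r.
  rewrite (ltr0_norm m0) -opprD normrN [`|m - mu|]ltr0_norm; last by lra.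
  have -> : (- (m - mu) <= eps) = false by apply/negbTE; rewrite -ltNge; lra.
  by rewrite add0r ltNge; case: (_ <= _); rewrite ?addr0 ?add0r.
rewrite -[X in _ --> X]subr0; apply: cvgB => //; exact: cvg_cst.
Qed.

End magnetization_limit.

(** * Spin-flip symmetry and the variance of the magnetization *)

Lemma eq_invn_mul {R : realType} (u v : nat -> R) :
  (forall N, (0 < N)%N -> u N = v N) ->
  (fun N => N%:R^-1 * u N) = (fun N => N%:R^-1 * v N).
Proof.
move=> uv; apply/funext => -[|N]; first by rewrite invr0 !mul0r.
by rewrite uv.
Qed.

Section spin_flip.
Context {R : realType}.

Definition flip N (c : config N) : config N := [ffun i => ~~ c i].

Lemma flipK N : involutive (@flip N).
Proof. by move=> c; apply/ffunP => i; rewrite !ffunE negbK. Qed.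

Lemma spin_flip N (c : config N) i : spin (flip c) i = - spin c i :> R.
Proof. by rewrite /spin ffunE signrN. Qed.

Lemma prod_spin_flip N p (c : config N) (t : p.*2.-tuple 'I_N) :
  \prod_(i <- t) spin (flip c) i = \prod_(i <- t) spin c i :> R.
Proof.
have E (r : seq 'I_N) : \prod_(i <- r) spin (flip c) i =
    (-1) ^+ size r * \prod_(i <- r) spin c i :> R.
  elim: r => [|i r IH]; first by rewrite !big_nil mulr1.
  by rewrite !big_cons IH /= exprS spin_flip; ring.
have e1 : (-1) ^+ size t = 1 :> R by rewrite size_tuple -mul2n exprM sqrrN !expr1n.
by rewrite E e1 mul1r.
Qed.

Lemma magnetization_flip N (c : config N) : magnetization (flip c) = - magnetization c :> R.
Proof.
rewrite /magnetization -mulrN -sumrN; congr (_ * _).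
by apply: eq_bigr => i _; exact: spin_flip.
Qed.

Lemma near_ind_flip N (mu eps : R) (c : config N) :
  near_ind mu eps (flip c) = near_ind (- mu) eps c.
Proof.
by rewrite /near_ind magnetization_flip -opprD normrN opprK.
Qed.

Lemma sum_flip N (f : config N -> R) : \sum_c f (flip c) = \sum_c f c.
Proof. by rewrite [RHS](reindex_inj (can_inj (@flipK N))). Qed.

Lemma av_flip N (E f : config N -> R) :
  av (fun c => E (flip c)) f = av E (fun c => f (flip c)).
Proof.
rewrite /av /Zf (sum_flip (fun c => expR (E c))); congr (_ / _).
by rewrite -(sum_flip (fun c => expR (E c) * f (flip c))); apply: eq_bigr => c _; rewrite flipK.
Qed.

Lemma lnZ_flip N (E : config N -> R) : lnZ (fun c => E (flip c)) = lnZ E.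
Proof. by rewrite /lnZ /Zf (sum_flip (fun c => expR (E c))). Qed.

End spin_flip.

Section symmetry.
Context {d : measure_display} {T : measurableType d} {R : realType}.
Variable P : probability T R.
Variables (hs : nat -> {RV P >-> R}) (g : disorder P) (s L : R).
Hypothesis HM : gaussian_disorder hs g s L.
Local Notation X := (joint_family hs g).
Variable bp : nat -> R.
Hypothesis bpB : cvgn (fun n => \sum_(1 <= p < n) 2 ^+ p * bp p ^+ 2).

(** Flipping all spins leaves interactions of even order unchanged and reverses the signs of the
    fields, whose law is symmetric; only [e] feels the flip. *)
Lemma Em_flip_law n N (e : config N -> R) (Phi : (config N -> R) -> R) :
  (forall d' (T' : measurableType d') (E : T' -> config N -> R),
    (forall c, measurable_fun setT (E^~ c)) -> measurable_fun setT (fun w => Phi (E w))) ->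
  rint P (fun w => Phi (Em hs g bp n 0 0 e w)) ->
  rint P (fun w => Phi (fun c => Em hs g bp n 0 0 (e \o @flip N) w (flip c))) ->
  Ex P (fun w => Phi (Em hs g bp n 0 0 e w)) =
  Ex P (fun w => Phi (fun c => Em hs g bp n 0 0 (e \o @flip N) w (flip c))).
Proof.
move=> mPhi i1 i2.
pose K : finType := (coupling n N + 'I_N)%type.
pose Y (k : K) : T -> R := X (emb 0 0 k).
pose Y' (k : K) (w : T) : R := match k with inl _ => Y k w | inr _ => - Y k w end.
have flipE w : (fun c => Em hs g bp n 0 0 (e \o @flip N) w (flip c)) =
    linE e (@amodel R bp n N) (Y'^~ w).
  apply/funext => c; rewrite /Em /linE /= flipK; congr (_ + _).
  apply: eq_bigr => -[k|i] _ /=.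
    by rewrite /acoupling prod_spin_flip.
  by rewrite spin_flip mulNr mulrN.
rewrite [X in rint P X](_ : _ = fun w => Phi (linE e (@amodel R bp n N) (Y'^~ w))) in i2; last first.
  by apply/funext => w; rewrite flipE.
rewrite [RHS](_ : _ = Ex P (fun w => Phi (linE e (@amodel R bp n N) (Y'^~ w)))); last first.
  by apply: eq_Ex => w; rewrite flipE.
have iY : findep P Y := findep_emb HM (@emb_inj n N 0 0) (@emb_domain n N 0 0).
have mY k : measurable_fun setT (Y k) by exact: measurable_funPT.
apply: (@law_ExK _ _ _ P K Y Y' (fun x => Phi (linE e (@amodel R bp n N) x))) => //.
- by case=> [k|i]; [exact: mY|apply: measurableT_comp => //; exact: mY].
- move=> A mA.
  pose A' (k : K) := match k with inl _ => A k | inr _ => -%R @^-1` A k end.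
  have mA' k : measurable (A' k).
    case: k => [k|i] //=; rewrite -[X in measurable X]setTI.
    exact: measurable_funN.
  have := iY A' mA'.
  rewrite (_ : [set w | forall k, A' k (Y k w)] = [set w | forall k, A k (Y' k w)]).
    move=> ->; apply: eq_bigr => -[k|i] _ //.
  by apply/seteqP; split=> w h k; have := h k; case: k.
- case=> [k|i] A mA //.
  have -> : Y' (inr i) @^-1` A = Y (inr i) @^-1` (-%R @^-1` A) by [].
  exact/esym/(gauss_sym (disorder_gauss HM (emb_domain 0 0 (inr i)))).
- apply: (mPhi _ _ (fun t => linE e (@amodel R bp n N) (kval t))) => c.
  apply: measurable_funD => //; apply: measurable_sumR => k.
  by apply: measurable_funM => //; exact: measurable_kval.
Qed.

Lemma ELlim_even N x : (0 < N)%N -> ELlim hs g bp N (- x) = ELlim hs g bp N x.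
Proof.
move=> N0.
have [_ c1] := cvg_EL HM bpB x N0; have [_ c2] := cvg_EL HM bpB (- x) N0.
suff E n : EL hs g bp n N (- x) = EL hs g bp n N x.
  by move: c2; under eq_fun do rewrite E; move=> c2; exact: (cvg_unique _ c2 c1).
have i1 y : rint P (fun w => lnZ (Em hs g bp n 0 0 (@ext_field R N y) w)).
  exact: (rint_lnZ_linE (gauss_Xem HM (@emb_domain n N 0 0)) (config0 N)).
have eE : @ext_field R N (- x) \o @flip N = @ext_field R N x.
  apply/funext => c; rewrite /ext_field /=.
  by under eq_bigr do rewrite spin_flip; rewrite sumrN mulrNN.
have i2 : rint P (fun w => lnZ (fun c => Em hs g bp n 0 0 (@ext_field R N (- x) \o @flip N) w (flip c))).
  by rewrite eE; under eq_fun do rewrite lnZ_flip; exact: i1.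
rewrite /EL (Em_flip_law (Phi := @lnZ R (config N)) _ (i1 (- x)) i2); last first.
  by move=> d' T' E mE; exact: measurable_lnZ.
by rewrite eE; apply: eq_Ex => w; exact: lnZ_flip.
Qed.

Lemma F_SK_even x : F_SK g bp (fun i w => - x + hs i w) = F_SK g bp (fun i w => x + hs i w).
Proof.
have c1 := @cvg_F_SK _ _ _ _ _ _ _ _ HM _ bpB x.
have c2 := @cvg_F_SK _ _ _ _ _ _ _ _ HM _ bpB (- x).
have E : (fun N => N%:R^-1 * ELlim hs g bp N (- x)) = (fun N => N%:R^-1 * ELlim hs g bp N x).
  by apply: eq_invn_mul => N N0; exact: ELlim_even.
have := cvg_lim (@Rhausdorff R) c2; rewrite E => <-.
exact: (cvg_lim (@Rhausdorff R) c1).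
Qed.

Variable b : R.
Hypothesis b0 : 0 < b.
Local Notation Eb N w := (Elim hs g bp (@mean_field R N b) w).
Local Notation W mu eps N w := (Wp hs g bp b mu eps N w).

Lemma measurable_av_gen N (f : config N -> R) d' (T' : measurableType d') (E : T' -> config N -> R) :
  (forall c, measurable_fun setT (E^~ c)) -> measurable_fun setT (fun w => av (E w) f).
Proof. by move=> mE; exact: measurable_av (config0 N) _. Qed.

Lemma measurable_Wp mu eps N : measurable_fun setT (fun w => W mu eps N w).
Proof. by apply: measurable_av_gen => c; exact: measurable_Elim. Qed.

(** The quadratic term is invariant under the flip, which exchanges the two windows; bounded
    convergence removes the truncation. *)
Lemma Wp_symmetric_law (phi : R -> R) (M : R) mu eps N : (0 < N)%N ->
  continuous phi -> (forall x, `|phi x| <= M) ->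
  Ex P (fun w => phi (W mu eps N w)) = Ex P (fun w => phi (W (- mu) eps N w)).
Proof.
move=> N0 cphi bphi.
have mphi : measurable_fun setT phi by exact: continuous_measurable_fun.
pose Phi x (E : config N -> R) := phi (av E (near_ind x eps)).
have mPhi x d' (T' : measurableType d') (E : T' -> config N -> R) :
    (forall c, measurable_fun setT (E^~ c)) -> measurable_fun setT (fun w => Phi x (E w)).
  by move=> mE; apply: (measurableT_comp mphi); exact: measurable_av_gen.
have lim x : Ex P (fun w => Phi x (Em hs g bp n 0 0 (@mean_field R N b) w)) @[n --> \oo] -->
    Ex P (fun w => Phi x (Eb N w)).
  have [] // := @cvg_Ex_lim _ _ _ _ _ _ _ _ HM _ bpB N (Phi x) (@mean_field R N b) M 0 N0.
  - exact: le_trans (bphi 0).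
  - exact: mPhi.
  - move=> En E EnE; apply: continuous_cvg; first exact: cphi.
    exact: (cvg_av (config0 N)).
  - by move=> E B _; rewrite mul0r addr0; exact: bphi.
have iPhi x n e : rint P (fun w => Phi x (Em hs g bp n 0 0 e w)).
  apply: (@rint_bnd _ _ _ _ _ M); last by move=> w; exact: bphi.
  by apply: mPhi => c; exact: measurable_Em.
have i2 n e : rint P (fun w => Phi mu (fun c => Em hs g bp n 0 0 e w (flip c))).
  apply: (@rint_bnd _ _ _ _ _ M); last by move=> w; exact: bphi.
  by apply: (mPhi mu _ _ (fun w c => Em hs g bp n 0 0 e w (flip c))) => c; exact: measurable_Em.
have eE : @mean_field R N b \o @flip N = @mean_field R N b.
  by apply/funext => c; rewrite /mean_field/= magnetization_flip sqrrN.
have E n : Ex P (fun w => Phi mu (Em hs g bp n 0 0 (@mean_field R N b) w)) =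
    Ex P (fun w => Phi (- mu) (Em hs g bp n 0 0 (@mean_field R N b) w)).
  rewrite (Em_flip_law (mPhi mu) (iPhi mu n _) (i2 n _)) eE; apply: eq_Ex => w.
  rewrite /Phi av_flip; congr phi; apply: eq_av => c; exact: near_ind_flip.
have c1 := lim mu; have c2 := lim (- mu).
rewrite -[LHS](cvg_lim (@Rhausdorff R) c1) -[RHS](cvg_lim (@Rhausdorff R) c2).
by congr (limn _); apply/funext => n; exact: E.
Qed.

Lemma magnetization_variance N : (0 < N)%N ->
  N%:R * s ^+ 2 * Ex P (fun w => cov (Eb N w) (@magnetization R N) (@magnetization R N)) <=
  Num.sqrt N%:R * (2 * expR L).
Proof.
move=> N0.
pose m := @magnetization R N.
have bm c : `|m c| <= 1 := normr_magnetization c.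
have mcov d' (T' : measurableType d') (E : T' -> config N -> R) :
    (forall c, measurable_fun setT (E^~ c)) -> measurable_fun setT (fun w => cov (E w) m m).
  move=> mE; apply: measurable_funB; first exact: measurable_av_gen.
  by apply: measurable_funM; exact: measurable_av_gen.
have bcov E : `|cov E m m| <= 2.
  by apply: le_trans (cov_bnd (config0 N) E bm bm) _; rewrite mulr1.
have [_ lim] : rint P (fun w => cov (Eb N w) m m) /\
    Ex P (fun w => cov (Em hs g bp n 0 0 (@mean_field R N b) w) m m) @[n --> \oo] -->
    Ex P (fun w => cov (Eb N w) m m).
  apply: (@cvg_Ex_lim _ _ _ _ _ _ _ _ HM _ bpB N (fun E => cov E m m) (@mean_field R N b) 2 0 N0) => //.
  - move=> En E EnE; apply: cvgB; first exact: (cvg_av (config0 N)).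
    by apply: cvgM; exact: (cvg_av (config0 N)).
  - by move=> E B _; rewrite mul0r addr0.
rewrite -/m.
have lim2 : N%:R * s ^+ 2 * Ex P (fun w => cov (Em hs g bp n 0 0 (@mean_field R N b) w) m m)
    @[n --> \oo] --> N%:R * s ^+ 2 * Ex P (fun w => cov (Eb N w) m m) by exact: cvgMr.
rewrite -(cvg_lim (@Rhausdorff R) lim2); apply: limr_le; first exact: cvgP lim2.
apply: nearW => n.
pose E w := Em hs g bp n 0 0 (@mean_field R N b) w.
have mE c : measurable_fun setT (E^~ c) by exact: measurable_Em.
have icov (f : config N -> R) M : (forall c, `|f c| <= M) -> rint P (fun w => cov (E w) m f).
  move=> fM; apply: (@rint_bnd _ _ _ _ _ (1 * M *+ 2)); last by move=> w; exact: (cov_bnd (config0 N)).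
  apply: measurable_funB; first exact: measurable_av_gen.
  by apply: measurable_funM; exact: measurable_av_gen.
have ibp (i : 'I_N) : Ex P (fun w => hs i w * av (E w) m) =
    s ^+ 2 * Ex P (fun w => cov (E w) m (fun c => spin c i)).
  exact: (@gauss_ibp_av _ _ _ P _ (fun k => X (emb 0 0 k)) _
    (findep_emb HM (@emb_inj n N 0 0) (@emb_domain n N 0 0))
    (fun k => disorder_gauss HM (emb_domain 0 0 k)) _ (config0 N) (@mean_field R N b)
    (@amodel R bp n N) m 1 (inr i) bm).
have covE w : \sum_(i < N) cov (E w) m (fun c => spin c i) = N%:R * cov (E w) m m.
  rewrite /cov sumrB -av_sum -mulr_sumr -av_sum mulrBr; congr (_ - _).
    rewrite -avZ; apply: eq_av => c; rewrite -mulr_sumr sum_spin; exact: mulrCA.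
  have -> : av (E w) (fun c => \sum_i spin c i) = N%:R * av (E w) m.
    by rewrite -avZ; apply: eq_av => c; exact: sum_spin.
  exact: mulrCA.
have ihs (i : 'I_N) : rint P (fun w => hs i w * av (E w) m).
  apply: (@rint_le _ _ _ _ _ (fun w => `|hs i w|)).
  - by apply: measurable_funM => //; exact: measurable_av_gen.
  - exact: (rint_gauss_abs (gauss_Xem HM (em := fun _ : unit => inl (i : nat)) (fun=> I)) tt).
  - by move=> w; rewrite normrM ler_piMr//; apply: (av_bnd (config0 N)).
have -> : N%:R * s ^+ 2 * Ex P (fun w => cov (E w) m m) =
    Ex P (fun w => (\sum_(i < N) 1 * hs i w) * av (E w) m).
  under [RHS]eq_Ex => w.
    rewrite mulr_suml; under eq_bigr do rewrite mul1r. over.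
  rewrite Ex_sum; last by move=> i _; exact: ihs.
  under [RHS]eq_bigr do rewrite ibp.
  rewrite -mulr_sumr -Ex_sum; last first.
    by move=> i _; apply: (icov _ 1) => c; rewrite normr_spin.
  under [in RHS]eq_Ex do rewrite covE.
  by rewrite ExZ ?(icov _ 1)// mulrA [_ * s ^+ 2]mulrC.
have v0 : 0 < Num.sqrt N%:R :> R by rewrite sqrtr_gt0 ltr0n.
pose em (i : 'I_N) : joint_index := inl (i : nat).
have iem : injective em by move=> i j [] /val_inj.
have a1 : \sum_(i < N) (1 : R) ^+ 2 <= Num.sqrt N%:R ^+ 2.
  by rewrite sqr_sqrtr// expr1n sumr_const card_ord.
have [iS bS] := Ex_abs_linear (disorder_L0 HM) (findep_emb HM iem (fun=> I))
  (fun k => disorder_subexp HM (j := em k) I)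
  (mean_Xem HM (em := em) (fun=> I)) v0 a1.
apply: le_trans bS; apply: Ex_le => //.
  rewrite (_ : (fun w => _) = (fun w => \sum_(i < N) hs i w * av (E w) m)).
    by apply: rint_sum => i _; exact: ihs.
  by apply/funext => w; rewrite mulr_suml; apply: eq_bigr => i _; rewrite mul1r.
move=> w; rewrite (le_trans (ler_norm _))// normrM ler_piMr//.
exact: (av_bnd (config0 N)).
Qed.

Lemma Wp_ge0 mu eps N w : 0 <= W mu eps N w.
Proof. by apply: av_ge0 => c; rewrite /near_ind. Qed.

Lemma Wp_le1 mu eps N w : W mu eps N w <= 1.
Proof.
apply: le_trans (ler_norm _) _; apply: (av_bnd (config0 N)) => c.
exact: near_ind_bnd.
Qed.

(** The Gibbs mean of [m] has a sign, hence is at distance at least [mu - eps] from the window on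
    the other side. The weight of that window times [(mu - eps) ^+ 2] is below the variance, and the
    other weight is at most 1. *)
Lemma Wp_product mu eps N w : 0 < eps < mu ->
  W mu eps N w * W (- mu) eps N w * (mu - eps) ^+ 2 <=
  cov (Eb N w) (@magnetization R N) (@magnetization R N).
Proof.
move=> /andP[e0 em]; set m := @magnetization R N; set E := Eb N w.
set a := av E m.
have -> : cov E m m = av E (fun c => (m c - a) ^+ 2).
  rewrite /cov -/a.
  have -> : (fun c => (m c - a) ^+ 2) =
      (fun c => (m c * m c + (- (2 * a)) * m c) + a ^+ 2).
    by apply/funext => c; ring.
  by rewrite !avD avZ (av_cst (config0 N)) -/a; ring.
have d0 : 0 <= mu - eps by rewrite subr_ge0 ltW.
have part x : (forall c, `|m c - x| <= eps -> (mu - eps) ^+ 2 <= (m c - a) ^+ 2) ->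
    W x eps N w * (mu - eps) ^+ 2 <= av E (fun c => (m c - a) ^+ 2).
  move=> h; rewrite mulrC /Wp -avZ; apply: (av_le (config0 N)) => c.
  rewrite /near_ind; have [hc|_] := leP `|m c - x| eps.
    by rewrite mulr1; exact: h.
  by rewrite mulr0 sqr_ge0.
have [a0|a0] := leP a 0.
  apply: le_trans (part mu _).
    rewrite ler_wpM2r ?sqr_ge0// ler_piMr ?Wp_ge0//; exact: Wp_le1.
  move=> c /ler_normlP[h1 h2]; rewrite lerXn2r ?nnegrE//; lra.
apply: le_trans (part (- mu) _).
  rewrite ler_wpM2r ?sqr_ge0// ler_piMl ?Wp_ge0//; exact: Wp_le1.
move=> c /ler_normlP[h1 h2]; rewrite -[leRHS]sqrrN lerXn2r ?nnegrE//; lra.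
Qed.

Lemma cvg_Ex_product mu eps : 0 < eps < mu -> s != 0 ->
  Ex P (fun w => W mu eps N w * W (- mu) eps N w) @[N --> \oo] --> (0 : R).
Proof.
move=> em s0; have /andP[e0 e1] := em.
have d0 : 0 < (mu - eps) ^+ 2 by rewrite exprn_gt0// subr_gt0.
have s2 : 0 < s ^+ 2 by rewrite lt0r sqr_ge0 expf_neq0.
pose C := 2 * expR L / (s ^+ 2 * (mu - eps) ^+ 2).
have bnd N : (0 < N)%N -> Ex P (fun w => W mu eps N w * W (- mu) eps N w) <=
    C * (Num.sqrt N%:R)^-1.
  move=> N0; have := magnetization_variance N0; set V := Ex P _ => hV.
  have q0 : 0 < Num.sqrt N%:R :> R by rewrite sqrtr_gt0 ltr0n.
  have iW : rint P (fun w => W mu eps N w * W (- mu) eps N w).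
    apply: (@rint_bnd _ _ _ _ _ 1).
      by apply: measurable_funM; exact: measurable_Wp.
    move=> w; rewrite ger0_norm; last by apply: mulr_ge0; exact: Wp_ge0.
    by apply: mulr_ile1; rewrite ?Wp_ge0 ?Wp_le1.
  have hW : Ex P (fun w => W mu eps N w * W (- mu) eps N w) * (mu - eps) ^+ 2 <= V.
    rewrite mulrC -ExZ//; apply: Ex_le; first exact: rintZ.
      apply: (@rint_bnd _ _ _ _ _ (1 * 1 *+ 2)); last first.
        by move=> w; apply: (cov_bnd (config0 N)) => c; exact: normr_magnetization.
      have mE c : measurable_fun setT (fun w => Eb N w c) by exact: measurable_Elim.
      apply: measurable_funB; first exact: measurable_av_gen.
      by apply: measurable_funM; exact: measurable_av_gen.
    by move=> w; rewrite mulrC; exact: Wp_product.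
  have qE := sqr_sqrtr (ler0n R N).
  move: hW hV; rewrite -{1}qE /C {qE iW}.
  move: (Num.sqrt _) q0 (Ex P _) V => q q0 x v hx hv.
  rewrite -ler_pdivlMr in hx; last exact: d0.
  apply: (le_trans hx).
  have hv' : v <= 2 * expR L / (q * s ^+ 2).
    have qs : 0 < q * s ^+ 2 by exact: mulr_gt0.
    rewrite (ler_pdivlMr _ _ qs) -(ler_pM2l q0); apply: le_trans hv.
    by rewrite le_eqVlt; apply/orP; left; apply/eqP; ring.
  apply: (le_trans (ler_wpM2r _ hv')); first by rewrite invr_ge0 ltW.
  rewrite le_eqVlt; apply/orP; left; apply/eqP.
  by move: ((mu - eps) ^+ 2) (s ^+ 2) d0 s2 => x1 x2 x10 x20; field; rewrite !gt_eqF.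
have c0 : C * (Num.sqrt N%:R)^-1 @[N --> \oo] --> (0 : R).
  rewrite -(mulr0 C); apply: cvgMr.
  apply/cvgrPdist_lt => e e0'; near=> N.
  have N0 : (0 < N)%N by near: N; exists 1%N.
  have q0 : 0 < Num.sqrt N%:R :> R by rewrite sqrtr_gt0 ltr0n.
  rewrite sub0r normrN ger0_norm ?invr_ge0 ?ltW//.
  rewrite invf_plt ?posrE// -(ltr_sqr (x := e^-1)) ?nnegrE ?invr_ge0 ?ltW// sqr_sqrtr//.
  near: N; exact: nbhs_infty_gtr.
apply: (@squeeze_cvgr _ _ _ _ (cst 0) (fun N : nat => C * (Num.sqrt N%:R)^-1)) => //; last exact: cvg_cst.
exists 1%N => // N /= N0; rewrite bnd// andbT; apply: Ex_ge0 => w.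
by apply: mulr_ge0; exact: Wp_ge0.
Unshelve. all: by end_near.
Qed.

End symmetry.

(* If [x + y = 1] and [x * y = 0] then [{x, y} = {0, 1}]; quantitatively: *)
Lemma two_point_estimate {R : realType} (phi : R -> R) (M eta : R) :
  continuous phi -> (forall x, `|phi x| <= M) -> 0 < eta ->
  exists2 k : R, 0 <= k & forall x y, 0 <= x <= 1 -> 0 <= y <= 1 ->
    `|phi x + phi y - (phi 0 + phi 1)| <= eta + k * (`|1 - (x + y)| + x * y).
Proof.
move=> cphi bphi eta0.
have M0 : 0 <= M := le_trans (normr_ge0 _) (bphi 0).
have eta2 : 0 < eta / 2 by rewrite divr_gt0.
have cont z : exists2 dd : R, 0 < dd & forall x, `|z - x| < dd -> `|phi z - phi x| < eta / 2.
  have /cvgrPdist_lt/(_ _ eta2) := cphi z => /nbhs_ballP[dd /= dd0 h].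
  by exists dd => // x zx; exact: h.
have [d0 d00 h0] := cont 0; have [d1 d10 h1] := cont 1.
pose dd := Num.min (Num.min d0 d1) 1.
have dd0 : 0 < dd by rewrite !lt_min d00 d10 ltr01.
have dd1 : dd <= 1 by rewrite ge_min lexx orbT.
have ddd0 : dd <= d0 by rewrite !ge_min lexx.
have ddd1 : dd <= d1 by rewrite !ge_min lexx orbT.
(* If the defect [q] is at least [dd / 6], the second term already exceeds the trivial bound
   [4 * M]. *)
exists (4 * M * (6 / dd)); first by rewrite !mulr_ge0// ?invr_ge0 ltW.
move=> x y x01 y01; set q := `|_| + _.
have q0 : 0 <= q.
  by rewrite addr_ge0// mulr_ge0//; [case/andP: x01|case/andP: y01].
have k0 : 0 <= 4 * M * (6 / dd) * q.
  by rewrite !mulr_ge0// ?invr_ge0 ltW.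
have [qs|qb] := ltP q (dd / 6); last first.
  apply: (@le_trans _ _ (4 * M)).
    have := bphi x; have := bphi y; have := bphi 0; have := bphi 1.
    by rewrite !ler_norml => /andP[? ?] /andP[? ?] /andP[? ?] /andP[? ?]; apply/andP; split; lra.
  rewrite -[leLHS]add0r lerD ?(ltW eta0)// -mulrA ler_peMr ?mulr_ge0//.
  by rewrite mulrAC ler_pdivlMr// mul1r mulrC -ler_pdivrMr.
wlog xy : x y x01 y01 @q q0 k0 qs / y <= x.
  move=> H; have [yx|xy] := leP y x; first exact: H.
  have qE : q = `|1 - (y + x)| + y * x by rewrite /q addrC [x + y]addrC [x * y]mulrC addrC.
  rewrite [phi x + _]addrC qE; apply: H => //; rewrite -?qE//; exact: ltW.
have s1 : `|1 - (x + y)| <= q by rewrite /q lerDl mulr_ge0//; [case/andP: x01|case/andP: y01].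
have s2 : x * y <= q by rewrite /q lerDr.
have qs' : q < 1 / 6 by apply: lt_le_trans qs _; rewrite ler_wpM2r// invr_ge0.
move: s1; rewrite ler_norml => /andP[s11 s12].
(* For [q < 1/6] the larger number is at least 1/4, so [x * y <= q] gives [y <= 4 q], and then
   [1 - x <= 5 q]. Both are below [dd] since [q < dd / 6]. *)
have y4 : y <= 4 * q.
  have x4 : 4^-1 <= x by lra.
  case/andP: y01 => y0 _.
  have : 4^-1 * y <= q by apply: le_trans s2; rewrite ler_wpM2r.
  by lra.
have a0 : `|phi 0 - phi y| < eta / 2.
  by apply: h0; rewrite sub0r normrN ger0_norm; [lra|case/andP: y01].
have a1 : `|phi 1 - phi x| < eta / 2.
  by apply: h1; rewrite ger0_norm; [lra|rewrite subr_ge0; case/andP: x01].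
move: a0 a1; rewrite !ltr_norml => /andP[? ?] /andP[? ?].
rewrite ler_norml; apply/andP; split; lra.
Qed.

(** * Limits of the Gibbs weights of the two peaks *)

Section conclusion.
Context {d : measure_display} {T : measurableType d} {R : realType}.
Variable P : probability T R.
Variables (hs : nat -> {RV P >-> R}) (g : disorder P) (s L : R).
Hypothesis HM : gaussian_disorder hs g s L.
Variable bp : nat -> R.
Hypothesis bpB : cvgn (fun n => \sum_(1 <= p < n) 2 ^+ p * bp p ^+ 2).
Variable b : R.
Hypothesis b0 : 0 < b.
Local Notation F x := (F_SK g bp (fun i w => x + hs i w)).
Local Notation Eb N w := (Elim hs g bp (@mean_field R N b) w).
Local Notation W mu eps N w := (Wp hs g bp b mu eps N w).
Variables (mu eps : R).
Hypothesis em : 0 < eps < mu.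
Hypothesis unique_peaks : forall q, -1 <= q <= 1 -> q != mu -> q != - mu ->
    F (b * q) - b * q ^+ 2 / 2 < F (b * mu) - b * mu ^+ 2 / 2.

Lemma cvg_half_of_symmetric (x : R) : x = mu \/ x = - mu ->
  (forall i, {ae P, forall w, hs i w = 0}) ->
  {ae P, forall w, W x eps N w @[N --> \oo] --> (2^-1 : R)}.
Proof.
move=> xmu h0; have := cvg_two_peaks HM bpB b0 em unique_peaks.
apply: filterS2 (ae_foralln h0) => w hw cw.
have WE N : W (- mu) eps N w = W mu eps N w.
  have EbE : (fun c => Eb N w (flip c)) = Eb N w.
    apply/funext => c; rewrite /Elim /mean_field magnetization_flip sqrrN.
    congr (_ + _ + _); last first.
      by rewrite /field !big1// => i _; rewrite hw mul0r.
    rewrite /H_SK; congr (limn _); apply/funext => n; apply: eq_bigr => p _.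
    congr (_ * _); apply: eq_bigr => t _; congr (_ * _); exact: prod_spin_flip.
  rewrite /Wp -{2}EbE av_flip; apply: eq_av => c; rewrite near_ind_flip//.
have W2 N : W x eps N w = 2^-1 * (W mu eps N w + W (- mu) eps N w).
  by case: xmu => ->; rewrite ?WE; lra.
have -> : (fun N => W x eps N w) = (fun N => 2^-1 * (W mu eps N w + W (- mu) eps N w)).
  exact/funext.
by rewrite -[X in _ --> X]mulr1; exact: cvgMr.
Qed.

(** As both weights have the same law, the expectation is half of that of the symmetric sum, which
    [two_point_estimate] compares with [phi 0 + phi 1]. The error is governed by the means of
    [|1 - (W+ + W-)|] and of [W+ W-], both vanishing. *)
Lemma cvg_Ex_half (phi : R -> R) (M : R) (x : R) : x = mu \/ x = - mu -> s != 0 ->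
  continuous phi -> (forall x, `|phi x| <= M) ->
  Ex P (fun w => phi (W x eps N w)) @[N --> \oo] --> 2^-1 * (phi 1 + phi 0).
Proof.
move=> xmu s0 cphi bphi.
have mphi : measurable_fun setT phi by exact: continuous_measurable_fun.
have mW y N : measurable_fun setT (fun w => W y eps N w) by exact: measurable_Wp.
have mphiW y N : measurable_fun setT (fun w => phi (W y eps N w)).
  exact: (measurableT_comp mphi (mW y N)).
have iphi y N : rint P (fun w => phi (W y eps N w)).
  by apply: (@rint_bnd _ _ _ _ _ M).
pose S N w : R := W mu eps N w + W (- mu) eps N w.
have mS N : measurable_fun setT (S N) by exact: measurable_funD.
have W01 y N w : 0 <= W y eps N w <= 1 by rewrite Wp_ge0 Wp_le1.
pose D N := Ex P (fun w => `|1 - S N w|).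
have mD N : measurable_fun setT (fun w => `|1 - S N w|).
  by apply: measurableT_comp => //; exact: measurable_funB.
have bD N w : `|1 - S N w| <= 1.
  have := W01 mu N w; have := W01 (- mu) N w; rewrite /S ler_norml.
  by move=> /andP[? ?] /andP[? ?]; apply/andP; split; lra.
have iD N : rint P (fun w => `|1 - S N w|).
  by apply: (@rint_bnd _ _ _ _ _ 1) => // w; rewrite normr_id.
have cD : D N @[N --> \oo] --> (0 : R).
  rewrite /D -(Ex_cst P 0); apply: (Ex_dominated mD _ (rint_cst P 1)) => //.
    have := cvg_two_peaks HM bpB b0 em unique_peaks; apply: filterS => w h.
    have hn : `|1 - S N w| @[N --> \oo] --> `|1 - 1 : R|.
      by apply: cvg_norm; apply: cvgB => //; exact: cvg_cst.
    by move: hn; rewrite subrr normr0.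
  by apply: aeW => w N; rewrite normr_id.
pose V N := Ex P (fun w => W mu eps N w * W (- mu) eps N w).
have cV : V N @[N --> \oo] --> (0 : R) := cvg_Ex_product HM bpB b em s0.
have iV N : rint P (fun w => W mu eps N w * W (- mu) eps N w).
  apply: (@rint_bnd _ _ _ _ _ 1); first exact: measurable_funM.
  move=> w; rewrite ger0_norm; last by apply: mulr_ge0; exact: Wp_ge0.
  by apply: mulr_ile1; rewrite ?Wp_ge0 ?Wp_le1.
have sym N : (0 < N)%N -> Ex P (fun w => phi (W x eps N w)) =
    2^-1 * Ex P (fun w => phi (W mu eps N w) + phi (W (- mu) eps N w)).
  move=> N0; rewrite ExD//.
  have E := Wp_symmetric_law HM bpB b mu eps N0 cphi bphi.
  by case: xmu => ->; rewrite E; lra.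
apply/cvgrPdist_le => e e0; have e1 : 0 < e / 2 by rewrite divr_gt0.
have [k k0 hk] := two_point_estimate cphi bphi e1.
have bound N : (0 < N)%N -> `|2^-1 * (phi 1 + phi 0) - Ex P (fun w => phi (W x eps N w))|
    <= e / 2 + k * (D N + V N).
  move=> N0; rewrite (sym N N0) -mulrBr normrM ger0_norm// distrC.
  set A := `|_ - _|; suff : A <= e / 2 + k * (D N + V N).
    by apply: le_trans; rewrite ler_piMl ?normr_ge0// invf_le1// ler1n.
  have i3 : rint P (fun w => phi (W mu eps N w) + phi (W (- mu) eps N w) - (phi 0 + phi 1)).
    by apply: rintB; [exact: rintD|exact: rint_cst].
  have -> : A = `|Ex P (fun w => phi (W mu eps N w) + phi (W (- mu) eps N w) - (phi 0 + phi 1))|.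
    rewrite /A [phi 1 + _]addrC ExB ?Ex_cst//; [exact: rintD|exact: rint_cst].
  apply: (le_trans (normr_Ex i3)).
  have i4 : rint P (fun w => e / 2 + k * (`|1 - S N w| + W mu eps N w * W (- mu) eps N w)).
    by apply: rintD; [exact: rint_cst|apply: rintZ; exact: rintD].
  apply: (@le_trans _ _ (Ex P (fun w => e / 2 + k * (`|1 - S N w| + W mu eps N w * W (- mu) eps N w)))).
    by apply: Ex_le => //; [exact: rint_norm|move=> w; exact: hk].
  rewrite ExD ?Ex_cst ?ExZ ?ExD//; [exact: rintD|exact: rint_cst|].
  by apply: rintZ; exact: rintD.
have c0 : k * (D N + V N) @[N --> \oo] --> (0 : R).
  by rewrite -(mulr0 k); apply: cvgMr; exact: cvgD0.
near=> N; apply: (le_trans (bound N _)); first by near: N; exists 1%N.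
rewrite [leRHS]splitr lerD2l (le_trans (ler_norm _))// -normrN -sub0r.
by near: N; exact: (cvgrPdist_le _ _).1.
Unshelve. all: by end_near.
Qed.

End conclusion.

(** * The random-field Curie-Weiss model *)

Section hyperbolic.
Context {R : realType}.
Implicit Type x : R.

Definition sinh x : R := (expR x - expR (- x)) / 2.
Definition tanh x : R := sinh x / cosh x.
Definition sech2 x : R := (cosh x ^+ 2)^-1.

Lemma cosh_sqr x : cosh x ^+ 2 - sinh x ^+ 2 = 1.
Proof.
have e1 : expR x * expR (- x) = 1 by rewrite -expRD subrr expR0.
rewrite /cosh /sinh; transitivity (expR x * expR (- x)) => //.
by move: (expR x) (expR (- x)) => u v; field.
Qed.

Lemma cosh_even x : cosh (- x) = cosh x.
Proof. by rewrite /cosh opprK addrC. Qed.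

Lemma sinh_odd x : sinh (- x) = - sinh x.
Proof. by rewrite /sinh opprK; lra. Qed.

Lemma tanh_odd x : tanh (- x) = - tanh x.
Proof. by rewrite /tanh cosh_even sinh_odd mulNr. Qed.

Lemma sinh_gt0 x : 0 < x -> 0 < sinh x.
Proof. by move=> x0; rewrite /sinh divr_gt0// subr_gt0 ltr_expR; lra. Qed.

Lemma cosh_ge1 x : 1 <= cosh x.
Proof.
rewrite /cosh ler_pdivlMr// mul1r.
by have := expR_ge1Dx x; have := expR_ge1Dx (- x); lra.
Qed.

Lemma sech2_bounds x : 0 <= sech2 x <= 1.
Proof.
rewrite /sech2 invr_ge0 sqr_ge0/= invf_le1 ?exprn_gt0 ?cosh_gt0//.
by rewrite exprn_ege1 ?cosh_ge1.
Qed.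

Lemma tanh_le1 x : `|tanh x| <= 1.
Proof.
rewrite /tanh normrM normfV (gtr0_norm (cosh_gt0 x)) ler_pdivrMr ?cosh_gt0// mul1r.
rewrite ler_norml /sinh /cosh; have := expR_gt0 x; have := expR_gt0 (- x) => ? ?.
by apply/andP; split; lra.
Qed.

Lemma cosh_lt x r : 0 < x -> 0 < r -> cosh (x - r) < cosh (x + r).
Proof.
move=> x0 r0; rewrite -subr_gt0.
have -> : cosh (x + r) - cosh (x - r) = 2 * sinh x * sinh r.
  rewrite /cosh /sinh !opprD opprK !expRD.
  by move: (expR x) (expR (- x)) (expR r) (expR (- r)) => u v w z; field.
by apply: mulr_gt0; [apply: mulr_gt0|]; rewrite ?sinh_gt0.
Qed.

Lemma sech2_gt x r : 0 < x -> 0 < r -> sech2 (x + r) < sech2 (x - r).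
Proof.
move=> x0 r0; rewrite /sech2 ltf_pV2 ?posrE ?exprn_gt0 ?cosh_gt0//.
by rewrite ltrXn2r ?nnegrE ?ltW ?cosh_gt0//; exact: cosh_lt.
Qed.

Lemma is_derive_cosh x : is_derive x 1 (@cosh R) (sinh x).
Proof.
rewrite (_ : @cosh R = fun x : R => 2^-1 * (expR x + expR (- x))); last first.
  by apply/funext => y; rewrite /cosh mulrC.
by apply: is_derive_eq; rewrite /GRing.scale/= /sinh; lra.
Qed.

Lemma is_derive_sinh x : is_derive x 1 sinh (cosh x).
Proof.
rewrite (_ : sinh = fun x : R => 2^-1 * (expR x - expR (- x))); last first.
  by apply/funext => y; rewrite /sinh mulrC.
by apply: is_derive_eq; rewrite /GRing.scale/= /cosh; lra.
Qed.

Lemma is_derive_lncosh x : is_derive x 1 (fun x => ln (cosh x)) (tanh x).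
Proof.
have h1 := is_derive_cosh x.
have h2 := is_derive1_ln (cosh_gt0 x).
have := is_derive1_comp h2 h1.
by rewrite /tanh mulrC; exact.
Qed.

Lemma is_derive_tanh x : is_derive x 1 tanh (sech2 x).
Proof.
have h1 := is_derive_cosh x; have h2 := is_derive_sinh x.
have c0 : cosh x != 0 by rewrite gt_eqF// cosh_gt0.
have h3 := is_deriveV c0 h1.
have h4 := is_deriveM h2 h3.
have -> : tanh = (sinh \* (fun x => (cosh x)^-1))%R by [].
apply: is_derive_eq; rewrite /GRing.scale/= /sech2.
have := cosh_sqr x; move: (cosh x) (sinh x) c0 => u v u0 uv.
by rewrite -[X in _ = X]mul1r -uv; field.
Qed.

End hyperbolic.

Lemma lt_of_derive {R : realType} (f df : R -> R) (a b : R) : a < b ->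
  (forall t : R, is_derive t 1 f (df t)) -> (forall t, a < t < b -> 0 < df t) ->
  f a < f b.
Proof.
move=> ab fd df0.
have cf : continuous f.
  by move=> t; apply/differentiable_continuous/derivable1_diffP; exact: ex_derive.
have [c + fE] := @MVT R f df a b ab (fun x _ => fd x) (continuous_subspaceT cf).
by rewrite in_itv/= => cab; rewrite -subr_gt0 fE mulr_gt0 ?subr_gt0 ?df0.
Qed.

(** * Concavity of the averaged hyperbolic tangent and the mean-field equation *)

Section shifted_expectations.
Context {R : realType}.
Variables (nu : probability R R) (s : R).
Hypothesis gnu : gauss_law nu s.

Lemma is_derive_Ex_shift (psi psi' : R -> R) (C t : R) :
  (forall x : R, is_derive x 1 psi (psi' x)) -> (forall x, `|psi' x| <= C) ->
  (forall t : R, rint nu (fun y => psi (t + y))) ->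
  is_derive t 1 (fun t => Ex nu (fun y => psi (t + y))) (Ex nu (fun y => psi' (t + y))).
Proof.
move=> dpsi bpsi ipsi.
pose f (t : R) (y : R) : R := psi (t + y).
have df (t' y : R) : is_derive t' 1 (f ^~ y) (psi' (t' + y)).
  have h1 : is_derive t' 1 (fun t : R => t + y) 1.
    by apply: is_derive_eq; rewrite addr0.
  by have := @is_derive1_comp R psi (fun t : R => t + y) t' _ _ (dpsi (t' + y)) h1; rewrite mulr1.
have d1E (t' y : R) : partial1of2 f t' y = psi' (t' + y).
  by rewrite /partial1of2 derive1E; exact: derive_val.
have It : (`]t - 1, t + 1[%classic : set R) t.
  by rewrite /= in_itv/= gtrBl ltr01 ltrDl ltr01.
have intf t' : (`]t - 1, t + 1[%classic : set R) t' -> rint nu (f t') by move=> _; exact: ipsi.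
have derf t' (y : R) : (`]t - 1, t + 1[%classic : set R) t' -> setT y -> derivable (f ^~ y) t' 1.
  by move=> _ _; exact: ex_derive.
have Gub t' (y : R) : (`]t - 1, t + 1[%classic : set R) t' -> setT y ->
    `|partial1of2 f t' y| <= (fun _ : R => C) y.
  by move=> _ _; rewrite d1E.
have C0 (y : R) : 0 <= (fun _ : R => C) y := le_trans (normr_ge0 _) (bpsi y).
have dif := derivable_under_integral measurableT It intf derf C0 (rint_cst nu C) Gub.
have val := differentiation_under_integral measurableT It intf derf C0 (rint_cst nu C) Gub.
apply: DeriveDef => //; rewrite -derive1E val.
by under eq_Rintegral => y _ do rewrite d1E.
Qed.

Lemma Ex_opp (f : R -> R) : measurable_fun setT f -> rint nu f ->
  rint nu (fun y => f (- y)) -> Ex nu (fun y => f (- y)) = Ex nu f.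
Proof.
move=> mf i1 i2.
have ind (Y : unit -> R -> R) : findep nu Y.
  move=> A mA; rewrite (bigD1 tt)//= big1 ?mule1; last by case.
  by congr (nu _); apply/seteqP; split=> [w h|w h []//]; exact: h.
apply/esym; apply: (@law_ExK _ _ _ nu unit (fun _ y => y) (fun _ y => - y) (fun x => f (x tt))) => //.
- by move=> _; exact: measurable_funN.
- by move=> _ A mA; exact/esym/(gauss_sym gnu).
- by apply: (measurableT_comp mf); exact: measurable_kval.
Qed.

Definition ell (t : R) : R := Ex nu (fun y => ln (cosh (t + y))).
Definition gth (t : R) : R := Ex nu (fun y => tanh (t + y)).
Definition dgth (t : R) : R := Ex nu (fun y => sech2 (t + y)).

Let continuous_derive (f df : R -> R) : (forall x : R, is_derive x 1 f (df x)) -> continuous f.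
Proof.
by move=> fd t; apply/differentiable_continuous/derivable1_diffP; exact: ex_derive.
Qed.

Lemma continuous_tanh : continuous (@tanh R).
Proof. exact: continuous_derive (@is_derive_tanh R). Qed.

Lemma continuous_sech2 : continuous (@sech2 R).
Proof.
move=> x; rewrite /sech2; apply: cvgV; first by rewrite expf_neq0// gt_eqF// cosh_gt0.
by under eq_fun do rewrite expr2; rewrite expr2; apply: cvgM;
  exact: (continuous_derive (@is_derive_cosh R)).
Qed.

Let mshift (f : R -> R) t : measurable_fun setT f -> measurable_fun setT (fun y : R => f (t + y)).
Proof. by move=> mf; apply: (measurableT_comp mf); exact: measurable_funD. Qed.

Lemma rint_lncosh_shift t : rint nu (fun y => ln (cosh (t + y))).
Proof.
apply: (@rint_le _ _ _ _ _ (fun y : R => `|t| + `|y|)).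
- exact: (mshift t measurable_lncosh).
- by apply: rintD; [exact: rint_cst|exact: (rint_abs (gauss_exp gnu))].
- move=> y; rewrite ger0_norm ?lncosh_ge0// (le_trans (lncosh_le _))//.
  exact: ler_normD.
Qed.

Lemma rint_tanh_shift t : rint nu (fun y => tanh (t + y)).
Proof.
apply: (@rint_bnd _ _ _ _ _ 1); last by move=> y; exact: tanh_le1.
apply: mshift; exact: continuous_measurable_fun continuous_tanh.
Qed.

Lemma normr_sech2 x : `|sech2 x : R| <= 1.
Proof. by have /andP[h0 h1] := sech2_bounds x; rewrite ger0_norm. Qed.

Lemma rint_sech2_shift t : rint nu (fun y => sech2 (t + y)).
Proof.
apply: (@rint_bnd _ _ _ _ _ 1); last by move=> y; exact: normr_sech2.
apply: mshift; exact: continuous_measurable_fun continuous_sech2.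
Qed.

Lemma is_derive_ell (t : R) : is_derive t 1 ell (gth t).
Proof.
exact: (is_derive_Ex_shift t (@is_derive_lncosh R) (@tanh_le1 R) rint_lncosh_shift).
Qed.

Lemma is_derive_gth (t : R) : is_derive t 1 gth (dgth t).
Proof.
exact: (is_derive_Ex_shift t (@is_derive_tanh R) normr_sech2 rint_tanh_shift).
Qed.

Lemma dgth_decr a b : 0 <= a -> a < b -> dgth b < dgth a.
Proof.
(* Around the midpoint [c], the difference of the two integrands becomes [psi (c + y)] with [psi]
   odd and positive on the positive axis, the situation of [gauss_odd]. *)
move=> a0 ab; pose r := (b - a) / 2; pose c := (a + b) / 2.
have r0 : 0 < r by rewrite divr_gt0// subr_gt0.
have c0 : 0 < c by rewrite divr_gt0//; lra.
pose psi (x : R) : R := sech2 (x - r) - sech2 (x + r).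
have cpsi : continuous psi.
  move=> x; apply: cvgB.
    apply: (@continuous_comp _ _ _ (fun x : R => x - r)); last exact: continuous_sech2.
    by apply: cvgB; [exact: cvg_id|exact: cvg_cst].
  apply: (@continuous_comp _ _ _ (fun x : R => x + r)); last exact: continuous_sech2.
  by apply: cvgD; [exact: cvg_id|exact: cvg_cst].
have bpsi x : `|psi x| <= 2.
  rewrite (le_trans (ler_normB _ _))// (_ : (2 : R) = 1 + 1)// lerD//; exact: normr_sech2.
have opsi x : psi (- x) = - psi x.
  rewrite /psi -opprD /sech2 cosh_even -[- x + r]opprK opprD opprK cosh_even.
  by rewrite opprB.
have ppsi x : 0 < x -> 0 < psi x by move=> x0; rewrite subr_gt0 sech2_gt.
have := gauss_odd gnu cpsi bpsi opsi ppsi c0.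
have -> : (fun x => psi (c + x)) = fun y => sech2 (a + y) - sech2 (b + y).
  by apply/funext => y; rewrite /psi /c /r; congr (sech2 _ - sech2 _); lra.
by rewrite ExB ?subr_gt0//; exact: rint_sech2_shift.
Qed.

Lemma dgth_ge0 t : 0 <= dgth t.
Proof. by apply: Ex_ge0 => y; have /andP[] := sech2_bounds (t + y). Qed.

Lemma dgth_gt0 t : 0 <= t -> 0 < dgth t.
Proof.
move=> t0; apply: (le_lt_trans (dgth_ge0 (t + 1))); apply: dgth_decr => //.
by rewrite ltrDl.
Qed.

Lemma gth_nondecr a b : a <= b -> gth a <= gth b.
Proof.
by move=> ab; apply: (le_of_derive ab is_derive_gth) => t _; exact: dgth_ge0.
Qed.

Lemma gth0 : gth 0 = 0.
Proof.
have E : (fun y : R => tanh (0 + y)) = @tanh R by apply/funext => y; rewrite add0r.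
have i0 : rint nu (@tanh R) by rewrite -E; exact: rint_tanh_shift.
have mt : measurable_fun setT (@tanh R) by exact: continuous_measurable_fun continuous_tanh.
have i1 : rint nu (fun y => tanh (- y)).
  by under eq_fun do rewrite tanh_odd; exact: rintN.
have := Ex_opp mt i0 i1; under eq_Ex do rewrite tanh_odd.
rewrite ExN// /gth E; lra.
Qed.

Lemma gth_MVT a b : a < b -> exists2 c, a < c < b & gth b - gth a = dgth c * (b - a).
Proof.
move=> ab.
have [c + fE] := @MVT R gth dgth a b ab (fun x _ => is_derive_gth x)
  (continuous_subspaceT (continuous_derive is_derive_gth)).
by rewrite in_itv/= => cab; exists c.
Qed.

(** [gth] is strictly concave on the positive axis and vanishes at 0, so [gth t / t] decreases
    strictly; stated without division. *)
Lemma gth_ratio_decr a b : 0 < a -> a < b -> a * gth b < b * gth a.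
Proof.
move=> a0 ab.
have [c1 /andP[c10 c1a]] := gth_MVT a0; rewrite gth0 !subr0 => g1.
have [c2 /andP[c2a c2b] g2] := gth_MVT ab.
have c12 : dgth c2 < dgth c1 by apply: dgth_decr; [exact: ltW|lra].
have -> : gth b = gth a + dgth c2 * (b - a) by rewrite -g2 subrKC.
rewrite g1; move: (dgth c1) (dgth c2) c12 => x y xy.
rewrite -subr_gt0.
have -> : b * (x * a) - a * (x * a + y * (b - a)) = a * (b - a) * (x - y) by ring.
by rewrite !mulr_gt0 ?subr_gt0.
Qed.

Lemma gth_lt_tangent t : 0 < t -> gth t < t * dgth 0.
Proof.
move=> t0; have [c /andP[c0 ct]] := gth_MVT t0; rewrite gth0 !subr0 => ->.
by rewrite mulrC ltr_pM2l// dgth_decr.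
Qed.

(** Intermediate values between [gth 0 = 0] and an explicit point where [tanh x >= 1 - 2 e^(-2x)]
    forces [gth] above [u]. *)
Lemma gth_surj u : 0 < u < 1 -> exists2 t, 0 < t & gth t = u.
Proof.
move=> /andP[u0 u1].
pose C := Ex nu (fun y => expR (- 2 * y)).
have C0 : 0 <= C by apply: Ex_ge0 => y; exact: expR_ge0.
have iC : rint nu (fun y => expR (- 2 * y)) := gauss_exp gnu (- 2).
have tanh_ge x : 1 - 2 * expR (- 2 * x) <= tanh x :> R.
  rewrite /tanh ler_pdivlMr ?cosh_gt0// /cosh /sinh.
  have e1 : expR x * expR (- x) = 1 by rewrite -expRD subrr expR0.
  have -> : expR (- 2 * x) = expR (- x) * expR (- x) by rewrite -expRD; congr expR; ring.
  have := expR_gt0 (- x); move: (expR x) (expR (- x)) e1 => v w vw w0.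
  have : 0 < w * w * w by rewrite !mulr_gt0.
  have -> : (1 - 2 * (w * w)) * ((v + w) / 2) = (v + w) / 2 - w * (v * w) - w * w * w by field.
  by rewrite vw; lra.
(* It makes [2 * C * expR (- 2 * t1)] at most [1 - u], because [2 t e^(-2t) <= 1]. *)
pose t1 := C / (1 - u).
have t10 : 0 <= t1 by rewrite divr_ge0// subr_ge0 ltW.
have g1 : u <= gth t1.
  have : 1 - 2 * (expR (- 2 * t1) * C) <= gth t1.
    rewrite -ExZ// -ExZ; last exact: rintZ.
    rewrite -{1}(Ex_cst nu 1) -ExB; [|exact: rint_cst|exact/rintZ/rintZ].
    apply: Ex_le; [apply: rintB; [exact: rint_cst|exact/rintZ/rintZ]|exact: rint_tanh_shift|].
    by move=> y; rewrite -expRD -mulrDr; exact: tanh_ge.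
  apply: le_trans; rewrite lerBrDr -lerBrDl.
  have h : expR (- 2 * t1) * (1 + 2 * t1) <= 1.
    rewrite mulNr expRN mulrC ler_pdivrMr ?expR_gt0// mul1r; exact: expR_ge1Dx.
  have CE : C = t1 * (1 - u) by rewrite /t1 divfK// subr_eq0 eq_sym lt_eqF.
  rewrite CE mulrA.
  have -> : 2 * expR (- 2 * t1) * (t1 * (1 - u)) = (expR (- 2 * t1) * (2 * t1)) * (1 - u) by ring.
  rewrite ler_piMl ?subr_ge0 ?ltW//; move: h; rewrite mulrDr mulr1.
  by have := expR_gt0 (- 2 * t1); lra.
have [] := @IVT R gth 0 t1 u t10.
- exact: continuous_subspaceT (continuous_derive is_derive_gth).
- by rewrite gth0 ge_min le_max (ltW u0) g1 orbT.
move=> t; rewrite in_itv/= => /andP[t0 _] gt; exists t => //.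
by rewrite lt_neqAle t0 andbT; apply: contraTneq u0 => t0'; rewrite -gt -t0' gth0 ltxx.
Qed.

Definition fCW (x b : R) : R := ln 2 + ell (b * x) - b * x ^+ 2 / 2.

Lemma is_derive_fCW b (x : R) : is_derive x 1 (fCW^~ b) (b * (gth (b * x) - x)).
Proof.
have h1 : is_derive x 1 (fun x : R => b * x) b.
  by apply: is_derive_eq; rewrite /GRing.scale/= mulr1.
have h2 := @is_derive1_comp R ell (fun x : R => b * x) x _ _ (is_derive_ell (b * x)) h1.
have h3 : is_derive x 1 (fun x : R => b * x ^+ 2 / 2) (b * x).
  rewrite (_ : (fun x : R => b * x ^+ 2 / 2) = (fun x : R => (b / 2) * x ^+ 2)); last first.
    by apply/funext => y; rewrite mulrAC.
  by apply: is_derive_eq; rewrite /GRing.scale/=; lra.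
have h4 := is_deriveB (is_deriveD (is_derive_cst (ln 2) x 1) h2) h3.
by rewrite add0r mulrC -mulrBr in h4.
Qed.

(** At inverse temperature [b = t / u] the point [u] solves [gth (b u) = u]. The derivative
    [b (gth (b x) - x)] is positive before [u] and negative after, by [gth_ratio_decr]. *)
Lemma fCW_argmax u t : 0 < u < 1 -> 0 < t -> gth t = u ->
  forall x, 0 <= x <= 1 -> x != u -> fCW x (t / u) < fCW u (t / u).
Proof.
move=> /andP[u0 u1] t0 gt x /andP[x0 x1] xu; set b := t / u.
have b0 : 0 < b by rewrite divr_gt0.
have bu : b * u = t by rewrite /b divfK// gt_eqF.
have [xltu|ultx|xeq] := ltgtP x u; last by rewrite xeq eqxx in xu.
  apply: (lt_of_derive xltu (is_derive_fCW b)) => z /andP[xz zu].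
  rewrite mulr_gt0// subr_gt0.
  have z0 : 0 < z by exact: le_lt_trans xz.
  have := @gth_ratio_decr (b * z) t (mulr_gt0 b0 z0); rewrite -{1}bu ltr_pM2l// => /(_ zu).
  by rewrite gt -[X in _ < X * _]bu -[b * z * u]mulrA -[b * u * _]mulrA ltr_pM2l// [z * u]mulrC ltr_pM2l.
rewrite -ltrN2; apply: (lt_of_derive (f := fun z => - fCW z b)
  (df := fun z => - (b * (gth (b * z) - z))) ultx).
  by move=> z; have := is_deriveN (is_derive_fCW b z); exact.
move=> z /andP[uz zx]; rewrite oppr_gt0 pmulr_rlt0// subr_lt0.
have := @gth_ratio_decr t (b * z) t0; rewrite -{1}bu ltr_pM2l// => /(_ uz).
by rewrite gt -[X in X * gth _ < _]bu -[b * u * _]mulrA -[b * z * u]mulrA ltr_pM2l// [z * u]mulrC ltr_pM2l.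
Qed.

(** Above the inverse temperature attached to [u], the function still increases on [[0, u]]: either
    [b2 z] stays below [b1 u] and the ratio comparison applies, or [gth (b2 z) >= u > z]. Hence
    [delta_CW] is the least loss incurred on that interval. *)
Lemma fCW_le u b1 b2 : 0 < u -> 0 < b1 -> b1 < b2 -> gth (b1 * u) = u ->
  forall x, 0 <= x <= u -> fCW x b2 <= fCW u b2.
Proof.
move=> u0 b10 b12 gu x /andP[x0 xu].
apply: (le_of_derive xu (is_derive_fCW b2)) => z /andP[xz zu].
have z0 : 0 < z by exact: le_lt_trans xz.
have b20 : 0 < b2 by exact: lt_trans b12.
rewrite mulr_ge0 ?(ltW b20)// subr_ge0.
have [bz|bz] := ltP (b2 * z) (b1 * u); last first.
  by apply: le_trans (ltW zu) _; rewrite -{1}gu; exact: gth_nondecr.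
have := gth_ratio_decr (mulr_gt0 b20 z0) bz; rewrite gu => h.
have g0 : 0 <= gth (b2 * z) by rewrite -gth0; apply: gth_nondecr; rewrite mulr_ge0// ltW.
have : b2 * z * u < b2 * u * gth (b2 * z).
  by apply: (lt_le_trans h); rewrite ler_wpM2r// ler_wpM2r ?ltW.
by rewrite mulrAC ltr_pM2l ?mulr_gt0// => /ltW.
Qed.

Lemma fCW_stationary u b : 0 < u < 1 -> 0 < b ->
  (forall y, 0 <= y <= 1 -> fCW y b <= fCW u b) -> gth (b * u) = u.
Proof.
move=> /andP[u0 u1] b0 hmax.
have d0 : is_derive u 1 (fCW^~ b) 0.
  apply: (@derive1_at_max R (fCW^~ b) 0 1 u ler01).
  - by move=> x _; exact: (@ex_derive _ _ _ _ _ _ _ (is_derive_fCW b x)).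
  - by rewrite in_itv/= u0 u1.
  - by move=> x; rewrite in_itv/= => /andP[? ?]; apply: hmax; rewrite !ltW.
have := @derive_val _ _ _ _ _ _ _ d0; rewrite (@derive_val _ _ _ _ _ _ _ (is_derive_fCW b u)).
by move=> /eqP; rewrite mulf_eq0 gt_eqF//= subr_eq0 => /eqP.
Qed.

End shifted_expectations.

Section curie_weiss_random_field.
Context {d : measure_display} {T : measurableType d} {R : realType}.
Variable P : probability T R.
Variables (h : {RV P >-> R}) (s : R).
Hypothesis gh : gauss_law (distribution P h) s.
Local Notation nu := (distribution P h).

Lemma f_CW_fCW x b : f_CW h x b = fCW nu x b.
Proof.
rewrite /f_CW /fCW expectE; congr (_ + _ - _).
have mf : measurable_fun setT (fun y : R => ln (cosh (b * x + y))).
  by apply: (measurableT_comp measurable_lncosh); exact: measurable_funD.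
rewrite (Ex_comp_law (f := fun y : R => ln (cosh (b * x + y))))//.
exact: (rint_distribution (rint_lncosh_shift gh (b * x))).
Qed.

Lemma alpha_dgth : alpha h = (dgth nu 0)^-1.
Proof.
rewrite /alpha expectE; congr (_^-1).
have E : (fun y : R => sech2 (0 + y)) = (fun y : R => (cosh y ^+ 2)^-1).
  by apply/funext => y; rewrite add0r.
rewrite /dgth E (Ex_comp_law (f := fun y : R => (cosh y ^+ 2)^-1))//.
  exact: continuous_measurable_fun (@continuous_sech2 R).
have := rint_sech2_shift nu 0; rewrite E; exact: rint_distribution.
Qed.

Lemma mu_CW_range b : 0 <= mu_CW h b <= 1.
Proof.
rewrite /mu_CW; case: xgetP => [x -> [/=]|]; first by rewrite in_itv.
by rewrite lexx ler01.
Qed.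

(** The witness [t / u] shows that the choice defining [beta_CW] is not empty; whichever value is
    chosen, [u] is an interior maximiser for it and satisfies the mean-field equation. *)
Lemma beta_CW_spec u : 0 < u < 1 ->
  0 < beta_CW h u /\ gth nu (beta_CW h u * u) = u.
Proof.
move=> u01; have /andP[u0 u1] := u01.
have [t t0 gt] := gth_surj gh u01.
have tu : alpha h < t / u.
  have dg0 := dgth_gt0 gh (lexx 0).
  rewrite alpha_dgth ltr_pdivlMr// mulrC ltr_pdivrMr//.
  by rewrite -{1}gt; exact: (gth_lt_tangent gh t0).
have muE : mu_CW h (t / u) = u.
  have hu : argmax `[0, 1] ((f_CW h)^~ (t / u)) u.
    split; first by rewrite /= in_itv/= !ltW.
    move=> y; rewrite /= in_itv/= => y01; rewrite !f_CW_fCW.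
    have [->//|yu] := eqVneq y u; exact/ltW/(fCW_argmax gh u01 t0 gt).
  have : argmax `[0, 1] ((f_CW h)^~ (t / u)) (mu_CW h (t / u)).
    by rewrite /mu_CW; apply: xgetPex; exists u.
  move=> [/=]; rewrite in_itv/= => m01 /(_ u hu.1); rewrite !f_CW_fCW.
  apply: contra_leP => /eqP mu; exact: (fCW_argmax gh u01 t0 gt).
have : [set b | alpha h < b /\ mu_CW h b = u] (beta_CW h u).
  by apply: (@xgetPex _ 0 [set b | alpha h < b /\ mu_CW h b = u]); exists (t / u).
set b := beta_CW h u => -[ab mub].
have b0 : 0 < b.
  by apply: le_lt_trans ab; rewrite alpha_dgth invr_ge0 dgth_ge0.
split=> //; apply: (fCW_stationary gh u01 b0) => y y01.
have : argmax `[0, 1] ((f_CW h)^~ b) u.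
  (* The default value 0 of [xget] is excluded by [0 < u]. *)
  move: mub; rewrite /mu_CW; case: xgetP => [x -> hx <-//|_ u0'].
  by rewrite -u0' ltxx in u0.
by move=> [_ /(_ y)]; rewrite /= in_itv/= !f_CW_fCW; apply.
Qed.

Lemma f_CW_gt u b x : 0 < u < 1 -> beta_CW h u < b -> 0 <= x ->
  f_CW h u b < f_CW h x b -> u < x.
Proof.
move=> u01 hb x0; have [b0 gb] := beta_CW_spec u01; have /andP[u0 _] := u01.
apply: contraTT; rewrite -!leNgt => xu; rewrite !f_CW_fCW.
by apply: (fCW_le gh u0 b0 hb gb); rewrite x0 xu.
Qed.

End curie_weiss_random_field.

(** * The two peaks *)

Lemma Ex_bernoulli_half {R : realType} (f : bool -> R) :
  rint (bernoulli_prob (2^-1 : R)) f /\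
  Ex (bernoulli_prob (2^-1 : R)) f = 2^-1 * (f true + f false).
Proof.
set Q := bernoulli_prob _.
pose M := `|f true| + `|f false|.
have fM c : `|f c| <= M by case: c; rewrite /M ?lerDl ?lerDr.
have mf : measurable_fun setT f by [].
have iF : rint Q f by exact: (rint_bnd Q mf fM).
split=> //.
(* The Bernoulli integral formula is for nonnegative functions, so [M] is added and subtracted
   again. *)
have iM : rint Q (cst M) by exact: rint_cst.
have half01 : 0 <= (2^-1 : R) <= 1 by rewrite invr_ge0 ler0n invf_le1 ?ler1n.
have := integral_Ex (rintD iF iM).
rewrite integral_bernoulli_prob//; last first.
  by move=> c; rewrite lee_fin -lerBlDr sub0r lerNl (le_trans _ (fM c))// -normrN ler_norm.
rewrite (ExD iF iM) Ex_cst -!EFinM -EFinD /unstable.onem.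
move=> /(congr1 fine) /=.
by clear; move: (Ex Q f) M => x v; lra.
Qed.

Lemma dirac0_ae {d} {T : measurableType d} {R : realType} (P : probability T R)
    (X : {RV P >-> R}) :
  (forall A : set R, measurable A -> distribution P X A = \d_(0 : R) A) ->
  {ae P, forall w, X w = 0}.
Proof.
move=> XE; exists (X @^-1` (~` [set 0])); split.
- by rewrite -[X in measurable X]setTI; apply: measurable_funPT => //; exact: measurableC.
- have := XE (~` [set 0]) (measurableC (measurable_set1 _)).
  rewrite /distribution /pushforward => ->.
  by rewrite diracE (_ : (0 \in _) = false)//; apply/negbTE; rewrite notin_setE/=; apply.
- by move=> w /=.
Qed.

Lemma subexp_law_eq {R : realType} (nu nu' : probability R R) (K : R) :
  (forall A, measurable A -> nu A = nu' A) -> subexp nu K -> subexp nu' K.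
Proof.
move=> nuE h phi c c01 lphi; have [i1 b1] := h phi c c01 lphi.
split; first exact: rint_law_eq nuE _ i1.
rewrite -(Ex_law_eq nuE) (eq_measure_integral nu)// => A mA _; exact/esym/nuE.
Qed.

Lemma subexp_mono {R : realType} (nu : probability R R) (K K' : R) :
  K <= K' -> subexp nu K -> subexp nu K'.
Proof.
move=> KK' h phi c c01 lphi; have [i1 b1] := h phi c c01 lphi.
split=> //; apply: (le_trans b1); rewrite lee_fin ler_expR.
by rewrite ler_wpM2r// sqr_ge0.
Qed.

Lemma gaussian_disorder_of_law d (T : measurableType d) (R : realType)
    (P : probability T R) (h : {RV P >-> R}) (hs : nat -> {RV P >-> R})
    (g : disorder P) (s : R) :
  (forall A : set R, measurable A ->
    distribution P h A = (if s == 0 then \d_(0 : R) A else normal_prob 0 s A)) ->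
  disorder_law h hs g -> exists L, gaussian_disorder hs g s L.
Proof.
move=> hE [hsE gE ind].
have gh : gauss_law (distribution P h) s := gauss_lawP hE.
have ghs i : gauss_law (distribution P (hs i)) s.
  by apply: gauss_lawP => A mA; exact: (etrans (hsE i A mA) (hE A mA)).
have gg p (t : p.*2.-tuple nat) : (1 <= p)%N -> gauss_law (distribution P (g p t)) 1.
  by move=> p1; apply: gauss_lawP => A mA; rewrite oner_eq0; exact: gE.
have [K1 K10 sub1] := subexp_gauss (gauss_exp gh).
(* Any coupling serves as representative, since all have the standard normal law; the larger of the
   two constants then covers fields and couplings. *)
pose t0 : (1%N.*2).-tuple nat := [tuple 0%N | i < 1%N.*2].
have [K2 K20 sub2] := subexp_gauss (gauss_exp (gg 1%N t0 isT)).
exists (Num.max K1 K2); split.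
- exact: ind.
- by move=> [i|[p t]] /= hp; [exact: ghs|exact: gg].
- by rewrite le_max K10.
- move=> [i|[p t]] /= hp.
    apply: (subexp_mono (K := K1)); first by rewrite le_max lexx.
    by apply: subexp_law_eq sub1 => A mA; exact/esym/hsE.
  apply: (subexp_mono (K := K2)); first by rewrite le_max lexx orbT.
  by apply: subexp_law_eq sub2 => A mA; exact: (etrans (gE _ t0 isT A mA) (esym (gE p t hp A mA))).
- move=> [i|[p t]] [i'|[p' t']] //= hp hp' _ A mA.
    exact: (etrans (hsE i A mA) (esym (hsE i' A mA))).
  exact: (etrans (gE p t hp A mA) (esym (gE p' t' hp' A mA))).
Qed.

Section second_moment.
Context {d : measure_display} {T : measurableType d} {R : realType}.
Variable P : probability T R.
Variables (h : {RV P >-> R}) (s : R).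
Hypothesis hE : forall A : set R, measurable A ->
  distribution P h A = (if s == 0 then \d_(0 : R) A else normal_prob 0 s A).

Let mh2 : measurable_fun setT (fun w => (h w ^+ 2)%:E).
Proof. by apply/measurable_EFinP; exact: measurable_funX. Qed.

Lemma second_moment_neq0 : ('E_P[fun w => (h w ^+ 2)%R] <> 0)%E -> s != 0.
Proof.
apply: contra_notN => /eqP s0; rewrite unlock.
have h0 : {ae P, forall w, h w = 0}.
  by apply: dirac0_ae => A mA; rewrite hE// s0 eqxx.
rewrite (ae_eq_integral (cst 0%E))//; first by rewrite integral_cst// mul0e.
by apply: filterS h0 => w hw _; rewrite /= hw expr0n.
Qed.

(** A vanishing second moment forces [h = 0] almost surely, whereas a nondegenerate normal law gives
    no mass to the origin. *)
Lemma second_moment_eq0 : ('E_P[fun w => (h w ^+ 2)%R] = 0)%E -> s = 0.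
Proof.
move=> E0; apply/eqP/negPn/negP => s0.
have h0 : {ae P, forall w, h w = 0}.
  have [+ _] := @ae_eq_integral_abs _ _ _ P setT measurableT _ mh2.
  have -> : (\int[P]_(w in setT) `|(h w ^+ 2)%:E|)%E = 0%E.
    by move: E0; rewrite unlock => E0; rewrite -[RHS]E0; apply: eq_integral => w _;
      rewrite gee0_abs// lee_fin sqr_ge0.
  move=> /(_ erefl); apply: filterS => w /(_ I)/= [] /eqP.
  by rewrite sqrf_eq0 => /eqP.
have := hE (measurable_set1 0); rewrite (negbTE s0).
rewrite /normal_prob integral_set1 /distribution /pushforward => p0.
case: h0 => N [mN N0 hN].
pose B := h @^-1` [set 0].
have mB : measurable B.
  by rewrite /B -[X in measurable X]setTI; exact: measurable_funPT.
have : (P setT <= P (B `|` N))%E.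
  apply: le_measure; rewrite ?inE//.
    exact: measurableU.
  move=> w _; have [hw|hw] := pselect (h w = 0); first by left.
  by right; apply: hN.
rewrite probability_setT => /le_trans/(_ (measureU2 _ mB mN)).
have PB : (P B <= 0)%E by rewrite le_eqVlt; apply/orP; left; exact/eqP.
have PN : (P N <= 0)%E by rewrite N0.
by move=> /le_trans/(_ (leeD PB PN)); rewrite adde0 lee_fin ler10.
Qed.

End second_moment.

Section peaks.
Context {d : measure_display} {T : measurableType d} {R : realType}.
Variable P : probability T R.
Variables (h : {RV P >-> R}) (hs : nat -> {RV P >-> R}) (g : disorder P) (s L : R).
Hypothesis hsE : forall i, same_law (hs i) h.
Hypothesis gh : gauss_law (distribution P h) s.
Hypothesis HM : gaussian_disorder hs g s L.

Lemma logcosh_mean_f_CW b x : logcosh_mean hs (b * x) - b * x ^+ 2 / 2 = f_CW h x b.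
Proof.
have mf : measurable_fun setT (fun y : R => ln (cosh (b * x + y))).
  by apply: (measurableT_comp measurable_lncosh); exact: measurable_funD.
have lawE (A : set R) : measurable A -> P (hs 0%N @^-1` A) = P (h @^-1` A).
  by move=> mA; exact: (hsE 0%N mA).
have [_ E] := Ex_same_law lawE mf (rint_lncosh HM (b * x) 0).
by rewrite /logcosh_mean E /f_CW expectE.
Qed.

(** A unique maximiser would be 0 by evenness, yet nonnegative maximisers exceed [u]; so [Omega]
    consists of two opposite points, and anything outside it is strictly worse. *)
Lemma peaks_of_calR u b bp : 0 < u < 1 -> calR h g hs u (b, bp) ->
  [/\ 0 < b, cvgn (fun n => \sum_(1 <= p < n) 2 ^+ p * bp p ^+ 2) &
  exists2 mu, u < mu < 1 & forall q, -1 <= q <= 1 -> q != mu -> q != - mu ->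
    F_SK g bp (fun i w => b * q + hs i w) - b * q ^+ 2 / 2 <
    F_SK g bp (fun i w => b * mu + hs i w) - b * mu ^+ 2 / 2].
Proof.
move=> u01 [/= [[[b0' bpB] b0 hO] _] hb hxi]; split=> //.
simpl in b0', bpB, b0, hO.
pose pot q := F_SK g bp (fun i w => b * q + hs i w) - b * q ^+ 2 / 2.
have potE q : f_CW h q b <= pot q <= f_CW h q b + xi bp 1 / 2.
  have := F_SK_bounds HM bpB (b * q); rewrite -logcosh_mean_f_CW /pot.
  by move=> /andP[? ?]; apply/andP; split; lra.
have in1 (q : R) : (`[-1, 1]%classic : set R) q <-> -1 <= q <= 1 by rewrite /= in_itv.
(* The chain [f(mu) + xi(1)/2 >= pot mu >= pot (mu_CW h b) >= f(mu_CW h b)] together with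
   [xi(1)/2 < delta_u] yields [f(mu) > f(u)], which [f_CW_gt] converts into [u < mu]. *)
have far mu : 0 <= mu -> Omega g b bp hs mu -> u < mu.
  move=> mu0 [_ hmu]; apply: (f_CW_gt gh u01 hb mu0).
  have /andP[m0 m1] := mu_CW_range h b.
  have hpot : pot (mu_CW h b) <= pot mu.
    by apply: hmu; apply/in1; rewrite m1 andbT (le_trans _ m0)// lerN10.
  have /andP[l1 _] := potE (mu_CW h b); have /andP[_ l2] := potE mu.
  move: hxi; rewrite /delta_CW; lra.
case: hO => [[mu Omu]|[mu [/andP[mu0 mu1] Omu]]].
  have Om : Omega g b bp hs mu by rewrite Omu.
  have OmN : Omega g b bp hs (- mu).
    case: Om => m1 hmu; split.
      by apply/in1; move/in1: m1 => /andP[? ?]; apply/andP; split; lra.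
    by move=> y y1; rewrite mulrN (F_SK_even HM bpB) sqrrN; exact: hmu.
  have mu0 : mu = 0 by move: OmN; rewrite Omu /= => ?; lra.
  have /andP[u0 _] := u01.
  have : u < 0 by apply: far; rewrite -?mu0.
  by move=> /(lt_trans u0); rewrite ltxx.
have Om : Omega g b bp hs mu by rewrite Omu; left.
exists mu; first by rewrite mu1 andbT; apply: far => //; exact: ltW.
move=> q q1 qm qN; have hmu y : -1 <= y <= 1 -> pot y <= pot mu.
  by move=> y1; have [_ /(_ y)] := Om; apply; apply/in1.
suff : pot q < pot mu by [].
rewrite lt_neqAle hmu// andbT; apply/eqP => E.
have : Omega g b bp hs q.
  split; first exact/in1.
  by move=> y /in1 y1; have := hmu y y1; rewrite -E.
by rewrite Omu => -[] /= E'; [rewrite E' eqxx in qm|rewrite E' eqxx in qN].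
Qed.

End peaks.

Theorem proposition6 (R : realType) (d : measure_display)
    (T : measurableType d) (P : probability T R)
    (h : {RV P >-> R}) (hs : nat -> {RV P >-> R}) (g : disorder P)
    (h_gauss : centered_gaussian h) (h_moment : moment_condition h)
    (hg_law : disorder_law h hs g) :
  (forall u : R, 0 < u < 1 -> ('E_P[fun w => (h w ^+ 2)%R] = 0)%E ->
    forall (b : R) (bp : nat -> R), calR h g hs u (b, bp) ->
    exists2 mu : R, u < mu < 1 &
      forall eps : R, 0 < eps < mu ->
        {ae P, forall w,
          gibbs_near g b bp hs mu eps N w @[N --> \oo] --> (2^-1 : R)} /\
        {ae P, forall w,
          gibbs_near g b bp hs (- mu) eps N w @[N --> \oo] --> (2^-1 : R)}) /\
  (forall u : R, 2^-1 < u < 1 -> ('E_P[fun w => (h w ^+ 2)%R] <> 0)%E ->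
    forall (b : R) (bp : nat -> R), calR h g hs u (b, bp) ->
    exists2 mu : R, u < mu < 1 &
      forall eps : R, 0 < eps < mu ->
        cvg_weakly P (gibbs_near g b bp hs mu eps)
          (bernoulli_prob 2^-1) (fun c : bool => c%:R) /\
        cvg_weakly P (gibbs_near g b bp hs (- mu) eps)
          (bernoulli_prob 2^-1) (fun c : bool => c%:R)).
Proof.
have [s s0 hE] := h_gauss.
have gh : gauss_law (distribution P h) s := gauss_lawP hE.
have [L HM] := gaussian_disorder_of_law hE hg_law.
have [hsE _ _] := hg_law.
split=> u u01 Eh b bp hR.
  have sE : s = 0 := second_moment_eq0 hE Eh.
  have [b0 bpB [mu mu1 peaks]] := peaks_of_calR hsE gh HM u01 hR.
  exists mu => // eps em.
  have hs0 i : {ae P, forall w, hs i w = 0}.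
    by apply: dirac0_ae => A mA; have := etrans (hsE i A mA) (hE A mA); rewrite sE eqxx.
  have half x : x = mu \/ x = - mu ->
      {ae P, forall w, gibbs_near g b bp hs x eps N w @[N --> \oo] --> (2^-1 : R)}.
    move=> xmu; apply: filterS (cvg_half_of_symmetric HM bpB b0 em peaks xmu hs0) => w.
    suff -> : (fun N => gibbs_near g b bp (fun i => hs i) x eps N w) =
      (fun N => Wp hs g bp b x eps N w) by [].
    by apply/funext => N; exact: gibbs_near_av.
  by split; apply: half; [left|right].
have u01' : 0 < u < 1.
  by case/andP: u01 => u2 ->; rewrite andbT; apply: lt_trans u2; rewrite invr_gt0.
have s1 : s != 0 := second_moment_neq0 hE Eh.
have [b0 bpB [mu mu1 peaks]] := peaks_of_calR hsE gh HM u01' hR.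
exists mu => // eps em.
have weak x : x = mu \/ x = - mu ->
    cvg_weakly P (gibbs_near g b bp hs x eps) (bernoulli_prob 2^-1) (fun c : bool => c%:R).
  move=> xmu phi cphi [M bphi].
  have [iB EB] := Ex_bernoulli_half (fun c : bool => phi c%:R).
  rewrite (expectation_Ex iB) EB.
  have mphi : measurable_fun setT phi by exact: continuous_measurable_fun.
  have gE N : gibbs_near g b bp (fun i => hs i) x eps N = (fun w => Wp hs g bp b x eps N w).
    by apply/funext => w; exact: gibbs_near_av.
  have iW N : rint P (phi \o gibbs_near g b bp hs x eps N).
    rewrite gE; have mW : measurable_fun setT (phi \o (fun w => Wp hs g bp b x eps N w)).
      by apply: (measurableT_comp mphi); exact: measurable_Wp.
    exact: (rint_bnd P mW (fun w => bphi _)).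
  have EN : (fun N => 'E_P[phi \o gibbs_near g b bp (fun i => hs i) x eps N])%E =
      (fun N => (Ex P (fun w => phi (Wp hs g bp b x eps N w)))%:E).
    by apply/funext => N; rewrite (expectation_Ex (iW N)) gE.
  rewrite EN; apply: cvg_EFin; first exact: nearW.
  exact: (cvg_Ex_half HM bpB b0 em peaks xmu s1 cphi bphi).
by split; apply: weak; [left|right].
Qed.
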